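(* Let $(V,\Upsilon(z),c,\rho)$ be a graded vertex operator coalgebra with $V_0\not\subseteq\ker c$ and $V_2\not\subseteq\ker\rho$, and let $g\in\mathrm{Aut}\,V$ be an automorphism of finite order $T$. Let $V'$ be the dual vertex operator algebra, and assume that the higher level twisted Zhu algebras satisfy $\dim A_{k,g^{-1}}(V')<\infty$ for all $k\in\frac1T\mathbb N$. Then $V$ is $g$-corational if and only if $V'$ is a $g^{-1}$-rational vertex operator algebra.
   Context: All vector spaces are over $\mathbb C$; $\mathbb N=\{0,1,2,\dots\}$; $\tau(v\otimes w)=w\otimes v$; $(z_1+z_2)^n$ is expanded in nonnegative powers of $z_2$; $\delta(x)=\sum_{n\in\mathbb Z}x^n$; $\mathrm{Res}_z$ is the coefficient of $z^{-1}$. Graded vertex operator coalgebra $(V,\Upsilon(z),c,\rho)$: $V=\bigoplus_{s\in\mathbb Z}V_s$, $\dim V_s<\infty$, $V_s=0$ for $s\ll0$; linear maps $c,\rho:V\to\mathbb C$ and $\Upsilon(z):V\to(V\otimes V)[[z,z^{-1}]]$, $\Upsilon(z)v=\sum_{k\in\mathbb Z}\Delta_k(v)z^{-k-1}$, with: (1) $\Delta_k(v)=0$ for $k\ll0$ and $\Delta_k(V_s)\subseteq(V\otimes V)_{s+k+1}$; (2) $(c\otimes\mathrm{Id})\Upsilon(z)v=v$, $(\mathrm{Id}\otimes c)\Upsilon(z)v\in V[[z]]$ with constant term $v$; (3) Jacobi identity $z_0^{-1}\delta(\frac{z_1-z_2}{z_0})(\mathrm{Id}\otimes\Upsilon(z_2))\Upsilon(z_1)-z_0^{-1}\delta(\frac{z_2-z_1}{-z_0})(\tau\otimes\mathrm{Id})(\mathrm{Id}\otimes\Upsilon(z_1))\Upsilon(z_2)=z_1^{-1}\delta(\frac{z_2+z_0}{z_1})(\Upsilon(z_0)\otimes\mathrm{Id})\Upsilon(z_2)$;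 (4) writing $(\rho\otimes\mathrm{Id})\Upsilon(z)=\sum_kL(k)z^{k-2}$, the operators $L(k)\in\mathrm{End}(V)$ satisfy $[L(k),L(j)]=(k-j)L(k+j)+\frac{k^3-k}{12}\delta_{k+j,0}d$ for a constant $d$, $V_s$ is the $s$-eigenspace of $L(0)$, and $(L(1)\otimes\mathrm{Id})\Upsilon(z)=\frac{d}{dz}\Upsilon(z)$. Automorphisms: linear bijections $g:V\to V$ with $c\circ g=c$, $\rho\circ g=\rho$, $\Upsilon(z)g=(g\otimes g)\Upsilon(z)$. For $g$ of order $T$: $V^{(r)}=\{v: gv=e^{2\pi ir/T}v\}$, $0\le r\le T-1$. $\frac{\ln g}{2\pi i}$ acts on $V^{(r)}$ as $\frac rT$; $z^\phi v=z^\lambda v$ if $\phi v=\lambda v$. Weak $g$-twisted $V$-comodule: a vector space $\mathcal M$ with a linear map $\Upsilon_{\mathcal M}(z)m=\sum_{k\in\mathbb Z}(z^{-\frac{\ln g}{2\pi i}}\otimes\mathrm{Id})\Delta_{\mathcal M,k}(m)z^{-k-1}$, $\Delta_{\mathcal M,k}:\mathcal M\to V\otimes\mathcal M$, with: (i) $\Delta_{\mathcal M,k}(m)=0$ for $k\ll0$, $(c\otimes\mathrm{Id})\Upsilon_{\mathcal M}(z)=\mathrm{Id}$; (ii) $z_0^{-1}\delta(\frac{z_1-z_2}{z_0})(\mathrm{Id}\otimes\Upsilon_{\mathcal M}(z_2))\Upsilon_{\mathcal M}(z_1)-z_0^{-1}\delta(\frac{z_2-z_1}{-z_0})(\tau\otimes\mathrm{Id})(\mathrm{Id}\otimes\Upsilon_{\mathcal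 M}(z_1))\Upsilon_{\mathcal M}(z_2)=z_2^{-1}\delta(\frac{z_1-z_0}{z_2})((\frac{z_1-z_0}{z_2})^{-\frac{\ln g}{2\pi i}}\otimes\mathrm{Id}\otimes\mathrm{Id})(\Upsilon(z_0)\otimes\mathrm{Id})\Upsilon_{\mathcal M}(z_2)$; (iii) writing $(\rho\otimes\mathrm{Id})\Upsilon_{\mathcal M}(z)=\sum_kL(k)z^{k-2}$, $L(k)\in\mathrm{End}(\mathcal M)$ satisfy the same Virasoro relations; (iv) $(L(1)\otimes\mathrm{Id})\Upsilon_{\mathcal M}(z)=\frac d{dz}\Upsilon_{\mathcal M}(z)=\Upsilon_{\mathcal M}(z)L(1)-(\mathrm{Id}\otimes L(1))\Upsilon_{\mathcal M}(z)$. It is admissible if $\mathcal M=\bigoplus_{t\in\frac1T\mathbb N}M_t$ with $\Delta_{\mathcal M,k}(M_t)\subseteq\bigoplus_{r=0}^{T-1}(V^{(r)}\otimes\mathcal M)_{t+k+1+\frac rT}$. Admissible subcomodules are graded subspaces $\mathcal N$ with $\Delta_{\mathcal M,k}(\mathcal N)\subseteq V\otimes\mathcal N$; $\mathcal M$ is irreducible if it has no nontrivial one, completely reducible if it is a direct sum of irreducible ones. $V$ is $g$-corational if every admissible $g$-twisted $V$-comodule is completely reducible. Dual: $V'=\bigoplus_sV_s^*$ is a vertex operator algebra with $\mathbf 1=c|_{V_0}$, $\omega=\rho|_{V_2}$, $(Y(u^*,z)v^*,v)=(u^*\otimes v^*,\Upsilon(z)v)$; $g$ acts on $V'$ as an automorphism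 of order $T$ by $(g(v^* ),v)=(v^*,g^{-1}(v))$, so $(g^{-1}(v^* ),v)=(v^*,g(v))$. Twisted modules: for a vertex operator algebra $\mathcal V$ and $h\in\mathrm{Aut}\,\mathcal V$ of order $T$, $\mathcal V^{(r)}=\{v:hv=e^{2\pi ir/T}v\}$. A weak $h$-twisted $\mathcal V$-module is a vector space $\mathcal N$ with $Y_{\mathcal N}(u,z)=\sum_{t\in\mathbb Z+r/T}u_tz^{-t-1}$ ($u\in\mathcal V^{(r)}$, $u_t\in\mathrm{End}\,\mathcal N$), $u_tn=0$ for $t\gg0$, $Y_{\mathcal N}(\mathbf 1,z)=\mathrm{Id}$, and for $u\in\mathcal V^{(r)},v\in\mathcal V$: $z_0^{-1}\delta(\frac{z_1-z_2}{z_0})Y_{\mathcal N}(u,z_1)Y_{\mathcal N}(v,z_2)-z_0^{-1}\delta(\frac{-z_2+z_1}{z_0})Y_{\mathcal N}(v,z_2)Y_{\mathcal N}(u,z_1)=z_2^{-1}\delta(\frac{z_1-z_0}{z_2})(\frac{z_1-z_0}{z_2})^{-r/T}Y_{\mathcal N}(Y(u,z_0)v,z_2)$. It is admissible if $\mathcal N=\bigoplus_{t\in\frac1T\mathbb N}N_t$ with $a_sN_t\subseteq N_{\mathrm{wt}\,a+t-s-1}$ for homogeneous $a$. $\mathcal V$ is $h$-rational if every admissible $h$-twisted module is a direct sum of irreducible admissible $h$-twisted submodules. Higher level twisted Zhu algebra (Dong–Li–Mason): for $h\in\mathrm{Aut}\,\mathcal V$ of order $T$ and $k=l+\frac iT$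 with $l\in\mathbb N$, $0\le i\le T-1$, put for $0\le r\le T-1$: $\delta_i(r)=1$ if $i\ge r$, $\delta_i(r)=0$ if $i<r$, and $\delta_i(T)=0$. $O_{k,h}(\mathcal V)$ is the span of all $L(-1)u+L(0)u$ ($u\in\mathcal V$) and all $\mathrm{Res}_z\frac{(1+z)^{\mathrm{wt}\,u-1+\delta_i(r)+l+r/T}}{z^{2l+\delta_i(r)+\delta_i(T-r)+1}}Y(u,z)v$ with $u\in\mathcal V^{(r)}$ homogeneous, $v\in\mathcal V$; $A_{k,h}(\mathcal V)=\mathcal V/O_{k,h}(\mathcal V)$. *)

(* Defs.v *)
From HB Require Import structures.
From mathcomp Require Import all_boot all_order all_algebra.
From mathcomp Require Import generic_quotient complex.
From mathcomp Require Import boolp classical_sets functions cardinality fsbigop.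
From mathcomp Require Import reals topology normedtype trigo.

Set Implicit Arguments.
Unset Strict Implicit.
Unset Printing Implicit Defensive.

Import Order.TTheory GRing.Theory Num.Theory.
Local Open Scope quotient_scope.
Local Open Scope classical_set_scope.
Local Open Scope ring_scope.

(* Tensor product of two vector spaces: finite formal sums of pairs (v, w),*)
(* written as lists, modulo the congruence generated by commutativity of   *)
(* the sum, biadditivity, and (a v, w) ~ (v, a w).                         *)

Lemma linear_fun_sum (K : pzRingType) (V W : lmodType K) (f : V -> W) :
  linear f -> forall n (a : 'I_n -> K) (x : 'I_n -> V),
  f (\sum_i a i *: x i) = \sum_i a i *: f (x i).
Proof.
move=> fl; have f0 : f 0 = 0.
  by have := fl (- 1) 0 0; rewrite scaler0 addr0 scaleN1r addNr.
elim=> [|n IH] a x; first by rewrite !big_ord0.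
by rewrite !big_ord_recl fl IH.
Qed.

Section Tensor.
Variables (K : fieldType) (V W : lmodType K).

Inductive tcong : seq (V * W) -> seq (V * W) -> Prop :=
| tcong_refl s : tcong s s
| tcong_sym s t : tcong s t -> tcong t s
| tcong_trans s t u : tcong s t -> tcong t u -> tcong s u
| tcong_cat s s' t t' : tcong s s' -> tcong t t' -> tcong (s ++ t) (s' ++ t')
| tcong_catC s t : tcong (s ++ t) (t ++ s)
| tcong0 w : tcong [:: (0, w)] [::]
| tcongDl v v' w : tcong [:: (v + v', w)] [:: (v, w); (v', w)]
| tcongDr v w w' : tcong [:: (v, w + w')] [:: (v, w); (v, w')]
| tcongZ a v w : tcong [:: (a *: v, w)] [:: (v, a *: w)].

Definition tcongb : rel (seq (V * W)) := fun s t => `[< tcong s t >].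

Lemma tcongb_refl : reflexive tcongb.
Proof. by move=> s; apply/asboolP; exact: tcong_refl. Qed.

Lemma tcongb_sym : symmetric tcongb.
Proof. by move=> s t; apply/asboolP/asboolP; exact: tcong_sym. Qed.

Lemma tcongb_trans : transitive tcongb.
Proof.
move=> t s u /asboolP st /asboolP tu.
by apply/asboolP; exact: tcong_trans st tu.
Qed.

Canonical tcong_equiv := EquivRel tcongb tcongb_refl tcongb_sym tcongb_trans.

Definition tensor := {eq_quot tcong_equiv}.

HB.instance Definition _ := Choice.on tensor.
HB.instance Definition _ := Quotient.on tensor.
HB.instance Definition _ := EqQuotient.on tensor.

Implicit Types s t : seq (V * W).

Lemma tensor_eqP s t : tcong s t <-> \pi_tensor s = \pi_tensor t.
Proof.
split=> [st|/eqmodP/asboolP //].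
by apply/eqmodP/asboolP.
Qed.

Lemma tcong_repr s : tcong (repr (\pi_tensor s)) s.
Proof. by apply/tensor_eqP; rewrite reprK. Qed.

Definition tensor_add (x y : tensor) : tensor := \pi_tensor (repr x ++ repr y).
Definition tensor_zero : tensor := \pi_tensor [::].
Definition tscale_seq (a : K) s := [seq (a *: p.1, p.2) | p <- s].
Definition tensor_scale (a : K) (x : tensor) : tensor :=
  \pi_tensor (tscale_seq a (repr x)).
Definition tensor_opp (x : tensor) : tensor := tensor_scale (- 1) x.

Lemma tcong_scale a s t : tcong s t -> tcong (tscale_seq a s) (tscale_seq a t).
Proof.
elim=> {s t} /=.
- by move=> s; exact: tcong_refl.
- by move=> s t _; exact: tcong_sym.
- by move=> s t u _ + _; exact: tcong_trans.
- by move=> s s' t t' _ + _; rewrite /tscale_seq !map_cat; exact: tcong_cat.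
- by move=> s t; rewrite /tscale_seq !map_cat; exact: tcong_catC.
- by move=> w; rewrite scaler0; exact: tcong0.
- by move=> v v' w; rewrite scalerDr; exact: tcongDl.
- by move=> v w w'; exact: tcongDr.
- by move=> b v w; rewrite scalerA mulrC -scalerA; exact: tcongZ.
Qed.

Lemma pi_cat s t :
  \pi_tensor (s ++ t) = tensor_add (\pi_tensor s) (\pi_tensor t).
Proof.
by apply/tensor_eqP; apply: tcong_cat; apply: tcong_sym; exact: tcong_repr.
Qed.

Lemma pi_tscale a s :
  \pi_tensor (tscale_seq a s) = tensor_scale a (\pi_tensor s).
Proof.
by apply/tensor_eqP; apply: tcong_scale; apply: tcong_sym; exact: tcong_repr.
Qed.

Lemma tensor_addA : associative tensor_add.
Proof.
elim/quotW=> s; elim/quotW=> t; elim/quotW=> u.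
by rewrite -(pi_cat t u) -(pi_cat s t) -(pi_cat s) -(pi_cat _ u) catA.
Qed.

Lemma tensor_addC : commutative tensor_add.
Proof.
elim/quotW=> s; elim/quotW=> t; rewrite -!pi_cat.
by apply/tensor_eqP; exact: tcong_catC.
Qed.

Lemma tensor_add0 : left_id tensor_zero tensor_add.
Proof. by elim/quotW=> s; rewrite /tensor_zero -pi_cat. Qed.

Lemma tcong_cancel s : tcong (tscale_seq (- 1) s ++ s) [::].
Proof.
elim: s => [|[v w] s IH] /=; first exact: tcong_refl.
have H1 : tcong ((- 1 *: v, w) :: tscale_seq (- 1) s ++ (v, w) :: s)
    (([:: (- 1 *: v, w)] ++ [:: (v, w)]) ++ (tscale_seq (- 1) s ++ s)).
  rewrite -cat1s -catA; apply: tcong_cat; first exact: tcong_refl.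
  rewrite -(cat1s _ s) !catA; apply: tcong_cat; last exact: tcong_refl.
  exact: tcong_catC.
apply: (tcong_trans H1); apply: (@tcong_trans _ ([::] ++ [::])) => //.
  apply: tcong_cat => //.
  apply: (@tcong_trans _ [:: (- 1 *: v + v, w)]).
    exact: tcong_sym (tcongDl _ _ _).
  by rewrite scaleN1r addNr; exact: tcong0.
exact: tcong_refl.
Qed.

Lemma tensor_addN : left_inverse tensor_zero tensor_opp tensor_add.
Proof.
elim/quotW=> s; rewrite /tensor_opp -pi_tscale -pi_cat.
by apply/tensor_eqP; exact: tcong_cancel.
Qed.

HB.instance Definition _ := GRing.isZmodule.Build tensor
  tensor_addA tensor_addC tensor_add0 tensor_addN.

Lemma tensor_scaleA a b (x : tensor) :
  tensor_scale a (tensor_scale b x) = tensor_scale (a * b) x.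
Proof.
elim/quotW: x => s; rewrite -(pi_tscale b) -(pi_tscale a) -(pi_tscale (a * b)).
congr (\pi_tensor _); rewrite /tscale_seq -map_comp.
by apply: eq_map => p /=; rewrite scalerA.
Qed.

Lemma tensor_scale1 : left_id 1 tensor_scale.
Proof.
elim/quotW=> s; rewrite -(pi_tscale 1); congr (\pi_tensor _).
by rewrite -[RHS]map_id; apply: eq_map => -[v w] /=; rewrite scale1r.
Qed.

Lemma tensor_scaleDr : right_distributive tensor_scale +%R.
Proof.
move=> a; elim/quotW=> s; elim/quotW=> t.
rewrite /GRing.add /= -(pi_cat s t) -(pi_tscale a s) -(pi_tscale a t).
by rewrite -(pi_tscale a (s ++ t)) -(pi_cat _ (tscale_seq a t)) -map_cat.
Qed.

Lemma tensor_scaleDl (x : tensor) :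
  {morph tensor_scale^~ x : a b / a + b >-> a + b}.
Proof.
move=> a b; elim/quotW: x => s; rewrite -(pi_tscale (a + b)).
rewrite -(pi_tscale a) -(pi_tscale b) [RHS]/GRing.add /=.
rewrite -(pi_cat _ (tscale_seq b s)); apply/tensor_eqP; elim: s => [|[v w] s IH] /=; first exact: tcong_refl.
rewrite scalerDl.
apply: (@tcong_trans _ ([:: (a *: v, w); (b *: v, w)] ++
    (tscale_seq a s ++ tscale_seq b s))).
  by rewrite -cat1s; apply: tcong_cat => //; exact: tcongDl.
set A := tscale_seq a s; set B := tscale_seq b s.
set x := (a *: v, w); set y := (b *: v, w).
change (tcong ([:: x] ++ (([:: y] ++ A) ++ B)) ([:: x] ++ (A ++ ([:: y] ++ B)))).
rewrite (catA A); apply: tcong_cat; first exact: tcong_refl.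
by apply: tcong_cat; [exact: tcong_catC | exact: tcong_refl].
Qed.

HB.instance Definition _ := GRing.Zmodule_isLmodule.Build K tensor
  tensor_scaleA tensor_scale1 tensor_scaleDr tensor_scaleDl.

Definition tens (v : V) (w : W) : tensor := \pi_tensor [:: (v, w)].

(* The map V (x) W -> U induced by f; it is the expected linear map when f  *)
(* is bilinear (tlift_tens, tlift_linear), the only case used below.        *)
Definition tlift (U : lmodType K) (f : V -> W -> U) (x : tensor) : U :=
  \sum_(p <- repr x) f p.1 p.2.

Definition bilinear_fun (U : lmodType K) (f : V -> W -> U) :=
  (forall w, linear (f^~ w)) /\ (forall v, linear (f v)).

Lemma pi_sum s : \pi_tensor s = \sum_(p <- s) tens p.1 p.2.
Proof.
elim: s => [|[v w] s IH]; first by rewrite big_nil.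
by rewrite big_cons /= -IH -cat1s pi_cat.
Qed.

Lemma tensor_sumE (x : tensor) : x = \sum_(p <- repr x) tens p.1 p.2.
Proof. by rewrite -pi_sum reprK. Qed.

Lemma tens_bilinear : bilinear_fun tens.
Proof.
have Dl v v' w : tens (v + v') w = tens v w + tens v' w.
  by rewrite /tens [RHS]/GRing.add /= -pi_cat; apply/tensor_eqP/tcongDl.
have Dr v w w' : tens v (w + w') = tens v w + tens v w'.
  by rewrite /tens [RHS]/GRing.add /= -pi_cat; apply/tensor_eqP/tcongDr.
have Zl a v w : tens (a *: v) w = a *: tens v w.
  by rewrite /tens [RHS]/GRing.scale /= -pi_tscale.
have Zr a v w : tens v (a *: w) = a *: tens v w.
  by rewrite -Zl; apply/esym/tensor_eqP/tcongZ.
by split=> z a x y; rewrite ?Dl ?Dr ?Zl ?Zr.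
Qed.

Section Lift.
Variables (U : lmodType K) (f : V -> W -> U).
Hypothesis fbil : bilinear_fun f.

Lemma tcong_lift s t : tcong s t ->
  \sum_(p <- s) f p.1 p.2 = \sum_(p <- t) f p.1 p.2.
Proof.
have [fl fr] := fbil.
elim=> {s t} //=.
- by move=> s t u _ -> _ ->.
- by move=> s s' t t' _ ES _ ET; rewrite !big_cat /= ES ET.
- by move=> s t; rewrite !big_cat /= addrC.
- move=> w; rewrite big_seq1 big_nil /=.
  by have := fl w (- 1) 0 0; rewrite scaler0 addr0 scaleN1r addNr.
- move=> v v' w; rewrite big_seq1 !big_cons big_nil addr0 /=.
  by have := fl w 1 v v'; rewrite !scale1r.
- move=> v w w'; rewrite big_seq1 !big_cons big_nil addr0 /=.
  by have := fr v 1 w w'; rewrite !scale1r.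
- move=> a v w; rewrite !big_seq1 /=.
  have z1 : f 0 w = 0.
    by have := fl w (- 1) 0 0; rewrite scaler0 addr0 scaleN1r addNr.
  have z2 : f v 0 = 0.
    by have := fr v (- 1) 0 0; rewrite scaler0 addr0 scaleN1r addNr.
  have := fl w a v 0; have := fr v a w 0.
  by rewrite !addr0 z1 z2 !addr0 => -> ->.
Qed.

Lemma tlift_pi s : tlift f (\pi_tensor s) = \sum_(p <- s) f p.1 p.2.
Proof. exact: tcong_lift (tcong_repr s). Qed.

Lemma tlift_tens v w : tlift f (tens v w) = f v w.
Proof. by rewrite tlift_pi big_seq1. Qed.

Lemma tlift_linear : linear (tlift f).
Proof.
move=> a; elim/quotW=> s; elim/quotW=> t.
rewrite [_ *: _]/GRing.scale [_ + _ in LHS]/GRing.add /=.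
rewrite -pi_tscale -pi_cat !tlift_pi big_cat /=; congr (_ + _).
rewrite big_map scaler_sumr; apply: eq_bigr => -[v w] _ /=.
have [fl _] := fbil; have := fl w a v 0.
have -> : f 0 w = 0.
  by have := fl w (- 1) 0 0; rewrite scaler0 addr0 scaleN1r addNr.
by rewrite !addr0.
Qed.

End Lift.

End Tensor.

Section TensorMaps.
Variable K : fieldType.
Implicit Types U V W : lmodType K.

Definition tmap V V' W W' (f : V -> V') (h : W -> W') :
    tensor V W -> tensor V' W' :=
  tlift (fun v w => tens (f v) (h w)).

(* f (x) Id and Id (x) f for a functional f, with C (x) W = W = W (x) C. *)
Definition tcontr_l V W (f : V -> K) : tensor V W -> W :=
  tlift (fun v w => f v *: w).
Definition tcontr_r V W (f : W -> K) : tensor V W -> V :=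
  tlift (fun v w => f w *: v).

(* u (x) v as a functional on V (x) W. *)
Definition tpair V W (u : V -> K) (v : W -> K) : tensor V W -> K^o :=
  tlift (fun x y => (u x * v y : K^o)).

Definition tassoc U V W : tensor (tensor U V) W -> tensor U (tensor V W) :=
  tlift (fun x w => tlift (fun u v => tens u (tens v w)) x).

(* tau (x) Id, the triple tensor product being bracketed to the right. *)
Definition tswap12 U V W : tensor U (tensor V W) -> tensor V (tensor U W) :=
  tlift (fun u y => tlift (fun v w => tens v (tens u w)) y).

Lemma tmap_pi V V' W W' (f : {linear V -> V'}) (h : {linear W -> W'}) s :
  tmap f h (\pi_(tensor V W) s) = \pi_(tensor V' W') [seq (f p.1, h p.2) | p <- s].
Proof.
have [tl tr] := @tens_bilinear _ V' W'.
rewrite /tmap tlift_pi ?pi_sum ?big_map//.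
by split=> [w a x y|v a x y] /=; rewrite linearP ?tl ?tr.
Qed.

Lemma tcontr_l_bilinear V W (f : {scalar V}) :
  bilinear_fun (fun (v : V) (w : W) => f v *: w).
Proof.
split=> [w a x y|v a x y] /=; first by rewrite linearP scalerDl scalerA.
by rewrite scalerDr !scalerA mulrC.
Qed.

Lemma tcontr_l0 V W (f : {scalar V}) : tcontr_l f (0 : tensor V W) = 0.
Proof.
by rewrite /tcontr_l (tlift_pi (tcontr_l_bilinear _ f) [::]) big_nil.
Qed.

Lemma tcontr_l_tmap V W (f : {scalar V}) (g : {linear V -> V})
    (h : {linear W -> W}) (x : tensor V W) :
  (forall v, f (g v) = f v) -> tcontr_l f (tmap g h x) = h (tcontr_l f x).
Proof.
move=> fg; elim/quotW: x => s; rewrite tmap_pi /tcontr_l.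
rewrite !(tlift_pi (tcontr_l_bilinear _ f)) big_map linear_sum /=.
by apply: eq_bigr => p _; rewrite fg linearZ.
Qed.

End TensorMaps.

Section Subspaces.
Variables (K : fieldType) (V : lmodType K).
Implicit Types A N : set V.

Definition is_subspace A :=
  A 0 /\ forall (a : K) u v, A u -> A v -> A (a *: u + v).

Definition lspan (S : set V) : set V :=
  [set v | exists n (a : 'I_n -> K) (x : 'I_n -> V),
     (forall i, S (x i)) /\ v = \sum_i a i *: x i].

Definition finite_dim A :=
  exists n (x : 'I_n -> V), forall v, A v -> lspan (range x) v.

(* dim (V / A) < oo : the classes of finitely many vectors span V / A. *)
Definition finite_codim A :=
  exists n (x : 'I_n -> V), forall v, exists2 w, lspan (range x) w & A (v - w).

(* f is the family of components of v with respect to the family A. *)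
Definition decomposition (I : choiceType) (A : I -> set V) (v : V)
    (f : I -> V) :=
  [/\ finite_set [set i | f i <> 0], forall i, A i (f i)
    & v = \sum_(i \in [set: I]) f i].

Definition direct_sum (I : choiceType) (A : I -> set V) :=
  (forall i, is_subspace (A i)) /\
  (forall v, exists! f, decomposition A v f).

Definition component (I : choiceType) (A : I -> set V) (i : I) (v : V) : V :=
  xget (fun=> 0) [set f | decomposition A v f] i.

Section Components.
Variables (I : choiceType) (A : I -> set V).
Hypothesis dA : direct_sum A.

Lemma component_decomposition v :
  decomposition A v (fun i => component A i v).
Proof.
have [_ /(_ v)[f [fd _]]] := dA.
exact: (xgetPex (fun=> 0) (ex_intro [set f | decomposition A v f] f fd)).
Qed.

Lemma decomposition_uniq v f f' :
  decomposition A v f -> decomposition A v f' -> f = f'.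
Proof.
have [_ /(_ v)[f0 [_ u]]] := dA.
by move=> /u <- /u <-.
Qed.

Lemma component_eq v f i : decomposition A v f -> component A i v = f i.
Proof.
move=> df; have := decomposition_uniq (component_decomposition v) df.
by move=> /(congr1 (@^~ i)).
Qed.

Lemma decomposition_homogeneous i v : A i v ->
  decomposition A v (fun j => if j == i then v else 0).
Proof.
have [sub _] := dA; move=> vi; split.
- by apply: sub_finite_set (finite_set1 i) => j /=; case: eqVneq.
- by move=> j; case: eqVneq => [->//|_]; have [] := sub j.
- rewrite -(fsbig_widen [set i])// => [|j [_ /= /eqP/negPf ->]//].
  by rewrite fsbig_set1 eqxx.
Qed.

Lemma component_in i v : A i v -> component A i v = v.
Proof. by move/decomposition_homogeneous/component_eq ->; rewrite eqxx. Qed.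

Lemma component_out i j v : A i v -> i <> j -> component A j v = 0.
Proof.
move/decomposition_homogeneous/component_eq -> => ij.
by case: eqVneq => // e; case: ij.
Qed.

Lemma component_linear i : linear (component A i).
Proof.
have [sub _] := dA; move=> a u v.
have [fu Au Su] := component_decomposition u.
have [fv Av Sv] := component_decomposition v.
rewrite (@component_eq _ (fun i => a *: component A i u + component A i v))//.
have fU : finite_set ([set i | component A i u <> 0] `|`
    [set i | component A i v <> 0]) by rewrite finite_setU.
split.
- apply: sub_finite_set fU => j /= nz; apply: contrapT => /not_orP[].
  by move=> /contrapT e1 /contrapT e2; apply: nz; rewrite e1 e2 scaler0 addr0.
- by move=> j; have [_ sj] := sub j; apply: sj.
- rewrite {1}Su {1}Sv.
  have W (f : I -> V) : (forall j, component A j u = 0 -> component A j v = 0 ->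
      f j = 0) -> \sum_(j \in [set: I]) f j = \sum_(j \in
        [set i | component A i u <> 0] `|` [set i | component A i v <> 0]) f j.
    move=> f0; apply/esym/fsbig_widen => // j [_ /= /not_orP[]].
    by move=> /contrapT e1 /contrapT e2; exact: f0.
  rewrite (W (fun i => component A i u))//.
  rewrite (W (fun i => component A i v))//.
  rewrite (W (fun i => a *: component A i u + component A i v)); last first.
    by move=> j -> ->; rewrite scaler0 addr0.
  by rewrite !fsbig_finite//= big_split/= scaler_sumr.
Qed.

End Components.

Definition graded_subspace (I : choiceType) (A : I -> set V) N :=
  is_subspace N /\ forall v, N v -> forall i, N (component A i v).

End Subspaces.

(* A formal series in z is given by its coefficients                       *)
(* e |-> [z^e], with e rational, and a formal series in z0, z1, z2 by its  *)
(* coefficients a b c |-> [z0^a z1^b z2^c].                                *)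

Section Formal.
Variable R : realType.
Local Notation C := R[i].

Definition fser3 (U : Type) := rat -> rat -> rat -> U.

Definition gbin (q : rat) (i : nat) : C :=
  ratr ((\prod_(j < i) (q - j%:R)) / (i`!)%:R).

(* Coefficient of w^ew x^ex y^ey in                                         *)
(*   w^-1 delta((x + eps y) / w) ((x + eps y) / w)^rho                      *)
(*     = \sum_(n in Z + rho) w^(-n-1) (x + eps y)^n,                        *)
(* where (x + eps y)^n = \sum_(i >= 0) gbin n i eps^i x^(n-i) y^i.          *)
Definition delta_coef (eps : C) (rho ew ex ey : rat) : C :=
  if [&& - ew - 1 - rho \is a Num.int, ey \is a Num.nat
       & ex + ey == - ew - 1]
  then gbin (- ew - 1) (Num.truncn ey) * eps ^+ Num.truncn ey else 0.

(* z0^-1 delta((z1 - z2) / z0) *)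
Definition delta_012 : fser3 C := fun a b c => delta_coef (- 1) 0 a b c.

(* z0^-1 delta((z2 - z1) / (- z0)) = z0^-1 delta((- z2 + z1) / z0)          *)
(*   = \sum_n (-1)^n z0^(-n-1) (z2 - z1)^n                                  *)
Definition delta_021 : fser3 C := fun a b c =>
  (- 1) ^ Num.floor (- a - 1) * delta_coef (- 1) 0 a c b.

(* z1^-1 delta((z2 + z0) / z1) *)
Definition delta_120 : fser3 C := fun a b c => delta_coef 1 0 b c a.

(* z2^-1 delta((z1 - z0) / z2) ((z1 - z0) / z2)^rho *)
Definition delta_210 (rho : rat) : fser3 C :=
  fun a b c => delta_coef (- 1) rho c b a.

(* Product of a scalar series and a vector-valued one; in all uses below    *)
(* the sum giving each coefficient has finite support.                      *)
Definition fmul3 (U : lmodType C) (k : fser3 C) (F : fser3 U) : fser3 U :=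
  fun a b c => \sum_(p \in [set: rat * rat * rat])
    k p.1.1 p.1.2 p.2 *: F (a - p.1.1) (b - p.1.2) (c - p.2).

Definition fderiv (U : lmodType C) (f : rat -> U) : rat -> U :=
  fun e => ratr (e + 1) *: f (e + 1).

Definition virasoro (M : lmodType C) (L : int -> M -> M) (d : C) :=
  forall (k j : int) m,
    L k (L j m) - L j (L k m) = (k - j)%:~R *: L (k + j) m +
      (if k + j == 0 then (k ^+ 3 - k)%:~R / 12%:R * d else 0) *: m.

(* e^(2 pi i r / T) *)
Definition expi (r T : nat) : C :=
  let t := 2 * pi * r%:R / T%:R in Complex (cos t) (sin t).

Definition eigensp (V : lmodType C) (g : V -> V) (T r : nat) : set V :=
  [set v | g v = expi r T *: v].

(* The V^(r)-component of v in V = (+)_(r < T) V^(r), where g^T = 1. *)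
Definition eigencomp (V : lmodType C) (g : V -> V) (T : nat) (r : 'I_T)
    (v : V) : V :=
  component (fun s : 'I_T => eigensp g T s) r v.

Definition has_order (V : Type) (g : V -> V) (T : nat) :=
  [/\ (0 < T)%N, forall v, iter T g v = v
    & forall n, (0 < n < T)%N -> ~ forall v, iter n g v = v].

(* (V (x) W)_n for the grading of a tensor product of two graded spaces,   *)
(* the degrees of the indices being given by dV and dW.                     *)
Definition tensor_grade (V W : lmodType C) (I J : Type) (dV : I -> rat)
    (dW : J -> rat) (VI : I -> set V) (WJ : J -> set W) (n : rat) :
    set (tensor V W) :=
  lspan [set x | exists i j v w,
    [/\ dV i + dW j = n, VI i v, WJ j w & x = tens v w]].

(* \sum_(k in Z) D k z^(-k-1) *)
Definition series_of_modes (X : Type) (U : lmodType C) (D : int -> X -> U)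
    (v : X) (e : rat) : U :=
  if e \is a Num.int then D (Num.floor (- e - 1)) v else 0.

Section Coalgebra.
Variables (V : lmodType C) (D : int -> {linear V -> tensor V V}).
Let Ups := series_of_modes (fun k => D k).

(* z0^-1 delta((z1 - z2)/z0) (Id (x) Ups(z2)) Ups(z1)                       *)
(*   - z0^-1 delta((z2 - z1)/(-z0)) (tau (x) Id) (Id (x) Ups(z1)) Ups(z2)   *)
(*   = z1^-1 delta((z2 + z0)/z1) (Ups(z0) (x) Id) Ups(z2)                   *)
Definition coJacobi := forall v a b c,
  fmul3 delta_012 (fun a b c =>
      if a == 0 then tmap id (Ups^~ c) (Ups v b) else 0) a b c
  - fmul3 delta_021 (fun a b c =>
      if a == 0 then tswap12 (tmap id (Ups^~ b) (Ups v c)) else 0) a b c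
  = fmul3 delta_120 (fun a b c =>
      if b == 0 then tassoc (tmap (Ups^~ a) id (Ups v c)) else 0) a b c.

(* The operators L(k) with (rho (x) Id) Ups(z) = \sum_k L(k) z^(k-2). *)
Definition coL (rho : V -> C) (k : int) (v : V) : V :=
  tcontr_l rho (Ups v (k%:~R - 2)).

End Coalgebra.

Record voc (V : lmodType C) := VOC {
  vgrade : int -> set V;
  vDelta : int -> {linear V -> tensor V V};
  vc : {scalar V};
  vrho : {scalar V};
  vd : C;
  vUps := series_of_modes (fun k => vDelta k);
  vL := coL vDelta vrho;
  voc_grade : direct_sum vgrade;
  voc_findim : forall s, finite_dim (vgrade s);
  voc_bounded : exists s0 : int, forall s, s < s0 -> vgrade s `<=` [set 0];
  voc_trunc : forall v, exists k0 : int, forall k, k < k0 -> vDelta k v = 0;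
  voc_Delta_grade : forall k s v, vgrade s v ->
    tensor_grade intr intr vgrade vgrade (s + k + 1)%:~R (vDelta k v);
  voc_counit_l : forall v e,
    tcontr_l vc (vUps v e) = if e == 0 then v else 0;
  voc_counit_r : forall v e, e <= 0 ->
    tcontr_r vc (vUps v e) = if e == 0 then v else 0;
  voc_jacobi : coJacobi vDelta;
  voc_virasoro : virasoro vL vd;
  voc_L0 : forall s v, vgrade s v <-> vL 0 v = s%:~R *: v;
  voc_L1 : forall v e, tmap (vL 1) id (vUps v e) = fderiv (vUps v) e
}.

Definition voc_aut (V : lmodType C) (S : voc V) (g : {linear V -> V}) :=
  [/\ bijective g, forall v, vc S (g v) = vc S v,
      forall v, vrho S (g v) = vrho S v
    & forall k v, vDelta S k (g v) = tmap g g (vDelta S k v)].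

Section Comodules.
Variables (V : lmodType C) (S : voc V) (g : V -> V) (T : nat).
Variables (M : lmodType C) (D : int -> {linear M -> tensor V M}).

(* Coefficients of                                                          *)
(*   Ups_M(z) m = \sum_k (z^(- ln g / 2 pi i) (x) Id) D k m z^(-k-1);       *)
(* the V^(r) (x) M - part of D k m contributes to z^(- k - 1 - r/T).        *)
Definition comod_series (m : M) (e : rat) : tensor V M :=
  \sum_(r < T) let k := - e - 1 - r%:R / T%:R in
    if k \is a Num.int
    then tmap (eigencomp g r) id (D (Num.floor k) m) else 0.

Definition comod_L (k : int) (m : M) : M :=
  tcontr_l (vrho S) (comod_series m (k%:~R - 2)).

(* As coJacobi, with right-hand side                                        *)
(*   z2^-1 delta((z1 - z0)/z2)                                              *)
(*     (((z1 - z0)/z2)^(- ln g / 2 pi i) (x) Id (x) Id)                     *)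
(*     (Ups(z0) (x) Id) Ups_M(z2).                                          *)
Definition comod_jacobi := forall m a b c,
  fmul3 delta_012 (fun a b c =>
      if a == 0 then tmap id (comod_series^~ c) (comod_series m b) else 0)
    a b c
  - fmul3 delta_021 (fun a b c =>
      if a == 0 then tswap12 (tmap id (comod_series^~ b) (comod_series m c))
      else 0) a b c
  = \sum_(r < T) fmul3 (delta_210 (- (r%:R / T%:R))) (fun a b c =>
      if b == 0 then tmap (eigencomp g r) id
        (tassoc (tmap ((vUps S)^~ a) id (comod_series m c)))
      else 0) a b c.

Definition weak_twisted_comodule :=
  [/\ (forall m, exists k0 : int, forall k, k < k0 -> D k m = 0)
        /\ (forall m e,
          tcontr_l (vc S) (comod_series m e) = if e == 0 then m else 0),
      comod_jacobi,
      virasoro comod_L (vd S)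
    & forall m e,
        tmap (vL S 1) id (comod_series m e) = fderiv (comod_series m) e
        /\ fderiv (comod_series m) e =
          comod_series (comod_L 1 m) e - tmap id (comod_L 1) (comod_series m e)].

(* Mt n is the homogeneous subspace of degree n / T. *)
Definition admissible_comodule (Mt : nat -> set M) :=
  [/\ weak_twisted_comodule, direct_sum Mt
    & forall k n m, Mt n m ->
        lspan [set x | exists r : 'I_T,
            tensor_grade intr (fun j : nat => j%:R / T%:R)
              (fun s => vgrade S s `&` eigensp g T r) Mt
              (n%:R / T%:R + k%:~R + 1 + r%:R / T%:R) x] (D k m)].

Definition admissible_subcomodule (Mt : nat -> set M) (N : set M) :=
  graded_subspace Mt N /\
  forall k m, N m ->
    lspan [set x | exists v n, N n /\ x = tens v n] (D k m).

Definition irreducible_subcomodule (Mt : nat -> set M) (N : set M) :=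
  [/\ admissible_subcomodule Mt N, N <> [set 0]
    & forall N', admissible_subcomodule Mt N' -> N' `<=` N ->
        N' = [set 0] \/ N' = N].

Definition completely_reducible_comodule (Mt : nat -> set M) :=
  exists (I : choiceType) (N : I -> set M),
    direct_sum N /\ forall i, irreducible_subcomodule Mt (N i).

End Comodules.

Definition corational (V : lmodType C) (S : voc V) (g : V -> V) (T : nat) :=
  forall (M : lmodType C) (D : int -> {linear M -> tensor V M})
    (Mt : nat -> set M),
  admissible_comodule S g T D Mt -> completely_reducible_comodule D Mt.

(* Y(u,z) v = \sum_k (va_mode u k v) z^(-k-1) *)
Record va_data := VAData {
  va_sort :> lmodType C;
  va_grade : int -> set va_sort;
  va_mode : va_sort -> int -> va_sort -> va_sort;
  va_one : va_sort;
  va_omega : va_sort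
}.

(* The operators L(n) with Y(omega,z) = \sum_n L(n) z^(-n-2). *)
Definition va_L (W : va_data) (n : int) (v : W) : W :=
  va_mode (va_omega W) (n + 1) v.

(* Jacobi identity for u and v acting on N, where                           *)
(* Y_N(u,z) = \sum_t u_t z^(-t-1) with t rational and u_t = m u t:          *)
(*   z0^-1 delta((z1 - z2)/z0) Y_N(u,z1) Y_N(v,z2)                          *)
(*     - z0^-1 delta((-z2 + z1)/z0) Y_N(v,z2) Y_N(u,z1)                     *)
(*     = z2^-1 delta((z1 - z0)/z2) ((z1 - z0)/z2)^rho Y_N(Y(u,z0)v,z2).     *)
Definition jacobi (W : va_data) (N : lmodType C) (m : W -> rat -> N -> N)
    (rho : rat) (u v : W) :=
  forall n a b c,
  fmul3 delta_012 (fun a b c =>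
      if a == 0 then m u (- b - 1) (m v (- c - 1) n) else 0) a b c
  - fmul3 delta_021 (fun a b c =>
      if a == 0 then m v (- c - 1) (m u (- b - 1) n) else 0) a b c
  = fmul3 (delta_210 rho) (fun a b c =>
      if b == 0 then
        m (series_of_modes (va_mode u) v a) (- c - 1) n
      else 0) a b c.

Definition adjoint_mode (W : va_data) (u : W) (t : rat) (v : W) : W :=
  if t \is a Num.int then va_mode u (Num.floor t) v else 0.

Record is_voa (W : va_data) : Prop := IsVOA {
  voa_linear_l : forall k v, linear (fun u : W => va_mode u k v);
  voa_linear_r : forall (u : W) k, linear (va_mode u k);
  voa_grade : direct_sum (@va_grade W);
  voa_findim : forall s, finite_dim (va_grade (v:=W) s);
  voa_bounded :
    exists s0 : int, forall s, s < s0 -> va_grade (v:=W) s `<=` [set 0];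
  voa_trunc : forall u v : W,
    exists k0 : int, forall k, k0 < k -> va_mode u k v = 0;
  voa_vacuum : forall (v : W) k,
    va_mode (va_one W) k v = if k == - 1 then v else 0;
  voa_creation : forall (u : W) k, - 1 <= k ->
    va_mode u k (va_one W) = if k == - 1 then u else 0;
  voa_jacobi : forall u v : W, jacobi (@adjoint_mode W) 0 u v;
  voa_virasoro : exists d : C, virasoro (@va_L W) d;
  voa_L0 : forall s (v : W), va_grade s v <-> va_L 0 v = s%:~R *: v;
  voa_Lm1 : forall (u : W) k v,
    va_mode (va_L (- 1) u) k v = - k%:~R *: va_mode u (k - 1) v
}.

Definition voa_aut (W : va_data) (h : W -> W) :=
  [/\ linear h, bijective h,
      h (va_one W) = va_one W /\ h (va_omega W) = va_omega W
    & forall u k v, h (va_mode u k v) = va_mode (h u) k (h v)].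

Section Modules.
Variables (W : va_data) (h : W -> W) (T : nat).

Section OneModule.
Variables (N : lmodType C) (m : W -> rat -> N -> N).

Definition weak_twisted_module :=
  [/\ (forall t n, linear (fun u => m u t n)) /\ (forall u t, linear (m u t)),
      forall r u t, (r < T)%N -> eigensp h T r u ->
        t - r%:R / T%:R \isn't a Num.int -> forall n, m u t n = 0,
      forall u n, exists t0 : rat, forall t, t0 < t -> m u t n = 0,
      forall t n, m (va_one W) t n = if t == - 1 then n else 0
    & forall r u v, (r < T)%N -> eigensp h T r u ->
        jacobi m (- (r%:R / T%:R)) u v].

(* Nt n is the homogeneous subspace of degree n / T; components of negative *)
(* degree are zero.                                                         *)
Definition admissible_module (Nt : nat -> set N) :=
  [/\ weak_twisted_module, direct_sum Nt
    & forall (w : int) (a : W) (t : rat) n x, va_grade w a -> Nt n x ->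
        m a t x = 0 \/
        exists2 j : nat, j%:R / T%:R = w%:~R + n%:R / T%:R - t - 1 :> rat
          & Nt j (m a t x)].

Definition admissible_submodule (Nt : nat -> set N) (X : set N) :=
  graded_subspace Nt X /\ forall u t x, X x -> X (m u t x).

Definition irreducible_submodule (Nt : nat -> set N) (X : set N) :=
  [/\ admissible_submodule Nt X, X <> [set 0]
    & forall X', admissible_submodule Nt X' -> X' `<=` X ->
        X' = [set 0] \/ X' = X].

Definition completely_reducible_module (Nt : nat -> set N) :=
  exists (I : choiceType) (X : I -> set N),
    direct_sum X /\ forall i, irreducible_submodule Nt (X i).

End OneModule.

Definition rational_voa :=
  [/\ is_voa W, voa_aut h, has_order h T
    & forall (N : lmodType C) (m : W -> rat -> N -> N) (Nt : nat -> set N),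
        admissible_module m Nt -> completely_reducible_module m Nt].

(* O_(k,h)(W) for k = l + i/T.  The residue                                 *)
(*   Res_z (1+z)^q z^-p Y(u,z)v                                             *)
(* is \sum_(j >= 0) gbin q j u_(j-p) v, a finite sum by truncation.  As     *)
(* i <= T - 1, zhu_delta i T = 0, which is the convention for delta_i(T).   *)
Definition zhu_delta (i r : nat) : nat := (r <= i)%N.

Definition zhu_circ (l i r : nat) (w : int) (u v : W) : W :=
  let q := w%:~R - 1 + (zhu_delta i r)%:R + l%:R + r%:R / T%:R in
  let p := (2 * l + zhu_delta i r + zhu_delta i (T - r) + 1)%N in
  \sum_(j \in [set: nat]) gbin q j *: va_mode u (j%:Z - p%:Z) v.

Definition zhu_O (l i : nat) : set W :=
  lspan ([set x | exists u : W, x = va_L (- 1) u + va_L 0 u] `|`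
        [set x | exists (r : 'I_T) w u v,
           [/\ va_grade w u, eigensp h T r u & x = zhu_circ l i r w u v]]).

Definition zhu_finite_dim (l i : nat) := finite_codim (zhu_O l i).

End Modules.

(* The dual V' = (+)_s V_s^*: the linear functionals on V that vanish on   *)
(* all but finitely many V_s.                                              *)

Section Dual.
Variables (V : lmodType C) (S : voc V).

Definition gdual_pred : {pred V -> C^o} := fun f =>
  `[< linear f /\ finite_set [set s | exists2 v, vgrade S s v & f v <> 0] >].

Record gdual := GDual {
  gdual_fun :> V -> C^o;
  gdual_funP : gdual_fun \in gdual_pred
}.

HB.instance Definition _ := [isSub for gdual_fun].
HB.instance Definition _ := [Choice of gdual by <:].

Lemma gdual_predP (f : V -> C^o) : reflect
  (linear f /\ finite_set [set s | exists2 v, vgrade S s v & f v <> 0])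
  (f \in gdual_pred).
Proof. exact: asboolP. Qed.

Lemma gdual_submod : subsemimod_closed gdual_pred.
Proof.
split; first split.
- apply/gdual_predP; split=> [a u v|]; first by rewrite /= scaler0 addr0.
  by rewrite (_ : [set _ | _] = set0) // -subset0 => s /= [v _].
- move=> f1 f2 /gdual_predP[l1 s1] /gdual_predP[l2 s2].
  apply/gdual_predP; split=> [a u v|].
    by rewrite !fctE l1 l2 scalerDr addrACA.
  have fU : finite_set ([set s | exists2 v, vgrade S s v & f1 v <> 0] `|`
    [set s | exists2 v, vgrade S s v & f2 v <> 0]) by rewrite finite_setU.
  apply: sub_finite_set fU => s /= [v vs]; rewrite !fctE => nz.
  have [e|/eqP] := eqVneq (f1 v) 0; last by left; exists v.
  by right; exists v => // e'; apply: nz; rewrite e e' addr0.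
- move=> b f /gdual_predP[l1 s1]; apply/gdual_predP; split=> [a u v|].
    by rewrite !fctE l1 scalerDr !scalerA mulrC.
  apply: sub_finite_set s1 => s /= [v vs] nz; exists v => // e; apply: nz.
  by rewrite !fctE e scaler0.
Qed.

HB.instance Definition _ := GRing.isSubmodClosed.Build C (V -> C^o) gdual_pred
  gdual_submod.
HB.instance Definition _ := [SubChoice_isSubLmodule of gdual by <:].

Definition gdual_grade (s : int) : set gdual :=
  [set f | forall t v, t <> s -> vgrade S t v -> f v = 0].

Lemma gdual_linear (f : gdual) : linear f.
Proof. by have /gdual_predP[] := gdual_funP f. Qed.

Definition gdual_mode_fun (u : gdual) (k : int) (v : gdual) : V -> C^o :=
  fun x => tpair u v (vDelta S k x).

Lemma tpair_bilinear (u v : gdual) :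
  bilinear_fun (fun x y => (u x * v y : C^o)).
Proof.
split=> [w a x y|w a x y] /=.
  by rewrite gdual_linear mulrDl -scalerAl.
by rewrite gdual_linear mulrDr -scalerAr.
Qed.

Lemma gdual_modeP u k v : gdual_mode_fun u k v \in gdual_pred.
Proof.
have tl := tlift_linear (tpair_bilinear u v).
apply/gdual_predP; split=> [a x y|].
  by rewrite /gdual_mode_fun /tpair linearP tl.
have /gdual_predP[_ su] := gdual_funP u.
have /gdual_predP[_ sv] := gdual_funP v.
have fin := finite_image2 (fun i j => i + j - k - 1) su sv.
apply: sub_finite_set fin => s /= [x xs nz].
have [n [a [t [tS tE]]]] := voc_Delta_grade k xs.
have [p tp] : exists p, tpair u v (t p) <> 0.
  apply: contrapT => h; apply: nz; rewrite /gdual_mode_fun tE /tpair (linear_fun_sum tl).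
  apply: big1 => p _; have -> : tlift (fun x y => u x * v y : C^o) (t p) = 0.
    by apply: contrapT => h'; apply: h; exists p.
  by rewrite scaler0.
have [i [j [y [z [ij yi zj tpE]]]]] := tS p.
move: tp; rewrite tpE /tpair tlift_tens; last exact: tpair_bilinear.
move=> uv; exists i; first by exists y => // e; apply: uv; rewrite e mul0r.
exists j; first by exists z => // e; apply: uv; rewrite e mulr0.
by move: ij; rewrite -intrD => /intr_inj ->; rewrite (addrAC (s + k)) !addrK.
Qed.

Definition gdual_mode (u : gdual) (k : int) (v : gdual) : gdual :=
  GDual (gdual_modeP u k v).

(* The restriction of a functional f to V_s, extended by 0. *)
Definition restr_fun (f : {scalar V}) (s : int) : V -> C^o :=
  fun v => f (component (vgrade S) s v).

Lemma restrP f s : restr_fun f s \in gdual_pred.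
Proof.
apply/gdual_predP; split=> [a x y|].
  by rewrite /restr_fun (component_linear (voc_grade S)) linearP.
apply: sub_finite_set (finite_set1 s) => t /= [v vt nz].
apply: contrapT => ts; apply: nz; rewrite /restr_fun.
by rewrite (component_out (voc_grade S) vt ts) linear0.
Qed.

Definition restr (f : {scalar V}) (s : int) : gdual := GDual (restrP f s).

Definition dual_voa : va_data :=
  VAData gdual_grade gdual_mode (restr (vc S) 0) (restr (vrho S) 2).

Section Action.
Variables (g : {linear V -> V}) (gaut : voc_aut S g).

Lemma voc_aut_grade s v : vgrade S s v -> vgrade S s (g v).
Proof.
have [_ _ rg Dg] := gaut; move=> /voc_L0 Lv; apply/voc_L0.
have -> : s%:~R *: g v = g (s%:~R *: v) by rewrite linearZ.
rewrite -Lv.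
rewrite /vL /coL /series_of_modes; set b := _ \is a Num.int; case: b; last first.
  by rewrite !tcontr_l0 linear0.
by rewrite Dg tcontr_l_tmap.
Qed.

Lemma gdual_actP (f : gdual) : f \o g \in gdual_pred.
Proof.
have /gdual_predP[_ sf] := gdual_funP f.
apply/gdual_predP; split=> [a x y|] /=; first by rewrite linearP gdual_linear.
apply: sub_finite_set sf => s /= [v vs nz].
by exists (g v) => //; exact: voc_aut_grade.
Qed.

(* The action of g^-1 on V': (g^-1 f, v) = (f, g v). *)
Definition dual_inv_act (f : gdual) : gdual := GDual (gdual_actP f).

End Action.

End Dual.

End Formal.

(* Main.v *)
From HB Require Import structures.
Require Import Defs.
From mathcomp Require Import all_boot all_order all_algebra.
From mathcomp Require Import complex.
From mathcomp Require Import boolp classical_sets functions cardinality fsbigop.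
From mathcomp Require Import reals trigo ring lra.

Set Implicit Arguments.
Unset Strict Implicit.
Unset Printing Implicit Defensive.

Import Order.TTheory GRing.Theory Num.Theory.
Local Open Scope classical_set_scope.
Local Open Scope ring_scope.

(** A coaction is a family of operators. For a functional [u] in the dual [V']
    and a rational [t], contracting the coefficient of [z^(- t - 1)] of the
    coaction of [M] with [u] gives an operator on [M], whose transpose is a mode
    [u_t] on the graded dual of [M]. Contracted with [u (x) v (x) Id], the
    Jacobi identity of the coaction is the one of these operators, with products
    reversed; by [comod_jacobi_tau] nothing is lost, because functionals
    separate tensors. Hence the graded dual of an admissible comodule is an
    admissible module ([comodule_dual_admissible]). Conversely each [V_s] is
    finite-dimensional and only finitely many [s] contribute in given degrees,
    so transposed module operators assemble into a coaction, and the graded dual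
    of an admissible module is an admissible comodule
    ([comod_Delta_admissible]). The Virasoro and derivative axioms of a comodule
    are dual to consequences of the Jacobi identity of a module. In both
    theories the subobjects are the graded subspaces stable under the operators.
    The same transposition shows that [V'] is a vertex operator algebra, once
    the counit and [rho] are known to be concentrated in degrees 0 and 2.

    The graded dual is not an involution when homogeneous components are
    infinite-dimensional, so complete reducibility has to be moved through it by
    another argument, the same in both directions ([semisimple_transfer]). Let
    [N] have a completely reducible graded dual and let [w] be homogeneous, in a
    stable subspace [W] whose component in the degree of [w] is
    finite-dimensional. For a stable subspace [X] of [W], a complement [Y] of
    the annihilator of [X] in the dual cuts out a stable subspace [Q] of [W]
    meeting [X] trivially. In the degree of [w], biduality in finite dimension
    gives that [X] and [Q] together fill [W]. So [w] is a sum of an element of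
    [X] and one of [Q], and induction on the dimension of that component writes
    [w] as a sum of elements of irreducible subspaces. Only the degree of [w]
    matters; the other components may be infinite-dimensional.

    The hypothesis on the Zhu algebras provides [W]. By associativity the
    vectors [u_t w] span a stable subspace. Its part in the degree [l + i / T]
    of [w] consists of values of zero modes [u_(wt u - 1) w], and these vanish
    for [u] in [O_(l,i)] ([zhu_O_zero]). A subspace of finite codimension thus
    acts by zero. For a comodule the same holds by transposition. *)

(** * Subspaces, functionals and finite-dimensional duality *)

Section LinearMaps.
Variables (K : fieldType) (U V : lmodType K) (f : U -> V).
Hypothesis fl : linear f.

Lemma lin_sum (I : Type) (s : seq I) (P : pred I) (F : I -> U) :
  f (\sum_(i <- s | P i) F i) = \sum_(i <- s | P i) f (F i).
Proof.
pose f' : {linear U -> V} := HB.pack f (GRing.isLinear.Build K U V _ f fl).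
exact: (linear_sum f').
Qed.

Lemma lin0 : f 0 = 0.
Proof. by have := lin_sum [::] xpredT (fun _ : nat => 0); rewrite !big_nil. Qed.

Lemma linD u v : f (u + v) = f u + f v.
Proof. by have := fl 1 u v; rewrite !scale1r. Qed.

Lemma linZ a u : f (a *: u) = a *: f u.
Proof. by have := fl a u 0; rewrite lin0 !addr0. Qed.

Lemma linB u v : f (u - v) = f u - f v.
Proof. by rewrite linD -scaleN1r linZ scaleN1r. Qed.

End LinearMaps.

Lemma finite_set_seq (I : choiceType) (A : set I) : finite_set A ->
  exists2 s : seq I, uniq s & forall i, A i -> i \in s.
Proof.
move=> /finite_seqP[s ->]; exists (undup s); first exact: undup_uniq.
by move=> i; rewrite mem_undup.
Qed.

Lemma seq_finite_set (I : choiceType) (s : seq I) (A : set I) :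
  (forall i, A i -> i \in s) -> finite_set A.
Proof.
by move=> h; apply: (@sub_finite_set _ _ [set` s]);
  [exact: h|exact: finite_seq].
Qed.

Lemma fsum_seq (M : zmodType) (I : choiceType) (s : seq I) (F : I -> M) :
  uniq s -> (forall i, i \notin s -> F i = 0) ->
  \sum_(i \in [set: I]) F i = \sum_(i <- s) F i.
Proof.
move=> us h; rewrite (fsbigE s)//; last by move=> i _; exact: h.
by apply: eq_bigl => i; rewrite in_setT.
Qed.

Section Span.
Variables (K : fieldType) (V : lmodType K).
Implicit Types A S U : set V.

Lemma subspaceD U u v : is_subspace U -> U u -> U v -> U (u + v).
Proof. by case=> _ h uU vU; have := h 1 u v uU vU; rewrite scale1r. Qed.

Lemma subspaceZ U a u : is_subspace U -> U u -> U (a *: u).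
Proof. by case=> h0 h uU; have := h a u 0 uU h0; rewrite addr0. Qed.

Lemma subspaceB U u v : is_subspace U -> U u -> U v -> U (u - v).
Proof.
by move=> h uU vU; apply: subspaceD => //; rewrite -scaleN1r; exact: subspaceZ.
Qed.

Lemma subspace_sum U (I : Type) (s : seq I) (P : pred I) (F : I -> V) :
  is_subspace U -> (forall i, P i -> U (F i)) -> U (\sum_(i <- s | P i) F i).
Proof.
move=> h FU; elim/big_rec: _ => [|i v Pi vU]; first by case: h.
by apply: subspaceD => //; exact: FU.
Qed.

Lemma subspace_sum_in U (I : eqType) (s : seq I) (F : I -> V) :
  is_subspace U -> (forall i, i \in s -> U (F i)) -> U (\sum_(i <- s) F i).
Proof. by move=> h FU; rewrite big_seq; exact: subspace_sum. Qed.

Lemma lspan_min S U : is_subspace U -> S `<=` U -> lspan S `<=` U.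
Proof.
move=> h SU v [n [a [x [Sx ->]]]]; apply: subspace_sum => // i _.
by apply: subspaceZ => //; exact: SU.
Qed.

Lemma lspan_in S v : S v -> lspan S v.
Proof.
by move=> Sv; exists 1%N, (fun=> 1), (fun=> v); rewrite big_ord1 scale1r.
Qed.

Lemma lspan_subspace S : is_subspace (lspan S).
Proof.
split=> [|c u v [n [a [x [Sx ->]]]] [m [b [y [Sy ->]]]]].
  by exists 0%N, (fun=> 0), (fun=> 0); split=> [[]//|]; rewrite big_ord0.
pose coef (i : 'I_(n + m)) :=
  match fintype.split i with inl j => c * a j | inr j => b j end.
pose vec (i : 'I_(n + m)) :=
  match fintype.split i with inl j => x j | inr j => y j end.
exists (n + m)%N, coef, vec; rewrite /coef /vec.
split=> [i|]; first by case: fintype.split.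
rewrite big_split_ord scaler_sumr /=; congr (_ + _); apply: eq_bigr => i _.
  by rewrite -[lshift m i]/(unsplit (inl i)) unsplitK scalerA.
by rewrite -[rshift n i]/(unsplit (inr i)) unsplitK.
Qed.

Lemma lspan0 S : lspan S 0.
Proof. by case: (lspan_subspace S). Qed.

Lemma lspan_mono S S' : S `<=` S' -> lspan S `<=` lspan S'.
Proof.
by move=> h; apply: lspan_min (lspan_subspace _) _ => v /h /lspan_in.
Qed.

Lemma lspan_rangeP n (x : 'I_n -> V) v :
  lspan (range x) v <-> exists a : 'I_n -> K, v = \sum_i a i *: x i.
Proof.
split=> [|[a ->]]; last by exists n, a, x; split=> // i; exists i.
have h : is_subspace [set v | exists a : 'I_n -> K, v = \sum_i a i *: x i].
  split=> [|c u w [a ->] [b ->]].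
    by exists (fun=> 0); rewrite big1 // => i _; rewrite scale0r.
  exists (fun i => c * a i + b i); rewrite scaler_sumr -big_split /=.
  by apply: eq_bigr => i _; rewrite scalerDl scalerA.
apply: (lspan_min h) => _ [i _ <-].
exists (fun j => (j == i)%:R);
  rewrite (bigD1 i) //= eqxx scale1r big1 ?addr0 //.
by move=> j /negPf ->; rewrite scale0r.
Qed.

Lemma subspace0 : is_subspace [set 0 : V].
Proof. by split=> // a u v -> ->; rewrite scaler0 addr0. Qed.

Lemma subspaceI U U' : is_subspace U -> is_subspace U' ->
  is_subspace (U `&` U').
Proof.
by move=> [z h] [z' h']; split=> // a u v [? ?] [? ?]; split;
  [exact: h|exact: h'].
Qed.

Definition sumsp (U U' : set V) : set V :=
  [set v | exists u u', [/\ U u, U' u' & v = u + u']].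

Lemma subspace_sumsp U U' :
  is_subspace U -> is_subspace U' -> is_subspace (sumsp U U').
Proof.
move=> [z h] [z' h']; split; first by exists 0, 0; rewrite addr0.
move=> a _ _ [u [u' [uU u'U' ->]]] [v [v' [vU v'U' ->]]].
exists (a *: u + v), (a *: u' + v'); split; [exact: h|exact: h'|].
by rewrite scalerDr addrACA.
Qed.

End Span.

(** The empty chain is excluded, as its union, the empty set, is not a
    subspace; this is why a member [A0] to start from is required. *)
Lemma zorn_sets (T : Type) (P : set (set T)) (A0 : set T) : P A0 ->
  (forall F : set (set T), F !=set0 -> F `<=` P -> total_on F subset ->
     P (\bigcup_(X in F) X)) ->
  exists A, [/\ A0 `<=` A, P A & forall B, A `<=` B -> P B -> B `<=` A].
Proof.
move=> PA0 Pchain.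
pose P' : set (set T) := [set A | A = set0 \/ (P A /\ A0 `<=` A)].
have [F FP' Ftot|A [P'A Amax]] := @Zorn_bigcup T P'.
  pose F' := F `&` [set X | P X /\ A0 `<=` X].
  have E : \bigcup_(X in F) X = \bigcup_(X in F') X.
    apply/seteqP; split=> x [X XF Xx]; exists X => //.
      split=> //; case: (FP' _ XF) => [X0|//]; by rewrite X0 in Xx.
    by case: XF.
  have [[X F'X]|/forallNP F'0] := pselect (exists X, F' X); [right|left].
    rewrite E; split; last by move=> a /(proj2 (proj2 F'X)) Xa; exists X.
    apply: Pchain; first by exists X.
      by move=> Y [_ []].
    by move=> Y Z [FY _] [FZ _]; exact: Ftot.
  by rewrite E -subset0 => x [X /F'0].
have PA : P A /\ A0 `<=` A.
  case: P'A => // A_0; have [A00|A0n] := pselect (A0 = set0).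
    by split; rewrite A_0 // -A00.
  have Amax0 := Amax A0; rewrite A_0 in Amax0.
  case: Amax0; last by apply: or_intror; split.
  by split; [exact: sub0set|rewrite subset0].
have [PA' A0A] := PA; exists A; split=> // B AB PB; apply: contrapT => BA.
by apply: (Amax B); [split|right; split=> // x /A0A /AB].
Qed.

Section Separation.
Variables (K : fieldType) (V : lmodType K).
Implicit Types U : set V.

(** A subspace that is maximal among those avoiding [v] is a hyperplane
    complementary to [v]; the coordinate along [v] is the functional. *)
Lemma separation U (v : V) : is_subspace U -> ~ U v ->
  exists f : V -> K^o, [/\ linear f, forall u, U u -> f u = 0 & f v = 1].
Proof.
move=> sU Uv; pose P (A : set V) := is_subspace A /\ ~ A v.
have [|F [X0 FX0] FP Ftot|H [UH [sH Hv] Hmax]] := @zorn_sets V P U.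
- by [].
- split; last by move=> [X /FP[]].
  split; first by exists X0 => //; have [[]] := FP _ FX0.
  move=> a x y [X FX Xx] [Y FY Yy].
  have [XY|YX] := Ftot _ _ FX FY.
    exists Y => //; have [[_ h] _] := FP _ FY; apply: h => //; exact: XY.
  exists X => //; have [[_ h] _] := FP _ FX; apply: h => //; exact: YX.
have ex x : exists a, H (x - a *: v).
  have [Hx|Hx] := pselect (H x); first by exists 0; rewrite scale0r subr0.
  pose L : set V := [set y | exists a, y = a *: x].
  have sL : is_subspace L.
    split; first by exists 0; rewrite scale0r.
    by move=> a _ _ [b ->] [c ->]; exists (a * b + c); rewrite scalerDl scalerA.
  have L0 : L 0 by case: sL.
  have [] := pselect (sumsp H L v); last first.
    move=> nv; exfalso; apply: Hx; apply: (Hmax (sumsp H L)).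
    - by move=> h Hh; exists h, 0; rewrite addr0.
    - by split=> //; exact: subspace_sumsp.
    - by exists 0, x; rewrite add0r; split=> //; [case: sH|exists 1;
        rewrite scale1r].
  move=> [h [_ [Hh [a ->] ve]]].
  have a0 : a != 0.
    by apply/eqP => a0; apply: Hv; rewrite ve a0 scale0r addr0.
  exists a^-1; rewrite ve scalerDr scalerA mulVf // scale1r opprD addrCA subrr.
  by rewrite addr0 -scaleN1r scalerA; exact: subspaceZ.
have uniq x a b : H (x - a *: v) -> H (x - b *: v) -> a = b.
  move=> Ha Hb; apply: contrapT => /eqP; rewrite -subr_eq0 => ab.
  apply: Hv; have -> : v = (a - b)^-1 *: ((x - b *: v) - (x - a *: v)).
    rewrite opprB [X in _ *: X]addrC addrA subrK -scalerBl.
    by rewrite scalerA mulVf ?scale1r.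
  by apply: subspaceZ => //; exact: subspaceB.
pose f x : K^o := projT1 (cid (ex x)).
have fP x : H (x - f x *: v) by rewrite /f; case: cid.
exists f; split.
- move=> a x y; apply: (uniq (a *: x + y)) => //.
  have -> : a *: x + y - (a *: f x + f y) *: v =
      a *: (x - f x *: v) + (y - f y *: v).
    by rewrite scalerDl opprD addrACA scalerBr scalerA.
  by case: sH => _; apply.
- by move=> u Uu; apply: (uniq u) => //; rewrite scale0r subr0; exact: UH.
- by apply: (uniq v) => //; rewrite scale1r subrr; case: sH.
Qed.

End Separation.

Section FiniteDimension.
Variables (K : fieldType) (V : lmodType K).
Implicit Types U : set V.

(** Exchange: a hyperplane section of a space spanned by [n + 1] vectors is
    spanned by [n] vectors, the spanning vectors being projected along [e]. *)
Lemma span_hyperplane n (x : 'I_n.+1 -> V) U (e : V) (f : V -> K^o) :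
  U `<=` lspan (range x) -> U e -> linear f -> f e = 1 ->
  exists y : 'I_n -> V, forall v, U v -> f v = 0 -> lspan (range y) v.
Proof.
move=> Ux Ue fl fe; have /lspan_rangeP[a ea] := Ux _ Ue.
have [k ak] : exists k, a k != 0.
  apply: contrapT => /forallNP h; suff e0 : e = 0.
    by have := fe; rewrite e0 (lin0 fl) => /eqP; rewrite eq_sym oner_eq0.
  by rewrite ea big1 // => i _; have /negP := h i; rewrite negbK => /eqP ->;
    rewrite scale0r.
pose P (v : V) : V := v - f v *: e.
have Pl : linear P.
  move=> c u v; rewrite /P fl scalerDl opprD addrACA scalerBr;
    congr (_ - _ + _).
  by rewrite scalerA.
pose y (j : 'I_n) := P (x (lift k j)); exists y.
have sy := lspan_subspace (range y).
have yl j : lspan (range y) (P (x (lift k j))) by apply: lspan_in; exists j.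
have Pe : P e = 0 by rewrite /P fe scale1r subrr.
have Px i : lspan (range y) (P (x i)).
  case: (unliftP k i) => [j ->//|->].
  have : P e = \sum_i a i *: P (x i).
    by rewrite {1}ea (lin_sum Pl); apply: eq_bigr => j _; rewrite (linZ Pl).
  rewrite Pe (bigD1 k) //= => /esym/eqP; rewrite addr_eq0 => /eqP E.
  have -> : P (x k) = (a k)^-1 *: (a k *: P (x k)) by rewrite scalerA mulVf
    ?scale1r.
  rewrite E; apply: subspaceZ => //; rewrite -scaleN1r; apply: subspaceZ => //.
  apply: subspace_sum => // i'; rewrite eq_sym => /unlift_some[j -> _].
  exact: subspaceZ.
move=> v /Ux /lspan_rangeP[b vb] fv.
have <- : P v = v by rewrite /P fv scale0r subr0.
rewrite vb (lin_sum Pl); apply: subspace_sum => // i _.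
by rewrite (linZ Pl); exact: subspaceZ.
Qed.

(** Split off a vector and a functional equal to 1 on it, and project along that
    vector. The [phi i] need not be dual to the [e i]: only the expansion of the
    vectors of [U] matters. *)
Lemma fd_dual_basis n (x : 'I_n -> V) U :
  is_subspace U -> U `<=` lspan (range x) ->
  exists m (e : 'I_m -> V) (phi : 'I_m -> V -> K^o),
    [/\ forall i, linear (phi i), forall i, U (e i)
      & forall v, U v -> v = \sum_i phi i v *: e i].
Proof.
elim: n x U => [|n IH] x U sU Ux.
  exists 0%N, (fun=> 0), (fun _ _ => 0); split=> [[]//|[]//|v /Ux].
  by move=> /lspan_rangeP[a ->]; rewrite !big_ord0.
have [U0|] := pselect (U `<=` [set 0]).
  exists 0%N, (fun=> 0), (fun _ _ => 0); split=> [[]//|[]//|v /U0 ->].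
  by rewrite big_ord0.
move=> /existsNP[e /not_implyP[Ue e0]].
have [f [fl _ fe]] := separation (subspace0 V) e0.
have [y yP] := span_hyperplane Ux Ue fl fe.
pose U' := U `&` [set v | f v = 0].
have sK : is_subspace [set v | f v = 0].
  by split=> [|a u v /= fu fv]; rewrite /= ?(lin0 fl) // fl fu fv scaler0 addr0.
have sU' : is_subspace U' by exact: subspaceI.
have [|m [e' [phi [lphi e'U E]]]] := IH y U' sU'; first by move=> v [Uv fv];
  exact: yP.
exists m.+1, (fun i => if unlift ord0 i is Some j then e' j else e).
exists (fun i v => if unlift ord0 i is Some j then phi j (v - f v *: e)
  else f v).
split.
- move=> i; case: unlift => [j|//] a u v.
  rewrite fl -lphi; congr (phi j _).
  by rewrite scalerDl opprD addrACA scalerBr scalerA.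
- by move=> i; case: unlift => [j|//]; case: (e'U j).
- move=> v Uv; rewrite big_ord_recl unlift_none.
  under eq_bigr do rewrite liftK.
  have U'v : U' (v - f v *: e).
    split; first by apply: subspaceB => //; exact: subspaceZ.
    by rewrite /= (linB fl) (linZ fl) fe [_ *: _]mulr1 subrr.
  by rewrite -(E _ U'v) addrCA subrr addr0.
Qed.

(** Biduality in finite dimension, for functionals on the ambient space: if no
    [y] in [Y] had the coordinates of [p], a functional on coordinate space
    separating [p] from [Y] would be evaluation at a vector of [U] that [Y]
    annihilates and [p] does not. *)
Lemma double_annihilator n (x : 'I_n -> V) U (Y : set (V -> K^o)) (p : V ->
  K^o) :
  is_subspace U -> U `<=` lspan (range x) ->
  is_subspace Y -> (forall y, Y y -> linear y) -> linear p ->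
  (forall v, U v -> (forall y, Y y -> y v = 0) -> p v = 0) ->
  exists2 y, Y y & forall v, U v -> y v = p v.
Proof.
move=> sU Ux sY Yl pl pY.
have [m [e [phi [lphi Ue E]]]] := fd_dual_basis sU Ux.
pose ev (y : V -> K^o) : {ffun 'I_m -> K^o} := [ffun i => y (e i)].
have [[y Yy yp]|nY] := pselect (exists2 y, Y y & ev y = ev p).
  exists y => // v /E ->; rewrite (lin_sum (Yl _ Yy)) (lin_sum pl).
  apply: eq_bigr => i _; rewrite (linZ (Yl _ Yy)) (linZ pl).
  by have /ffunP/(_ i) := yp; rewrite !ffunE => ->.
have sE : is_subspace [set a | exists2 y, Y y & ev y = a].
  split; first by exists 0; [case: sY|apply/ffunP => i; rewrite !ffunE].
  move=> a _ _ [y Yy <-] [z Yz <-]; exists (a *: y + z);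
    first by case: sY => _; apply.
  by apply/ffunP => i; rewrite !ffunE.
have [F [Fl F0 Fp]] := separation sE nY.
pose d (i : 'I_m) : {ffun 'I_m -> K^o} := [ffun j => (j == i)%:R].
have Fev y : F (ev y) = \sum_i y (e i) * F (d i).
  have -> : ev y = \sum_i (y (e i) : K) *: d i.
    apply/ffunP => j; rewrite sum_ffunE ffunE (bigD1 j) //= !ffunE eqxx.
    rewrite [_ *: _]mulr1 big1 ?addr0 // => i ij; rewrite !ffunE eq_sym.
    by rewrite (negPf ij) [_ *: _]mulr0.
  by rewrite (lin_sum Fl); apply: eq_bigr => i _; rewrite (linZ Fl).
pose v := \sum_i (F (d i) : K) *: e i.
have yv y : linear y -> y v = F (ev y).
  move=> yl; rewrite Fev (lin_sum yl); apply: eq_bigr => i _.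
  by rewrite (linZ yl) [_ *: _]mulrC.
have pv : p v = 0.
  apply: pY; first by apply: subspace_sum => // i _; exact: subspaceZ.
  by move=> y Yy; rewrite (yv y (Yl _ Yy)) F0 //; exists y.
by exfalso; move: Fp; rewrite -(yv p pl) pv => /eqP; rewrite eq_sym oner_eq0.
Qed.

End FiniteDimension.

(** * Direct sums and graded duals *)

Section DirectSums.
Variables (K : fieldType) (V : lmodType K) (I : choiceType) (A : I -> set V).

(** Components are recognised from candidate projections; this is how the
    eigenspaces of an automorphism and the degrees of a dual are handled. *)
Lemma component_eqP (p : I -> V -> V) : (forall i, is_subspace (A i)) ->
  (forall i, linear (p i)) -> (forall i v, A i (p i v)) ->
  (forall i v, A i v -> p i v = v) ->
  (forall i j v, A i v -> i <> j -> p j v = 0) ->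
  (forall v, exists s, [/\ uniq s, forall i, i \notin s -> p i v = 0
     & v = \sum_(i <- s) p i v]) ->
  direct_sum A /\ forall i v, component A i v = p i v.
Proof.
move=> sA pl pA p1 p0 ps.
have dec v : decomposition A v (p^~ v).
  have [s [us s0 sE]] := ps v; split=> //.
    apply: (@seq_finite_set _ s) => i /= nz; apply: contrapT => /negP is0.
    exact: nz (s0 _ is0).
  by rewrite (fsum_seq us).
have dA : direct_sum A.
  split=> // v; exists (p^~ v); split=> // f [/finite_set_seq[s us sf] fA vE].
  have f0 i : i \notin s -> f i = 0.
    by move=> /negP is0; apply: contrapT => /sf.
  apply: funext => j; rewrite vE (fsum_seq us f0) (lin_sum (pl j)).
  have [js|js] := boolP (j \in s).
    rewrite (bigD1_seq j) //= (p1 j _ (fA j)) big1 ?addr0 // => i ij.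
    by apply: (p0 i) => //; apply/eqP.
  rewrite (f0 _ js) big_seq big1 // => i is_; apply: (p0 i) => // ij.
  by rewrite -ij is_ in js.
by split=> // i v; apply: component_eq dA _ _ _ (dec v).
Qed.

Section Theory.
Hypothesis dA : direct_sum A.

Lemma grade_subspace i : is_subspace (A i).
Proof. by case: dA. Qed.

Lemma component_mem i v : A i (component A i v).
Proof. by have [] := component_decomposition dA v. Qed.

Lemma component_seq v : exists s : seq I,
  [/\ uniq s, forall i, i \notin s -> component A i v = 0
    & v = \sum_(i <- s) component A i v].
Proof.
have [/finite_set_seq[s us sf] _ vE] := component_decomposition dA v.
have f0 i : i \notin s -> component A i v = 0.
  by move=> /negP is0; apply: contrapT => /sf.
by exists s; split=> //; rewrite {1}vE (fsum_seq us).
Qed.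

Lemma component_component i j v :
  component A i (component A j v) = if i == j then component A i v else 0.
Proof.
have := component_mem j v; case: eqVneq => [->|ij] vj;
  first exact: component_in.
by apply: (component_out dA vj) => ji; rewrite ji eqxx in ij.
Qed.

Lemma component_inj v w : (forall i, component A i v = component A i w) ->
  v = w.
Proof.
move=> vw; apply/eqP; rewrite -subr_eq0; apply/eqP.
have [s [_ _ ->]] := component_seq (v - w); apply: big1 => i _.
by rewrite (linB (component_linear dA i)) vw subrr.
Qed.

Lemma graded_ext (U : lmodType K) (f g : V -> U) : linear f -> linear g ->
  (forall i v, A i v -> f v = g v) -> f =1 g.
Proof.
move=> fl gl fg v; have [s [_ _ ->]] := component_seq v.
rewrite (lin_sum fl) (lin_sum gl); apply: eq_bigr => i _; apply: fg.
exact: component_mem.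
Qed.

Lemma graded_ind (P : set V) : is_subspace P -> (forall i, A i `<=` P) ->
  forall v, P v.
Proof.
move=> sP AP v; have [s [_ _ ->]] := component_seq v.
by apply: subspace_sum => // i _; apply: AP (component_mem i v).
Qed.

End Theory.

Lemma direct_sum_indep : (forall i, is_subspace (A i)) ->
  (forall v, lspan (\bigcup_i A i) v) ->
  (forall (s : seq I) f, uniq s -> (forall i, A i (f i)) ->
     \sum_(i <- s) f i = 0 -> forall i, i \in s -> f i = 0) ->
  direct_sum A.
Proof.
move=> sA span indep; split=> // v.
pose P : set V := [set v | exists2 s : seq I, uniq s & exists f : I -> V,
  [/\ forall i, A i (f i), forall i, i \notin s -> f i = 0
    & v = \sum_(i <- s) f i]].
have sP : is_subspace P.
  split.
    exists [::] => //; exists (fun=> 0); rewrite big_nil.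
    by split=> // i; case: (sA i).
  move=> a u w [s us [f [fA f0 ->]]] [t ut [h [hA h0 ->]]].
  have widen (s' : seq I) (f' : I -> V) : uniq s' -> {subset s' <= s ++ t} ->
      (forall i, i \notin s' -> f' i = 0) ->
      \sum_(i <- s') f' i = \sum_(i <- undup (s ++ t)) f' i.
    move=> us' sub f'0; rewrite -!fsum_seq ?undup_uniq // => i.
    by rewrite mem_undup => nin; apply: f'0; apply: contra nin => /sub.
  exists (undup (s ++ t)); first exact: undup_uniq.
  exists (fun i => a *: f i + h i); split.
  - by move=> i; have [_ ] := sA i; apply.
  - move=> i; rewrite mem_undup mem_cat negb_or => /andP[/f0 -> /h0 ->].
    by rewrite scaler0 addr0.
  - rewrite (widen s f) // ?(widen t h) //.
    + by rewrite scaler_sumr -big_split.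
    + by move=> i; rewrite mem_cat => ->; rewrite orbT.
    + by move=> i; rewrite mem_cat => ->.
have [s us [f [fA f0 vE]]] : P v.
  apply: (lspan_min sP) (span v) => w [i _ wi].
  exists [:: i] => //; exists (fun j => if j == i then w else 0); split.
  - by move=> j; case: eqP => [->//|_]; case: (sA j).
  - by move=> j; rewrite inE => /negPf ->.
  - by rewrite big_seq1 eqxx.
exists f; split.
  split=> //; last by rewrite (fsum_seq us).
  apply: (@seq_finite_set _ s) => i /= nz; apply: contrapT => /negP is_.
  exact: nz (f0 _ is_).
move=> h [/finite_set_seq[t ut hf] hA vh].
have h0 i : i \notin t -> h i = 0 by move=> /negP it; apply: contrapT => /hf.
pose d i := f i - h i.
have d0 i : i \notin undup (s ++ t) -> d i = 0.
  rewrite mem_undup mem_cat negb_or => /andP[/f0 e1 /h0 e2].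
  by rewrite /d e1 e2 subrr.
have dA i : A i (d i) by apply: subspaceB.
suff dz i : d i = 0.
  by apply: funext => i; apply/eqP; rewrite -subr_eq0; apply/eqP; exact: dz.
have [iin|/d0 //] := boolP (i \in undup (s ++ t)).
apply: (indep _ d (undup_uniq (s ++ t)) dA) => //.
rewrite /d sumrB -!fsum_seq ?undup_uniq // -?vh ?(fsum_seq us f0) -?vE
  ?subrr //.
  by move=> j; rewrite mem_undup mem_cat negb_or => /andP[_ /h0].
by move=> j; rewrite mem_undup mem_cat negb_or => /andP[/f0].
Qed.

End DirectSums.

Section GradedDual.
Variables (K : fieldType) (N : lmodType K) (I : choiceType) (A : I -> set N).

Definition fin_functional (f : N -> K^o) :=
  linear f /\ finite_set [set i | exists2 x, A i x & f x <> 0].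

Definition gd_pred : {pred N -> K^o} := fun f => `[< fin_functional f >].

Record gd := GD { gd_fun :> N -> K^o; gd_funP : gd_fun \in gd_pred }.

HB.instance Definition _ := [isSub for gd_fun].
HB.instance Definition _ := [Choice of gd by <:].

Lemma fin_functionalD a f h : fin_functional f -> fin_functional h ->
  fin_functional (a *: f + h).
Proof.
move=> [fl ff] [hl hf]; split.
  by move=> b u v; rewrite !fctE fl hl !scalerDr addrACA !scalerA mulrC.
apply: (@sub_finite_set _ _ ([set i | exists2 x, A i x & f x <> 0] `|`
  [set i | exists2 x, A i x & h x <> 0])); last by rewrite finite_setU.
move=> i /= [x xi]; rewrite !fctE => nz.
have [e|/eqP] := eqVneq (f x) 0; last by left; exists x.
by right; exists x => // e'; apply: nz; rewrite e e' scaler0 addr0.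
Qed.

Lemma fin_functional0 : fin_functional 0.
Proof.
split; first by move=> b u v; rewrite scaler0 addr0.
by rewrite (_ : [set _ | _] = set0) // -subset0 => s /= [v _].
Qed.

Lemma gd_submod : submod_closed gd_pred.
Proof.
split; first exact/asboolP/fin_functional0.
by move=> a u v /asboolP uP /asboolP vP; apply/asboolP/fin_functionalD.
Qed.

HB.instance Definition _ := GRing.isSubmodClosed.Build K (N -> K^o) gd_pred
  (GRing.submod_closed_semi gd_submod).
HB.instance Definition _ := [SubChoice_isSubLmodule of gd by <:].

Lemma gd_fin (f : gd) : fin_functional f.
Proof. by have /asboolP := gd_funP f. Qed.

Definition mkgd f (fP : fin_functional f) : gd :=
  GD (introT (asboolP (fin_functional f)) fP : f \in gd_pred).

(** The graded dual is characterised through an evaluation map [ev], so that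
    what follows applies both to the dual vertex operator algebra, indexed by
    the integers, and to the duals [gd] of modules and comodules. *)
Definition is_graded_dual (D : lmodType K) (ev : D -> N -> K^o) :=
  [/\ forall a d e x, ev (a *: d + e) x = a *: ev d x + ev e x,
      forall d, fin_functional (ev d),
      forall f, fin_functional f -> exists d, ev d =1 f
    & forall d e, ev d =1 ev e -> d = e].

Lemma gd_graded_dual : is_graded_dual gd_fun.
Proof.
split=> //; first exact: gd_fin.
- by move=> f fP; exists (mkgd fP).
- by move=> d e /funext de; apply: val_inj.
Qed.

Definition dual_grade (D : Type) (ev : D -> N -> K^o) (i : I) : set D :=
  [set d | forall j x, j <> i -> A j x -> ev d x = 0].

Section Theory.
Hypothesis dA : direct_sum A.
Variables (D : lmodType K) (ev : D -> N -> K^o).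
Hypothesis evP : is_graded_dual ev.

Let ev_lin d : linear (ev d). Proof. by case: evP => _ h _ _; case: (h d). Qed.

Lemma graded_dual_linear d : linear (ev d). Proof. exact: ev_lin. Qed.

Lemma graded_dual_eval_linear x : linear (ev^~ x).
Proof. by case: evP => h _ _ _ a d e; exact: h. Qed.

Lemma fin_functional_component f i : linear f ->
  fin_functional (f \o component A i).
Proof.
move=> fl; split; first by move=> a u v; rewrite /= (component_linear dA) fl.
apply: (@seq_finite_set _ [:: i]) => j /= [x xj nz]; rewrite inE.
apply/eqP; apply: contrapT => ji; apply: nz.
by rewrite /= (component_out dA xj ji) (lin0 fl).
Qed.

Lemma graded_dual_extend f i : linear f ->
  exists2 d, dual_grade ev i d & forall x, ev d x = f (component A i x).
Proof.
move=> fl; have [_ _ ex _] := evP.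
have [d dE] := ex _ (fin_functional_component i fl); exists d => // j x ji xj.
by rewrite dE /= (component_out dA xj ji) (lin0 fl).
Qed.

Lemma dual_grade_subspace i : is_subspace (dual_grade ev i).
Proof.
have [ev4 _ _ _] := evP; split=> [j x _ _|a d e di ei j x ji xj].
  exact: (lin0 (graded_dual_eval_linear x)).
by rewrite ev4 (di j) // (ei j) // scaler0 addr0.
Qed.

Lemma dual_grade_eval i d x : dual_grade ev i d ->
  ev d x = ev d (component A i x).
Proof.
move=> di; have [s [us s0 {1}->]] := component_seq dA x.
rewrite (lin_sum (ev_lin d)).
have [is_|is_] := boolP (i \in s).
  rewrite (bigD1_seq i) //= big1 ?addr0 // => j /eqP ji.
  exact: di ji (component_mem dA _ _).
rewrite (s0 _ is_) (lin0 (ev_lin d)) big_seq big1 // => j js.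
by apply: di (component_mem dA _ _) => ji; rewrite ji in js; rewrite js in is_.
Qed.

(** Projection to a degree on the dual is the transpose of projection to that
    degree, which extends a functional on [A i] by zero. *)
Lemma graded_dual_direct_sum : direct_sum (dual_grade ev) /\
  forall i d x, ev (component (dual_grade ev) i d) x = ev d (component A i x).
Proof.
have [ev4 fin ex inj] := evP.
have pex i d : exists e, forall x, ev e x = ev d (component A i x).
  by have [e _] := graded_dual_extend i (ev_lin d); exists e.
pose p i d := projT1 (cid (pex i d)).
have pE i d x : ev (p i d) x = ev d (component A i x) by rewrite /p; case: cid.
have [||||||dD cE] := @component_eqP _ _ _ (dual_grade ev) p.
- exact: dual_grade_subspace.
- by move=> i a d e; apply: inj => x; rewrite ev4 !pE ev4.
- by move=> i d j x ji xj;
    rewrite pE (component_out dA xj ji) (lin0 (ev_lin d)).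
- by move=> i d di; apply: inj => x; rewrite pE -dual_grade_eval.
- move=> i j d di ij; apply: inj => x.
  rewrite pE (lin0 (graded_dual_eval_linear x)) (dual_grade_eval _ di).
  rewrite (component_component dA).
  by case: eqP => // _; rewrite (lin0 (ev_lin d)).
- move=> d; have [_ /finite_set_seq[s us sf]] := fin d; exists s.
  have s0 i : i \notin s -> p i d = 0.
    move=> /negP is_; apply: inj => x;
      rewrite pE (lin0 (graded_dual_eval_linear x)).
    apply: contrapT => nz; apply: is_; apply: sf.
    by exists (component A i x) => //; exact: component_mem.
  split=> //; apply: inj; apply: (graded_ext dA) => //.
  move=> i x xi.
  rewrite (lin_sum (graded_dual_eval_linear x)); under eq_bigr do rewrite pE.
  have [is_|is_] := boolP (i \in s).
    rewrite (bigD1_seq i) //= (component_in dA xi) big1 ?addr0 // => j ji.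
    by rewrite (component_out dA xi) ?(lin0 (ev_lin d)) // => ij;
      rewrite ij eqxx in ji.
  have := s0 _ is_ => /(congr1 (ev^~ x)); rewrite pE (component_in dA xi).
  rewrite (lin0 (graded_dual_eval_linear x)) => ->.
  rewrite big_seq big1 // => j js;
    rewrite (component_out dA xi) ?(lin0 (ev_lin d)) //.
  by move=> ij; rewrite ij js in is_.
by split=> // i d x; rewrite cE pE.
Qed.

Lemma graded_dual_separates i x :
  (forall d, dual_grade ev i d -> ev d x = 0) -> component A i x = 0.
Proof.
move=> h; apply: contrapT => nz.
have [f [fl _ f1]] := separation (subspace0 N) nz.
have [d di dE] := graded_dual_extend i fl.
by have := h d di; rewrite dE f1 => /eqP; rewrite oner_eq0.
Qed.

Lemma graded_dual_sep x : (forall d, ev d x = 0) -> x = 0.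
Proof.
move=> h; apply: (component_inj dA) => i.
by rewrite graded_dual_separates // (lin0 (component_linear dA i)).
Qed.

Lemma graded_dual_findim i : finite_dim (A i) -> finite_dim (dual_grade ev i).
Proof.
move=> [n [x xA]]; have [m [e [phi [lphi eA E]]]] :=
  fd_dual_basis (grade_subspace dA i) xA.
have [_ _ _ inj] := evP.
have uex k : exists d, forall x, ev d x = phi k (component A i x).
  by have [d _] := graded_dual_extend i (lphi k); exists d.
pose u k := projT1 (cid (uex k)).
have uE k y : ev (u k) y = phi k (component A i y) by rewrite /u; case: cid.
exists m, u => d di; apply/lspan_rangeP; exists (fun k => ev d (e k)).
apply: inj => y; rewrite (dual_grade_eval _ di) {1}(E _ (component_mem dA i y)).
rewrite (lin_sum (ev_lin d)) (lin_sum (graded_dual_eval_linear y)).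
apply: eq_bigr => k _.
by rewrite (linZ (ev_lin d)) (linZ (graded_dual_eval_linear y)) uE
  [_ *: _]mulrC.
Qed.

End Theory.

End GradedDual.

(** * Semisimplicity and its transfer through the graded dual *)

Section Stable.
Variables (K : fieldType) (V : lmodType K) (J : Type) (phi : J -> V -> V).
Hypothesis phil : forall j, linear (phi j).
Implicit Types X P Q : set V.

Definition stable X := is_subspace X /\ forall j v, X v -> X (phi j v).

Definition irr X :=
  [/\ stable X, X <> [set 0]
    & forall Y, stable Y -> Y `<=` X -> Y = [set 0] \/ Y = X].

(** The socle. *)
Definition soc : set V := lspan [set v | exists2 P, irr P & P v].

Lemma stable0 : stable [set 0].
Proof. by split=> [|j v ->]; [exact: subspace0|exact: lin0]. Qed.

Lemma stableI X Y : stable X -> stable Y -> stable (X `&` Y).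
Proof.
move=> [sX hX] [sY hY]; split=> [|j v [Xv Yv]]; first exact: subspaceI.
by split; [exact: hX|exact: hY].
Qed.

Lemma stable_sumsp X Y : stable X -> stable Y -> stable (sumsp X Y).
Proof.
move=> [sX hX] [sY hY]; split=> [|j _ [x [y [Xx Yy ->]]]].
  exact: subspace_sumsp.
by exists (phi j x), (phi j y); rewrite (linD (phil j)); split;
  [exact: hX|exact: hY|].
Qed.

Lemma stable_lspan (F : set (set V)) : (forall X, F X -> stable X) ->
  stable (lspan (\bigcup_(X in F) X)).
Proof.
move=> FX; split=> [|j v]; first exact: lspan_subspace.
have s : is_subspace [set v | lspan (\bigcup_(X in F) X) (phi j v)].
  have [h0 h] := lspan_subspace (\bigcup_(X in F) X).
  split=> [|a u w /= hu hw]; first by rewrite /= (lin0 (phil j)).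
  by rewrite phil; exact: h.
apply: (lspan_min s) => x [X XF Xx]; apply: lspan_in; exists X => //.
by case: (FX _ XF) => _; apply.
Qed.

Lemma irr_meet P X : irr P -> stable X -> P `<=` X \/ P `&` X = [set 0].
Proof.
move=> [sP P0 Pm] sX.
have [||->|E] := Pm (P `&` X); [exact: stableI|by move=> x []|by right|left].
by rewrite -E => x [].
Qed.

Lemma soc_sub X : is_subspace X -> (forall P, irr P -> P `<=` X) -> soc `<=` X.
Proof. by move=> sX h; apply: lspan_min => // v [P iP]; exact: h. Qed.

Lemma irr_soc P : irr P -> P `<=` soc.
Proof. by move=> iP v Pv; apply: lspan_in; exists P. Qed.

(** Take [Q] maximal among the stable subspaces that meet [X] trivially: an
    irreducible subspace outside [X + Q] could be added to [Q]. *)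
Lemma soc_complement X : (forall v, soc v) -> stable X ->
  exists Q, [/\ stable Q, X `&` Q `<=` [set 0] & forall v, sumsp X Q v].
Proof.
move=> socV sX.
pose M Q := stable Q /\ X `&` Q `<=` [set 0].
have [|F [X0 FX0] FM Ftot|Q [_ [sQ XQ] Qmax]] := @zorn_sets V M [set 0].
- by split; [exact: stable0|move=> v []].
- split; last by move=> v [Xv [Y FY Yv]]; case: (FM _ FY) => _; apply.
  split; first split.
  + by exists X0 => //; case: (FM _ FX0) => [[[]]].
  + move=> a x y [Y FY Yx] [Z FZ Zy].
    have [YZ|ZY] := Ftot _ _ FY FZ.
      by exists Z => //; case: (FM _ FZ) => [[[_ h] _] _]; apply: h => //;
        exact: YZ.
    by exists Y => //; case: (FM _ FY) => [[[_ h] _] _]; apply: h => //;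
      exact: ZY.
  + move=> j v [Y FY Yv]; exists Y => //.
    by case: (FM _ FY) => [[_ h] _]; exact: h.
exists Q; split=> // v; apply: soc_sub (socV v);
  first by case: (stable_sumsp sX sQ).
have X0 : X 0 by case: sX => [[]].
have Q0 : Q 0 by case: sQ => [[]].
move=> P iP; have sP : stable P by case: iP.
have [//|P0] := irr_meet iP (stable_sumsp sX sQ).
suff PQ : P `<=` Q by move=> p /PQ Qp; exists 0, p; rewrite add0r.
suff QPQ : sumsp Q P `<=` Q.
  by move=> p Pp; apply: QPQ; exists 0, p; rewrite add0r.
apply: Qmax.
- by move=> q Qq; exists q, 0; rewrite addr0; split=> //; case: sP => [[]].
- split; first exact: stable_sumsp.
  move=> v' [Xv [q [p [Qq Pp E]]]]; move: Xv; rewrite E => Xv.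
  have p0 : p = 0.
    suff : (P `&` sumsp X Q) p by rewrite P0.
    split=> //; exists (q + p), (- q); split=> //; last by rewrite addrC addKr.
    by rewrite -scaleN1r; apply: subspaceZ => //; case: sQ.
  by move: Xv; rewrite p0 addr0 => Xq; apply: XQ.
Qed.

Definition indep_family (F : set (set V)) := forall (s : seq (set V)) f,
  uniq s -> (forall P, P \in s -> F P /\ P (f P)) ->
  \sum_(P <- s) f P = 0 -> forall P, P \in s -> f P = 0.

Lemma chain_seq (T : eqType) (G : set (set T)) (s : seq T) :
  G !=set0 -> total_on G subset ->
  (forall x, x \in s -> exists2 X, G X & X x) ->
  exists2 X, G X & forall x, x \in s -> X x.
Proof.
move=> [X0 GX0] tot; elim: s => [|x s IH] h; first by exists X0.
have [X GX Xs] : exists2 X, G X & forall y, y \in s -> X y.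
  by apply: IH => y ys; apply: h; rewrite inE ys orbT.
have [Y GY Yx] := h x (mem_head _ _).
have [XY|YX] := tot _ _ GX GY.
  by exists Y => // y; rewrite inE => /orP[/eqP ->//|/Xs /XY].
by exists X => // y; rewrite inE => /orP[/eqP ->|/Xs//]; exact: YX.
Qed.

(** A maximal independent family of irreducible subspaces spans everything, as
    an irreducible subspace outside its span could be added to it. *)
Lemma soc_direct_sum : (forall v, soc v) ->
  exists (I : choiceType) (A : I -> set V),
    direct_sum A /\ forall i, irr (A i).
Proof.
move=> socV; pose M (F : set (set V)) := F `<=` irr /\ indep_family F.
have [|G G0 GM tot|F [_ [Firr Find] Fmax]] := @zorn_sets _ M set0.
- split; first exact: sub0set.
  by move=> s f _ h _ P /h[].
- split; first by move=> P [F GF FP]; case: (GM _ GF) => h _; exact: h.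
  move=> s f us h; have [|F GF Fs] := chain_seq G0 tot (s := s).
    by move=> P /h[[F GF FP] _]; exists F.
  apply: (proj2 (GM _ GF)) => // P Ps; split; first exact: Fs.
  by case: (h _ Ps).
pose W := lspan (\bigcup_(X in F) X).
have sW : stable W by apply: stable_lspan => X /Firr[].
have WV v : W v.
  apply: soc_sub (socV v); first by case: sW.
  move=> P iP; have [//|PW] := irr_meet iP sW.
  suff /(_ P) FP : (F `|` [set P]) `<=` F.
    by move=> p Pp; apply: lspan_in; exists P => //; apply: FP; right.
  apply: Fmax; first by left.
  split=> [Q [/Firr//|->//]|s f us h].
  have [Ps|Ps] := boolP (P \in s); last first.
    apply: Find => // Q Qs; have [[FQ|QP] Qf] := h _ Qs; first by [].
    by move: Ps; rewrite -[P](QP : Q = P) Qs.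
  have hF Q : Q \in rem P s -> F Q /\ Q (f Q).
    rewrite (mem_rem_uniq _ us) inE => /andP[/eqP QP /h[[]]//].
  rewrite (big_rem P) //= => E.
  have fP0 : f P = 0.
    suff : (P `&` W) (f P) by rewrite PW.
    split; first by case: (h _ Ps).
    have -> : f P = 0 - \sum_(Q <- rem P s) f Q by rewrite sub0r; apply/eqP;
      rewrite -addr_eq0 E.
    have [sW' _] := sW; apply: subspaceB => //; first by case: sW'.
    by apply: subspace_sum_in => // Q /hF[FQ Qf]; apply: lspan_in; exists Q.
  have fQ0 : forall Q, Q \in rem P s -> f Q = 0.
    by apply: Find; rewrite ?rem_uniq //; rewrite fP0 add0r in E.
  move=> Q Qs; have [->//|QP] := eqVneq Q P.
  by apply: fQ0; rewrite (mem_rem_uniq _ us) inE QP.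
pose I := {P : set V | P \in F}.
exists I, (fun i : I => val i).
have iI (i : I) : irr (val i) by apply/Firr/set_mem/(valP i).
split=> //; apply: direct_sum_indep => [i|v|s f us fA].
- by case: (iI i) => [[]].
- apply: lspan_mono (WV v) => x [P FP Px].
  by exists (exist _ P (mem_set FP) : I).
- move=> E i is_.
  pose f' (P : set V) : V := if insub P is Some i then f (i : I) else 0.
  have f'E j : f' (val j) = f j by rewrite /f' valK.
  rewrite -f'E; apply: (Find (map val s)).
  + by rewrite (map_inj_uniq val_inj).
  + by move=> P /mapP[j js ->]; rewrite f'E; split=> //; apply/set_mem/(valP j).
  + by rewrite big_map; under eq_bigr do rewrite f'E.
  + exact: map_f.
Qed.

Lemma direct_sum_soc (I : choiceType) (A : I -> set V) :
  direct_sum A -> (forall i, irr (A i)) -> forall v, soc v.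
Proof.
move=> dA iA; apply: (graded_ind dA); first exact: lspan_subspace.
by move=> i; exact: irr_soc.
Qed.

Definition cyc (w : V) : set V := [set v | forall X, stable X -> X w -> X v].

Lemma stable_cyc w : stable (cyc w).
Proof.
split; first split.
- by move=> X [[]].
- by move=> a u v hu hv X sX Xw; case: (sX) => [[_ h] _]; apply: h;
    [exact: hu|exact: hv].
- by move=> j v hv X sX Xw; case: (sX) => [_]; apply; exact: hv.
Qed.

End Stable.

Section GradedStable.
Variables (K : fieldType) (V : lmodType K) (I : choiceType) (A : I -> set V).
Variables (J : Type) (phi : J -> V -> V).

(** Graded subspaces are those stable under the projections to components, so
    these are counted among the operators. *)
Definition gops (x : I + J) : V -> V :=
  match x with inl i => component A i | inr j => phi j end.

Lemma stable_gops X :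
  stable gops X <-> graded_subspace A X /\ forall j v, X v -> X (phi j v).
Proof.
split=> [[sX h]|[[sX g] h]]; last by split=> // -[i|j] v Xv;
  [exact: g|exact: h].
by split=> [|j v Xv]; [split=> // v Xv i;
  exact: (h (inl i))|exact: (h (inr j))].
Qed.

End GradedStable.

Section Transfer.
Variables (K : fieldType) (N : lmodType K) (I : choiceType) (A : I -> set N).
Hypothesis dA : direct_sum A.
Variables (J : Type) (phi : J -> N -> N).
Hypothesis phil : forall j, linear (phi j).
Variables (D : lmodType K) (ev : D -> N -> K^o).
Hypothesis evP : is_graded_dual A ev.
Variable psi : J -> D -> D.
Hypothesis psiE : forall j d x, ev (psi j d) x = ev d (phi j x).

Local Notation B := (dual_grade A ev).
Local Notation ops := (gops A phi).
Local Notation dops := (gops B psi).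

Hypothesis complemented : forall X, stable dops X ->
  exists Q, [/\ stable dops Q, X `&` Q `<=` [set 0] & forall d, sumsp X Q d].

Let dB : direct_sum B. Proof. by case: (graded_dual_direct_sum dA evP). Qed.

Let ev_comp i d x : ev (component B i d) x = ev d (component A i x).
Proof. by case: (graded_dual_direct_sum dA evP). Qed.

Let evl d : linear (ev d). Proof. exact: graded_dual_linear evP d. Qed.

Let opsl j : linear (ops j).
Proof. by case: j => [i|j]; [exact: component_linear|exact: phil]. Qed.

Let dopsE j d x : ev (dops j d) x = ev d (ops j x).
Proof. by case: j => [i|j]; [exact: ev_comp|exact: psiE]. Qed.

(** Annihilators for the pairing of [D] with [N]. In infinite dimension
    [coperp (perp X)] is still [X] for graded [X], but [perp (coperp Y)] can be
    larger than [Y]. *)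
Definition perp (X : set N) : set D := [set d | forall x, X x -> ev d x = 0].
Definition coperp (Y : set D) : set N := [set x | forall d, Y d -> ev d x = 0].

Lemma stable_perp X : stable ops X -> stable dops (perp X).
Proof.
have [ev4 _ _ _] := evP; move=> [sX h]; split; first split.
- by move=> x _; exact: (lin0 (graded_dual_eval_linear evP x)).
- by move=> a d e hd he x Xx; rewrite ev4 hd // he // scaler0 addr0.
- by move=> j d hd x Xx; rewrite dopsE; apply: hd; exact: h.
Qed.

Lemma stable_coperp Y : stable dops Y -> stable ops (coperp Y).
Proof.
move=> [sY h]; split; first split.
- by move=> d _; exact: lin0.
- by move=> a u v hu hv d Yd; rewrite evl hu // hv // scaler0 addr0.
- by move=> j v hv d Yd; rewrite -dopsE; apply: hv; exact: h.
Qed.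

(** The complement of [X] in [W] is cut out by a complement [Y] of the
    annihilator of [X]. That [X] and its candidate complement fill the [i]-th
    component of [W] is biduality, as this component is finite-dimensional. *)
Lemma split_component i n (x : 'I_n -> N) W X :
  stable ops W -> W `&` A i `<=` lspan (range x) ->
  stable ops X -> X `<=` W ->
  exists Q, [/\ stable ops Q, Q `<=` W, X `&` Q `<=` [set 0]
    & forall w, (W `&` A i) w -> sumsp (X `&` A i) (Q `&` A i) w].
Proof.
move=> sW Wx sX XW; have [Y [sY XY tot]] := complemented (stable_perp sX).
have sQ : stable ops (W `&` coperp Y) by exact: stableI sW (stable_coperp sY).
exists (W `&` coperp Y); split=> //.
  move=> v [Xv [_ Yv]]; apply: (graded_dual_sep dA evP) => d.
  have [d1 [d2 [h1 h2 ->]]] := tot d.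
  by rewrite (linD (graded_dual_eval_linear evP v)) h1 // Yv // addr0.
move=> w Ww; apply: contrapT => nw.
have sA := grade_subspace dA i.
have [[sX' hX] [sQ' hQ] [sW' hW] [sY' hY]] := And4 sX sQ sW sY.
have [|p [pl p0 p1]] := @separation _ _ _ w _ nw.
  by apply: subspace_sumsp; exact: subspaceI.
have [ev4 _ _ _] := evP.
have z0 : (X `&` A i) 0 by split; [case: sX'|case: sA].
have z1 : (W `&` coperp Y `&` A i) 0 by split; [case: sQ'|case: sA].
have [||||||y [d Yd <-] dp] := @double_annihilator _ _ n x (W `&` A i)
    [set y | exists2 d, Y d & ev d = y] p.
- exact: subspaceI.
- exact: Wx.
- split.
    exists 0; first by case: sY'.
    by apply: funext => v; exact: (lin0 (graded_dual_eval_linear evP v)).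
  move=> a _ _ [d Yd <-] [e Ye <-]; exists (a *: d + e);
    first by case: sY' => _; apply.
  by apply: funext => v; rewrite ev4.
- by move=> _ [d _ <-]; exact: evl.
- exact: pl.
- move=> v [Wv iv] vY; apply: p0; exists 0, v; rewrite add0r; split=> //.
  by split=> //; split=> // d Yd; apply: vY; exists d.
have : component B i d = 0.
  apply: XY; split; last exact: (hY (inl i)).
  move=> v Xv; rewrite ev_comp.
  have Xi : X (component A i v) by exact: (hX (inl i)).
  have Ai := component_mem dA i v.
  rewrite dp; last by split=> //; exact: XW.
  by apply: p0; exists (component A i v), 0; rewrite addr0.
move=> /(congr1 (ev^~ w)); rewrite ev_comp (component_in dA (proj2 Ww)) dp //.
rewrite p1 (lin0 (graded_dual_eval_linear evP w)) => /eqP.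
by rewrite oner_eq0.
Qed.

(** Induction on the dimension of the [i]-th component of [W]: if the
    submodule generated by [w] is not irreducible, [w] is a sum of two elements
    of smaller submodules. *)
Lemma soc_component i n (x : 'I_n -> N) W w :
  stable ops W -> W `&` A i `<=` lspan (range x) -> W w -> A i w ->
  soc ops w.
Proof.
elim: n x W w => [|n IH] x W w sW Wx Ww Aw.
  have /lspan_rangeP[a ->] := Wx _ (conj Ww Aw).
  by rewrite big_ord0; exact: lspan0.
have sC := stable_cyc ops w.
have CW : cyc ops w `<=` W by move=> v; apply.
have Cw : cyc ops w w by move=> X.
have Cx : cyc ops w `&` A i `<=` lspan (range x).
  by move=> v [/CW Wv Av]; apply: Wx.
have [iC|] := pselect (irr ops (cyc ops w)); first exact: irr_soc Cw.
have [C0|C0 nirr] := pselect (cyc ops w = [set 0]).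
  by move=> _; move: Cw; rewrite C0 => ->; exact: lspan0.
have [Y [sY YC Y0 YnC]] : exists Y,
    [/\ stable ops Y, Y `<=` cyc ops w, Y <> [set 0] & Y <> cyc ops w].
  apply: contrapT => h; apply: nirr; split=> // Y sY YC.
  have [|Y0] := pselect (Y = [set 0]); first by left.
  by right; apply: contrapT => YnC; apply: h; exists Y.
have small Z : stable ops Z -> Z `<=` cyc ops w -> ~ Z w ->
    forall z, Z z -> A i z -> soc ops z.
  move=> sZ ZC nZ z Zz Az.
  have [f [fl f0 fw]] := separation (proj1 sZ) nZ.
  have [y yP] := span_hyperplane Cx (conj Cw Aw) fl fw.
  by apply: (IH y Z z) => // v [Zv Av]; apply: yP; [split=> //;
    exact: ZC|exact: f0].
have [Q [sQ QC YQ tot]] := split_component sC Cx sY YC.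
have [y [q [[Yy Ay] [Qq Aq] ->]]] := tot w (conj Cw Aw).
have nY : ~ Y w.
  by move=> Yw; apply: YnC; apply/seteqP; split=> // v; apply.
have nQ : ~ Q w.
  move=> Qw; apply: Y0; apply/seteqP; split=> [v Yv|v ->];
    last by case: sY => [[]].
  by apply: YQ; split=> //; apply: (YC v Yv).
apply: subspaceD; first exact: lspan_subspace.
  exact: (small Y).
exact: (small Q).
Qed.

(** Semisimplicity passes from the graded dual of [N] to [N], provided the
    components of the submodules generated by homogeneous elements are
    finite-dimensional in the degree of the generator. *)
Lemma semisimple_transfer :
  (forall i w, A i w -> exists W, [/\ stable ops W, W w
     & exists n (x : 'I_n -> N), W `&` A i `<=` lspan (range x)]) ->
  exists (I' : choiceType) (P : I' -> set N),
    direct_sum P /\ forall i, irr ops (P i).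
Proof.
move=> fin; apply: soc_direct_sum => //.
apply: (graded_ind dA); first exact: lspan_subspace.
move=> i w Aw; have [W [sW Ww [n [x Wx]]]] := fin _ _ Aw.
exact: soc_component sW Wx Ww Aw.
Qed.

End Transfer.

(** * Contractions of tensors *)

Section TensorCalculus.
Variable K : fieldType.
Implicit Types U V W : lmodType K.

Lemma tens_linl V W (w : W) : linear (fun v : V => tens v w).
Proof. by case: (@tens_bilinear K V W). Qed.

Lemma tens_linr V W (v : V) : linear (fun w : W => tens v w).
Proof. by case: (@tens_bilinear K V W). Qed.

Lemma tensor_ext V W U (f h : tensor V W -> U) : linear f -> linear h ->
  (forall v w, f (tens v w) = h (tens v w)) -> f =1 h.
Proof.
move=> fl hl fh x; rewrite [x]tensor_sumE (lin_sum fl) (lin_sum hl).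
by apply: eq_bigr.
Qed.

Lemma lin_comp U V W (f : V -> W) (h : U -> V) : linear f -> linear h ->
  linear (fun x => f (h x)).
Proof. by move=> fl hl a u v; rewrite hl fl. Qed.

Lemma lin_id V : linear (@id V). Proof. by []. Qed.

Section Maps.
Variables (V V' W W' : lmodType K) (f : V -> V') (h : W -> W').
Hypotheses (fl : linear f) (hl : linear h).

Let bil : bilinear_fun (fun v w => tens (f v) (h w)).
Proof. by split=> [w|v] a x y; rewrite ?fl ?hl ?tens_linl ?tens_linr. Qed.

Lemma tmap_tens v w : tmap f h (tens v w) = tens (f v) (h w).
Proof. exact: tlift_tens bil _ _. Qed.

Lemma tmap_linear : linear (tmap f h).
Proof. exact: tlift_linear bil. Qed.

End Maps.

Section Contraction.
Variables (V W : lmodType K) (u : V -> K^o).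
Hypothesis ul : linear u.

Let bil : bilinear_fun (fun (v : V) (w : W) => (u v : K) *: w).
Proof.
split=> [w|v] a x y; first by rewrite ul scalerDl scalerA.
by rewrite scalerDr !scalerA mulrC.
Qed.

Lemma tcontr_l_tens v (w : W) : tcontr_l u (tens v w) = (u v : K) *: w.
Proof. exact: tlift_tens bil _ _. Qed.

Lemma tcontr_l_linear : linear (@tcontr_l K V W u).
Proof. exact: tlift_linear bil. Qed.

End Contraction.

Section ContractionRight.
Variables (V W : lmodType K) (u : W -> K^o).
Hypothesis ul : linear u.

Let bil : bilinear_fun (fun (v : V) (w : W) => (u w : K) *: v).
Proof.
split=> [w|v] a x y; last by rewrite ul scalerDl scalerA.
by rewrite scalerDr !scalerA mulrC.
Qed.

Lemma tcontr_r_tens (v : V) w : tcontr_r u (tens v w) = (u w : K) *: v.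
Proof. exact: tlift_tens bil _ _. Qed.

Lemma tcontr_r_linear : linear (@tcontr_r K V W u).
Proof. exact: tlift_linear bil. Qed.

End ContractionRight.

Section Pairing.
Variables (V W : lmodType K) (u : V -> K^o) (v : W -> K^o).
Hypotheses (ul : linear u) (vl : linear v).

Let bil : bilinear_fun (fun x y => (u x * v y : K^o)).
Proof.
split=> [w|x] a y z; first by rewrite ul mulrDl -scalerAl.
by rewrite vl mulrDr -scalerAr.
Qed.

Lemma tpair_linear : linear (tpair u v).
Proof. exact: tlift_linear bil. Qed.

Lemma tpairE x : tpair u v x = v (tcontr_l u x).
Proof.
apply: (@tensor_ext V W K^o (tpair u v) (fun x => v (tcontr_l u x))) x;
  [exact: tpair_linear|exact: lin_comp vl (tcontr_l_linear ul)|].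
move=> x y; rewrite tcontr_l_tens // (linZ vl).
exact: tlift_tens bil _ _.
Qed.

Lemma tpairE_r x : tpair u v x = u (tcontr_r v x).
Proof.
apply: (@tensor_ext V W K^o (tpair u v) (fun x => u (tcontr_r v x))) x;
  [exact: tpair_linear|exact: lin_comp ul (tcontr_r_linear vl)|].
move=> x y; rewrite tcontr_r_tens // (linZ ul) [_ *: _]mulrC.
exact: tlift_tens bil _ _.
Qed.

End Pairing.

Lemma tcontr_l_map V V' W W' (u : V' -> K^o) (f : V -> V') (h : W -> W') x :
  linear u -> linear f -> linear h ->
  tcontr_l u (tmap f h x) = h (tcontr_l (fun v => u (f v)) x).
Proof.
move=> ul fl hl; have ufl := lin_comp ul fl.
apply: (@tensor_ext V W W' (fun x => tcontr_l u (tmap f h x))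
  (fun x => h (tcontr_l (fun v => u (f v)) x))) x.
- exact: lin_comp (tcontr_l_linear ul) (tmap_linear fl hl).
- exact: lin_comp hl (tcontr_l_linear ufl).
- by move=> v w; rewrite tmap_tens // !tcontr_l_tens // (linZ hl).
Qed.

Lemma tcontr_l_lincomb V W a (u u' : V -> K^o) (x : tensor V W) :
  linear u -> linear u' ->
  tcontr_l (fun v => a *: u v + u' v) x = a *: tcontr_l u x + tcontr_l u' x.
Proof.
move=> ul u'l.
have lc : linear (fun v => a *: u v + u' v : K^o).
  by move=> b v w; rewrite ul u'l !scalerDr addrACA !scalerA mulrC.
apply: (@tensor_ext V W W (tcontr_l (fun v => a *: u v + u' v))
  (fun x => a *: tcontr_l u x + tcontr_l u' x)) x; first exact: tcontr_l_linear.
  move=> b x y; rewrite !(tcontr_l_linear ul, tcontr_l_linear u'l).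
  by rewrite !scalerDr addrACA !scalerA mulrC.
by move=> v w; rewrite !tcontr_l_tens // scalerDl scalerA.
Qed.

Section Rebracket.
Variables U V W : lmodType K.

Let assoc1 (w : W) : bilinear_fun (fun (u : U) (v : V) => tens u (tens v w)).
Proof. by split=> [v|u] a x y; rewrite tens_linl // tens_linr. Qed.

Let assoc2 : bilinear_fun (fun (x : tensor U V) (w : W) =>
  tlift (fun u v => tens u (tens v w)) x).
Proof.
split=> [w|x a w w']; first exact: tlift_linear (assoc1 w).
apply: (@tensor_ext U V _ (tlift (fun u v => tens u (tens v (a *: w + w'))))
  (fun x => a *: tlift (fun u v => tens u (tens v w)) x
     + tlift (fun u v => tens u (tens v w')) x)) x.
- exact: tlift_linear (assoc1 _).
- move=> b x x'; rewrite !(tlift_linear (assoc1 _)).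
  by rewrite !scalerDr addrACA !scalerA mulrC.
- by move=> u v; rewrite !(tlift_tens (assoc1 _)) tens_linr tens_linr.
Qed.

Lemma tassoc_linear : linear (@tassoc K U V W).
Proof. exact: tlift_linear assoc2. Qed.

Lemma tassoc_tens (u : U) (v : V) (w : W) :
  tassoc (tens (tens u v) w) = tens u (tens v w).
Proof. by rewrite /tassoc (tlift_tens assoc2) (tlift_tens (assoc1 w)). Qed.

Let swap1 (u : U) : bilinear_fun (fun (v : V) (w : W) => tens v (tens u w)).
Proof. by split=> [v|w] a x y; rewrite ?tens_linl // !tens_linr. Qed.

Let swap2 : bilinear_fun (fun (u : U) (y : tensor V W) =>
  tlift (fun v w => tens v (tens u w)) y).
Proof.
split=> [y a u u'|u]; last exact: tlift_linear (swap1 u).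
apply: (@tensor_ext V W _ (tlift (fun v w => tens v (tens (a *: u + u') w)))
  (fun x => a *: tlift (fun v w => tens v (tens u w)) x
     + tlift (fun v w => tens v (tens u' w)) x)) y.
- exact: tlift_linear (swap1 _).
- move=> b x x'; rewrite !(tlift_linear (swap1 _)).
  by rewrite !scalerDr addrACA !scalerA mulrC.
- by move=> v w; rewrite !(tlift_tens (swap1 _)) tens_linl tens_linr.
Qed.

Lemma tswap12_linear : linear (@tswap12 K U V W).
Proof. exact: tlift_linear swap2. Qed.

Lemma tswap12_tens (u : U) (v : V) (w : W) :
  tswap12 (tens u (tens v w)) = tens v (tens u w).
Proof. by rewrite /tswap12 (tlift_tens swap2) (tlift_tens (swap1 u)). Qed.

End Rebracket.

Lemma tcontr_assoc V W X (u : V -> K^o) (v : W ->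
  K^o) (x : tensor (tensor V W) X) :
  linear u -> linear v ->
  tcontr_l v (tcontr_l u (tassoc x)) = tcontr_l (tpair u v) x.
Proof.
move=> ul vl; have uvl := tpair_linear ul vl.
have ll := lin_comp (tcontr_l_linear (W := X) vl)
   (lin_comp (tcontr_l_linear ul) (@tassoc_linear V W X)).
apply: (tensor_ext ll (tcontr_l_linear uvl)) x => y z.
have yl : linear (fun y : tensor V W => tens y z) by exact: tens_linl.
apply: (tensor_ext (lin_comp ll yl)
  (lin_comp (tcontr_l_linear (W := X) uvl) yl)) y => a b /=.
rewrite tassoc_tens !tcontr_l_tens // (linZ (tcontr_l_linear vl)).
by rewrite tcontr_l_tens // tpairE // tcontr_l_tens // (linZ vl) scalerA.
Qed.

Lemma tcontr_swap V W X (u : V -> K^o) (v : W ->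
  K^o) (x : tensor W (tensor V X)) :
  linear u -> linear v ->
  tcontr_l v (tcontr_l u (tswap12 x)) = tcontr_l u (tcontr_l v x).
Proof.
move=> ul vl.
have l1 := lin_comp (tcontr_l_linear (W := X) vl)
   (lin_comp (tcontr_l_linear ul) (@tswap12_linear W V X)).
have l2 := lin_comp (tcontr_l_linear (W := X) ul)
  (tcontr_l_linear (W := tensor V X) vl).
apply: (tensor_ext l1 l2) x => y z.
have yl : linear (fun z : tensor V X => tens y z) by exact: tens_linr.
apply: (tensor_ext (lin_comp l1 yl) (lin_comp l2 yl)) z => a b /=.
rewrite tswap12_tens !tcontr_l_tens // (linZ (tcontr_l_linear vl)).
rewrite (linZ (tcontr_l_linear ul)) !tcontr_l_tens // !scalerA.
by rewrite mulrC.
Qed.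

(** ** Tensors with a factor in a graded space, tested by its graded dual *)

Section GradedFactor.
Variables (V : lmodType K) (I : choiceType) (A : I -> set V).
Hypothesis dA : direct_sum A.
Variables (D : lmodType K) (ev : D -> V -> K^o).
Hypothesis evP : is_graded_dual A ev.

Let evl d : linear (ev d). Proof. exact: graded_dual_linear evP d. Qed.

Lemma component_sum_seq (t : seq I) v : uniq t ->
  (forall i, i \notin t -> component A i v = 0) ->
  v = \sum_(i <- t) component A i v.
Proof.
move=> ut t0; have [_ _ {1}->] := component_decomposition dA v.
exact: fsum_seq.
Qed.

Lemma common_degrees (T : eqType) (s : seq T) (f : T -> V) :
  exists2 t : seq I, uniq t & forall p, p \in s ->
    forall i, i \notin t -> component A i (f p) = 0.
Proof.
elim: s => [|p s [t ut h]]; first by exists [::].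
have [t' [ut' h' _]] := component_seq dA (f p).
exists (undup (t' ++ t)); first exact: undup_uniq.
move=> q; rewrite inE => /orP[/eqP ->|/h hq] i;
  rewrite mem_undup mem_cat negb_or => /andP[it' it].
  exact: h'.
exact: hq.
Qed.

Lemma graded_dual_extend_seq (t : seq I) (f : V -> K^o) : linear f ->
  exists d, forall x, ev d x = \sum_(i <- t) f (component A i x).
Proof.
move=> fl; elim: t => [|i t [d dE]].
  by exists 0 => x; rewrite big_nil (lin0 (graded_dual_eval_linear evP x)).
have [e _ eE] := graded_dual_extend dA evP i fl; exists (e + d) => x.
by rewrite (linD (graded_dual_eval_linear evP x)) eE dE big_cons.
Qed.

(** The finitely many first factors of [x] involve finitely many degrees, so
    the coordinates in their span can be taken in the graded dual. *)
Lemma tensor_expand W (x : tensor V W) : exists n (e : 'I_n -> V) (u : 'I_n ->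
  D),
  x = \sum_i tens (e i) (tcontr_l (ev (u i)) x).
Proof.
pose s := repr x; have xE : x =
  \sum_(p <- s) tens p.1 p.2 by exact: tensor_sumE.
have [t ut tP] := common_degrees s fst.
pose S : set V := lspan [set v | v \in map fst s].
have [m [y yS]] : exists m (y : 'I_m -> V), S `<=` lspan (range y).
  exists (size (map fst s)), (fun i => nth 0 (map fst s) i).
  apply: lspan_mono => v /= vs.
  by exists (Ordinal (etrans (index_mem v _) vs)); rewrite //= nth_index.
have [n [e [phi [lphi _ E]]]] := fd_dual_basis (lspan_subspace _) yS.
have uex i : exists d, forall x, ev d x = \sum_(j <- t) phi i (component A j x).
  exact: graded_dual_extend_seq.
pose u i := projT1 (cid (uex i)).
have uE p i : p \in s -> ev (u i) p.1 = phi i p.1.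
  move=> ps; rewrite /u; case: cid => d /= ->.
  by rewrite -(lin_sum (lphi i)) -component_sum_seq //; exact: tP.
exists n, e, u.
have cE i : tcontr_l (ev (u i)) x = \sum_(p <- s) (phi i p.1 : K) *: p.2.
  rewrite {1}xE (lin_sum (tcontr_l_linear (evl _))) big_seq [RHS]big_seq.
  by apply: eq_bigr => p ps; rewrite tcontr_l_tens // uE.
under eq_bigr do rewrite cE (lin_sum (tens_linr _)).
rewrite exchange_big /= {1}xE big_seq [RHS]big_seq; apply: eq_bigr => p ps.
have Sp : S p.1 by apply: lspan_in; exact: map_f.
rewrite {1}(E _ Sp) (lin_sum (tens_linl p.2)); apply: eq_bigr => i _.
by rewrite (linZ (tens_linl p.2)) (linZ (tens_linr _)).
Qed.

Lemma tensor_separates W (x : tensor V W) :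
  (forall d, tcontr_l (ev d) x = 0) -> x = 0.
Proof.
move=> h; have [n [e [u ->]]] := tensor_expand x.
by apply: big1 => i _; rewrite h (lin0 (tens_linr _)).
Qed.

Lemma tensor_eq W (x y : tensor V W) :
  (forall d, tcontr_l (ev d) x = tcontr_l (ev d) y) -> x = y.
Proof.
move=> h; apply/eqP; rewrite -subr_eq0; apply/eqP/tensor_separates => d.
by rewrite (linB (tcontr_l_linear (evl d))) h subrr.
Qed.

Lemma tensor_eq2 W (x y : tensor V (tensor V W)) :
  (forall d d', tcontr_l (ev d') (tcontr_l (ev d) x) =
                tcontr_l (ev d') (tcontr_l (ev d) y)) -> x = y.
Proof. by move=> h; apply: tensor_eq => d; apply: tensor_eq => d'. Qed.

(** This turns subcomodules into subspaces stable under contractions of the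
    coaction. *)
Lemma tensor_in_sub W (X : set W) (x : tensor V W) : is_subspace X ->
  (lspan [set y | exists v w, X w /\ y = tens v w] x <->
   forall d, X (tcontr_l (ev d) x)).
Proof.
move=> sX; split=> [h d|h].
  have s : is_subspace [set y : tensor V W | X (tcontr_l (ev d) y)].
    split=> [|a y z hy hz] /=;
      first by rewrite (lin0 (tcontr_l_linear (evl d))); case: sX.
    by rewrite (tcontr_l_linear (evl d)); case: sX => _; apply.
  apply: (lspan_min s) h => _ [v [w [Xw ->]]] /=.
  by rewrite tcontr_l_tens //; exact: subspaceZ.
have [n [e [u ->]]] := tensor_expand x; apply: subspace_sum => [|i _].
  exact: lspan_subspace.
by apply: lspan_in; exists (e i), (tcontr_l (ev (u i)) x).
Qed.

Hypothesis fdA : forall i, finite_dim (A i).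
Local Notation B := (dual_grade A ev).

(** Each [A i] being finite-dimensional, it contributes the canonical element
    [sum_k e_k (x) beta u_k] attached to a basis [e_k] with dual basis [u_k]. *)
Lemma tensor_of_map W (beta : D -> W) (s : seq I) : linear beta -> uniq s ->
  (forall i d, i \notin s -> B i d -> beta d = 0) ->
  exists2 x, lspan [set y | exists i v d,
      [/\ A i v, B i d & y = tens v (beta d)]] x
    & forall d, tcontr_l (ev d) x = beta d.
Proof.
move=> bl us b0; have [dB cB] := graded_dual_direct_sum dA evP.
have [_ _ _ inj] := evP.
have one i : exists2 x, lspan [set y | exists i v d,
      [/\ A i v, B i d & y = tens v (beta d)]] x
    & forall d, tcontr_l (ev d) x = beta (component B i d).
  have [n [y yA]] := fdA i.
  have [m [e [phi [lphi eA E]]]] := fd_dual_basis (grade_subspace dA i) yA.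
  have uex k := cid2 (graded_dual_extend dA evP i (lphi k)).
  pose u k := s2val (uex k).
  have uE k z : ev (u k) z =
    phi k (component A i z) by exact: (s2valP' (uex k)).
  have uB k : B i (u k) by exact: (s2valP (uex k)).
  exists (\sum_k tens (e k) (beta (u k))) => [|d].
    apply: subspace_sum => [|k _]; first exact: lspan_subspace.
    by apply: lspan_in; exists i, (e k), (u k).
  rewrite (lin_sum (tcontr_l_linear (evl d))).
  have -> : component B i d = \sum_k (ev d (e k) : K) *: u k.
    apply: inj => z; rewrite cB {1}(E _ (component_mem dA i z)).
    rewrite (lin_sum (evl d)) (lin_sum (graded_dual_eval_linear evP z)).
    apply: eq_bigr => k _; rewrite (linZ (evl d)).
    by rewrite (linZ (graded_dual_eval_linear evP z)) uE [_ *: _]mulrC.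
  rewrite (lin_sum bl); apply: eq_bigr => k _.
  by rewrite tcontr_l_tens // (linZ bl).
pose x i := s2val (cid2 (one i)).
have xP i d : tcontr_l (ev d) (x i) = beta (component B i d).
  exact: (s2valP' (cid2 (one i))).
exists (\sum_(i <- s) x i) => [|d].
  apply: subspace_sum => [|i _]; first exact: lspan_subspace.
  exact: (s2valP (cid2 (one i))).
rewrite (lin_sum (tcontr_l_linear (evl d))); under eq_bigr do rewrite xP.
rewrite -(lin_sum bl); apply/eqP; rewrite -subr_eq0 -(linB bl); apply/eqP.
have fl : linear (fun d => beta (\sum_(i <- s) component B i d - d)).
  move=> a d1 d2; rewrite -bl; congr beta; rewrite scalerBr addrACA -opprD.
  congr (_ - _); rewrite scaler_sumr -big_split; apply: eq_bigr => i _.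
  exact: component_linear.
apply: (graded_ext dB (g := fun=> 0) fl) => [a d1 d2|i d1 d1i].
  by rewrite scaler0 addr0.
have [is_|is_] := boolP (i \in s).
  rewrite (bigD1_seq i) //= (component_in dB d1i) big1 ?addr0 ?subrr
    ?(lin0 bl) //.
  by move=> j ji; apply: (component_out dB d1i) => ij; rewrite ij eqxx in ji.
rewrite (linB bl) (b0 _ _ is_ d1i) subr0 big_seq big1 ?(lin0 bl) // => j js.
by apply: (component_out dB d1i) => ij; rewrite ij js in is_.
Qed.

End GradedFactor.

End TensorCalculus.

(** * Jacobi identities as identities between one-parameter sums *)

Section Jacobi.
Variable R : realType.
Local Notation C := R[i].
Implicit Types U : lmodType C.

Lemma fsum_nat (M : zmodType) (F : nat -> M) k :
  (forall i, (k <= i)%N -> F i = 0) ->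
  \sum_(i \in [set: nat]) F i = \sum_(i < k) F i.
Proof.
move=> F0; rewrite (fsum_seq (s := iota 0 k)) ?iota_uniq //.
  by rewrite -[k in iota _ k]subn0 -/(index_iota 0 k) big_mkord.
by move=> i; rewrite mem_iota add0n leq0n /= -leqNgt => /F0.
Qed.

Lemma lin_fsum U U' (f : U -> U') (F : nat -> U) : linear f ->
  (exists k, forall i, (k <= i)%N -> F i = 0) ->
  f (\sum_(i \in [set: nat]) F i) = \sum_(i \in [set: nat]) f (F i).
Proof.
move=> fl [k F0]; rewrite (fsum_nat F0) (fsum_nat (k := k)) ?(lin_sum fl) //.
by move=> i /F0 ->; exact: lin0.
Qed.

(** The condition that makes the sums [jac1], [jac2] and [jac3] below finite,
    for a suitable order of the two variables. *)
Definition trunc U (P : rat -> rat -> U) := forall x y, exists k : nat,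
  forall i, (k <= i)%N -> P (x + i%:R) (y - i%:R) = 0.

(** The three formal products of a Jacobi identity, at a given coefficient. One
    variable of the vector-valued series is frozen there, so that the sum over
    three exponents of the delta function runs over a single natural number. *)
Definition jac1 U (P : rat -> rat -> U) (a b c : rat) : U :=
  if - a - 1 \is a Num.int then
    \sum_(i \in [set: nat])
      (gbin R (- a - 1) i * (- 1) ^+ i) *: P (b + a + 1 + i%:R) (c - i%:R)
  else 0.

Definition jac2 U (P : rat -> rat -> U) (a b c : rat) : U :=
  if - a - 1 \is a Num.int then
    \sum_(i \in [set: nat])
      ((- 1) ^ Num.floor (- a - 1) * (gbin R (- a - 1) i * (- 1) ^+ i)) *:
         P (b - i%:R) (c + a + 1 + i%:R)
  else 0.

Definition jac3 U (rho : rat) (P : rat -> rat -> U) (a b c : rat) : U :=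
  if b - rho \is a Num.int then
    \sum_(i \in [set: nat]) gbin R (- b - 1) i *: P (a - i%:R)
      (c + b + 1 + i%:R)
  else 0.

Definition Jac U (rho : rat) (P1 P2 Q : rat -> rat -> U) :=
  forall a b c, jac1 P1 a b c - jac2 P2 a b c = jac3 rho Q a b c.

Lemma fmul3_line U (k : fser3 C) (F : fser3 U) a b c
    (h : nat -> rat * rat * rat) :
  injective h ->
  (forall p, k p.1.1 p.1.2 p.2 *: F (a - p.1.1) (b - p.1.2) (c - p.2) <> 0 ->
     exists i, p = h i) ->
  fmul3 k F a b c = \sum_(i \in [set: nat])
    k (h i).1.1 (h i).1.2 (h i).2 *:
      F (a - (h i).1.1) (b - (h i).1.2) (c - (h i).2).
Proof.
move=> hi ex; rewrite /fmul3 -(fsbig_widen (range h)) //; last first.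
  move=> p [_ np] /=; apply: contrapT => /ex[i pE]; apply: np.
  by exists i.
by rewrite fsbig_image // => i j _ _; exact: hi.
Qed.

Lemma fmul3_eq0 U (k : fser3 C) (F : fser3 U) a b c :
  (forall p1 p2 p3, k p1 p2 p3 *: F (a - p1) (b - p2) (c - p3) = 0) ->
  fmul3 k F a b c = 0.
Proof. by move=> h; rewrite /fmul3 fsbig1. Qed.

Lemma natrI_rat : injective (fun i : nat => i%:R : rat).
Proof. by move=> i j /eqP; rewrite eqr_nat => /eqP. Qed.

Lemma delta_coef_nat eps rho ew ex (i : nat) :
  delta_coef (R := R) eps rho ew ex i%:R =
  if (- ew - 1 - rho \is a Num.int) && (ex + i%:R == - ew - 1)
  then gbin R (- ew - 1) i * eps ^+ i else 0.
Proof. by rewrite /delta_coef natr_nat natrK. Qed.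

Lemma delta_coef_supp eps rho ew ex ey :
  delta_coef (R := R) eps rho ew ex ey <> 0 ->
  [/\ - ew - 1 - rho \is a Num.int, exists i : nat, ey = i%:R
    & ex = - ew - 1 - ey].
Proof.
rewrite /delta_coef; case: ifP => // /and3P[h1 h2 /eqP h3] _; split=> //.
  by exists (Num.truncn ey); rewrite Num.Theory.truncnK.
by rewrite -h3 addrK.
Qed.

Lemma delta_012E U (P : rat -> rat -> U) a b c :
  fmul3 (delta_012 R) (fun a b c => if a == 0 then P b c else 0) a b c =
  jac1 P a b c.
Proof.
rewrite /jac1; case: ifPn => [aI|aNI]; last first.
  apply: fmul3_eq0 => p1 p2 p3.
  case: eqP => [/eqP|]; last by rewrite scaler0.
  rewrite subr_eq0 => /eqP <-; rewrite /delta_012 /delta_coef subr0 (negPf aNI).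
  by rewrite scale0r.
rewrite (fmul3_line (h := fun i => (a, - a - 1 - i%:R, i%:R))).
- apply: eq_fsbigr => i _ /=;
    rewrite subrr eqxx /delta_012 delta_coef_nat subr0 aI.
  by rewrite subrK eqxx /=; congr (_ *: P _ _); ring.
- by move=> i j [_ /natrI_rat].
- move=> [[p1 p2] p3] /= nz.
  have [e|ne] := eqVneq (a - p1) 0; last by rewrite (negPf ne) scaler0 in nz.
  have e1 : p1 = a by apply/eqP; rewrite eq_sym -subr_eq0 e.
  have [_ [i ->] ->] : _ := delta_coef_supp (fun k0 =>
    nz (etrans (congr1 (fun k => k *: _) k0) (scale0r _))).
  by exists i; rewrite e1.
Qed.

Lemma delta_021E U (P : rat -> rat -> U) a b c :
  fmul3 (delta_021 R) (fun a b c => if a == 0 then P b c else 0) a b c =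
  jac2 P a b c.
Proof.
rewrite /jac2; case: ifPn => [aI|aNI]; last first.
  apply: fmul3_eq0 => p1 p2 p3.
  case: eqP => [/eqP|]; last by rewrite scaler0.
  rewrite subr_eq0 => /eqP <-; rewrite /delta_021 /delta_coef subr0 (negPf aNI).
  by rewrite mulr0 scale0r.
rewrite (fmul3_line (h := fun i => (a, i%:R, - a - 1 - i%:R))).
- apply: eq_fsbigr => i _ /=;
    rewrite subrr eqxx /delta_021 delta_coef_nat subr0 aI.
  by rewrite subrK eqxx /=; congr (_ *: P _ _); ring.
- by move=> i j [/natrI_rat].
- move=> [[p1 p2] p3] /= nz.
  have [e|ne] := eqVneq (a - p1) 0; last by rewrite (negPf ne) scaler0 in nz.
  have e1 : p1 = a by apply/eqP; rewrite eq_sym -subr_eq0 e.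
  have [_ [i ->] ->] : _ := delta_coef_supp (fun k0 =>
    nz (etrans (congr1 (fun k => (_ * k) *: _) k0)
    (etrans (congr1 (fun k => k *: _) (mulr0 _)) (scale0r _)))).
  by exists i; rewrite e1.
Qed.

(** Upper negation: [z0^i] has the same coefficient in [(z1 - z0)^(b + i)] and
    in [(z2 + z0)^(- b - 1)], so the iterate sides of the coalgebra and of the
    module Jacobi identities are both of the form [jac3]. *)
Lemma gbin_neg (b : rat) i :
  gbin R (b + i%:R) i * (- 1) ^+ i = gbin R (- b - 1) i.
Proof.
have -> : (- 1) ^+ i = ratr ((- 1) ^+ i) :> C by rewrite rmorphXn rmorphN1.
rewrite /gbin -rmorphM /=; congr ratr; rewrite mulrAC; congr (_ / _).
rewrite (reindex_inj rev_ord_inj) /= mulrC -[X in _ ^+ X]card_ord -prodr_const.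
rewrite -big_split /=; apply: eq_bigr => j _.
by rewrite natrB // -[j.+1]addn1 natrD; ring.
Qed.

Lemma delta_210E U rho (P : rat -> rat -> U) a b c :
  fmul3 (delta_210 R rho) (fun a b c => if b == 0 then P a c else 0) a b c =
  jac3 rho P a b c.
Proof.
rewrite /jac3; case: ifPn => [bI|bNI]; last first.
  apply: fmul3_eq0 => p1 p2 p3.
  case: eqP => [/eqP|]; last by rewrite scaler0.
  rewrite subr_eq0 => /eqP <-; rewrite /delta_210.
  case: (pselect (delta_coef (R := R) (- 1) rho p3 b p1 = 0)) => [->|nz].
    by rewrite scale0r.
  have [h [i e1] e2] := delta_coef_supp nz; exfalso; move/negP: bNI; apply.
  have -> : b - rho = - p3 - 1 - rho - i%:R by rewrite e2 e1; ring.
  by rewrite rpredB // natr_int.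
rewrite (fmul3_line (h := fun i => (i%:R, b, - b - 1 - i%:R))).
- apply: eq_fsbigr => i _ /=; rewrite subrr eqxx /delta_210 delta_coef_nat.
  have -> : - (- b - 1 - i%:R) - 1 = b + i%:R by ring.
  have -> : b + i%:R - rho = (b - rho) + i%:R by ring.
  rewrite rpredD ?natr_int // eqxx /= gbin_neg.
  by congr (_ *: P _ _); ring.
- by move=> i j [/natrI_rat].
- move=> [[p1 p2] p3] /= nz.
  have [e|ne] := eqVneq (b - p2) 0; last by rewrite (negPf ne) scaler0 in nz.
  have e1 : p2 = b by apply/eqP; rewrite eq_sym -subr_eq0 e.
  have dnz : delta_210 R rho p1 p2 p3 <> 0.
    by move=> k0; apply: nz; rewrite k0 scale0r.
  have [_ [i ei] e3] := delta_coef_supp dnz; exists i.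
  by congr (_, _, _) => //; rewrite -e1 e3 ei; ring.
Qed.

Lemma delta_120E U (P : rat -> rat -> U) a b c :
  fmul3 (delta_120 R) (fun a b c => if b == 0 then P a c else 0) a b c =
  jac3 0 P a b c.
Proof.
rewrite /jac3 subr0; have bE : (- b - 1 - 0 \is a Num.int) = (b \is a Num.int).
  have -> : - b - 1 - 0 = - (b + 1) by ring.
  by rewrite rpredN rpredDr.
case: ifPn => [bI|bNI]; last first.
  apply: fmul3_eq0 => p1 p2 p3.
  case: eqP => [/eqP|]; last by rewrite scaler0.
  rewrite subr_eq0 => /eqP <-; rewrite /delta_120 /delta_coef bE (negPf bNI).
  by rewrite scale0r.
rewrite (fmul3_line (h := fun i => (i%:R, b, - b - 1 - i%:R))).
- apply: eq_fsbigr => i _ /=;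
    rewrite subrr eqxx /delta_120 delta_coef_nat bE bI.
  rewrite subrK eqxx /= expr1n mulr1; congr (_ *: P _ _); ring.
- by move=> i j [/natrI_rat].
- move=> [[p1 p2] p3] /= nz.
  have [e|ne] := eqVneq (b - p2) 0; last by rewrite (negPf ne) scaler0 in nz.
  have e1 : p2 = b by apply/eqP; rewrite eq_sym -subr_eq0 e.
  have dnz : (delta_120 R) p1 p2 p3 <> 0.
    by move=> k0; apply: nz; rewrite k0 scale0r.
  have [_ [i ei] e3] := delta_coef_supp dnz; exists i.
  by congr (_, _, _) => //; rewrite e3 e1 ei.
Qed.

Section Transport.
Variables (U U' : lmodType C) (f : U -> U').
Hypothesis fl : linear f.

Lemma jac1_lin P a b c : trunc P ->
  f (jac1 P a b c) = jac1 (fun x y => f (P x y)) a b c.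
Proof.
move=> tP; rewrite /jac1; case: ifP => _; last exact: lin0.
rewrite (lin_fsum fl); first by apply: eq_fsbigr => i _; rewrite (linZ fl).
have [k kP] := tP (b + a + 1) c; exists k => i /kP ->.
by rewrite scaler0.
Qed.

Lemma jac2_lin P a b c : trunc (fun x y => P y x) ->
  f (jac2 P a b c) = jac2 (fun x y => f (P x y)) a b c.
Proof.
move=> tP; rewrite /jac2; case: ifP => _; last exact: lin0.
rewrite (lin_fsum fl); first by apply: eq_fsbigr => i _; rewrite (linZ fl).
have [k kP] := tP (c + a + 1) b; exists k => i /kP ->.
by rewrite scaler0.
Qed.

Lemma jac3_lin rho P a b c : trunc (fun x y => P y x) ->
  f (jac3 rho P a b c) = jac3 rho (fun x y => f (P x y)) a b c.
Proof.
move=> tP; rewrite /jac3; case: ifP => _; last exact: lin0.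
rewrite (lin_fsum fl); first by apply: eq_fsbigr => i _; rewrite (linZ fl).
have [k kP] := tP (c + b + 1) a; exists k => i /kP ->.
by rewrite scaler0.
Qed.

(** Contractions and evaluations are linear, and truncation lets them cross the
    sums: this transposes Jacobi identities between a space and its dual. *)
Lemma Jac_lin rho P1 P2 Q : trunc P1 -> trunc (fun x y => P2 y x) ->
  trunc (fun x y => Q y x) -> Jac rho P1 P2 Q ->
  Jac rho (fun x y => f (P1 x y)) (fun x y => f (P2 x y)) (fun x y =>
    f (Q x y)).
Proof.
move=> t1 t2 t3 J a b c.
by rewrite -jac1_lin // -jac2_lin // -jac3_lin // -(linB fl) J.
Qed.

End Transport.

Lemma Jac_sep U U' (T : Type) (f : T -> U -> U') rho P1 P2 Q :
  (forall t, linear (f t)) -> (forall x y, (forall t, f t x = f t y) ->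
    x = y) ->
  trunc P1 -> trunc (fun x y => P2 y x) -> trunc (fun x y => Q y x) ->
  (forall t, Jac rho (fun x y => f t (P1 x y)) (fun x y => f t (P2 x y))
     (fun x y => f t (Q x y))) ->
  Jac rho P1 P2 Q.
Proof.
move=> fl inj t1 t2 t3 J a b c; apply: inj => t.
by rewrite (linB (fl t)) (jac1_lin (fl t)) // (jac2_lin (fl t)) //
  (jac3_lin (fl t)) // J.
Qed.

Lemma jac1_ext U (P P' : rat -> rat -> U) a b c :
  (forall x y, P x y = P' x y) -> jac1 P a b c = jac1 P' a b c.
Proof.
by move=> e; rewrite (_ : P = P') //; apply: funext => x; apply: funext => y.
Qed.

Lemma jac2_ext U (P P' : rat -> rat -> U) a b c :
  (forall x y, P x y = P' x y) -> jac2 P a b c = jac2 P' a b c.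
Proof.
by move=> e; rewrite (_ : P = P') //; apply: funext => x; apply: funext => y.
Qed.

Lemma jac3_ext U rho (P P' : rat -> rat -> U) a b c :
  (forall x y, P x y = P' x y) -> jac3 rho P a b c = jac3 rho P' a b c.
Proof.
by move=> e; rewrite (_ : P = P') //; apply: funext => x; apply: funext => y.
Qed.

Lemma Jac_eq U rho (P1 P2 Q P1' P2' Q' : rat -> rat -> U) :
  (forall x y, P1 x y = P1' x y) -> (forall x y, P2 x y = P2' x y) ->
  (forall x y, Q x y = Q' x y) -> Jac rho P1 P2 Q -> Jac rho P1' P2' Q'.
Proof.
move=> e1 e2 e3 J a b c.
by rewrite -(jac1_ext a b c e1) -(jac2_ext a b c e2) -(jac3_ext rho a b c e3) J.
Qed.

End Jacobi.

(** * The vertex operator algebra structure of the dual *)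

Lemma rat_archi (x : rat) : exists k : nat, forall i, (k <= i)%N -> x < i%:R.
Proof.
exists (Num.truncn x).+1 => i ki; apply: lt_le_trans (truncnS_gt x) _.
by rewrite ler_nat.
Qed.

Section Coaction.
Variable R : realType.
Local Notation C := R[i].
Variables (V M : lmodType C) (Y : M -> rat -> tensor V M).
Hypothesis Yl : forall e, linear (Y^~ e).
Implicit Types u v : V -> C^o.

(** The operator on [M] whose transpose is the mode [u_t] on the dual of [M].
    Transposition reverses products: [coact v s] after [coact u t] corresponds
    to [u_t] after [v_s]. *)
Definition coact u (t : rat) (m : M) : M := tcontr_l u (Y m (- t - 1)).

Lemma coact_linear u t : linear u -> linear (coact u t).
Proof. by move=> ul; exact: lin_comp (tcontr_l_linear ul) (Yl _). Qed.

Lemma coact_lincomb a u u' t m : linear u -> linear u' ->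
  coact (fun z => a *: u z + u' z) t m = a *: coact u t m + coact u' t m.
Proof. exact: tcontr_l_lincomb. Qed.

Let negK (x : rat) : - (- x - 1) - 1 = x. Proof. by ring. Qed.

Lemma coact_coact u v x y m : linear u -> linear v ->
  tcontr_l v (tcontr_l u (tmap id (Y^~ y) (Y m x))) =
  coact v (- y - 1) (coact u (- x - 1) m).
Proof.
by move=> ul vl; rewrite tcontr_l_map // /coact !negK.
Qed.

Lemma coact_swap u v x y m : linear u -> linear v ->
  tcontr_l v (tcontr_l u (tswap12 (tmap id (Y^~ x) (Y m y)))) =
  coact u (- x - 1) (coact v (- y - 1) m).
Proof.
by move=> ul vl; rewrite tcontr_swap // coact_coact.
Qed.

Lemma coact_iterate (G : V -> tensor V V) u v y m : linear u -> linear v ->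
  linear G ->
  tcontr_l v (tcontr_l u (tassoc (tmap G id (Y m y)))) =
  coact (fun z => tpair u v (G z)) (- y - 1) m.
Proof.
move=> ul vl Gl; rewrite tcontr_assoc // tcontr_l_map //;
  last exact: tpair_linear.
by rewrite /coact negK.
Qed.

End Coaction.

Section TensorGrade.
Variable R : realType.
Local Notation C := R[i].
Variables (V W : lmodType C) (I J : Type).
Variables (dV : I -> rat) (dW : J -> rat) (VI : I -> set V) (WJ : J -> set W).

Lemma tensor_grade_contr (a : I) (u : V -> C^o) n (x : tensor V W) : linear u ->
  (forall i v, i <> a -> VI i v -> u v = 0) ->
  tensor_grade dV dW VI WJ n x ->
  lspan [set w | exists2 j, dV a + dW j = n & WJ j w] (tcontr_l u x).
Proof.
move=> ul u0.
have s : is_subspace [set x : tensor V W |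
    lspan [set w | exists2 j, dV a + dW j = n & WJ j w] (tcontr_l u x)].
  have [h0 h] := lspan_subspace [set w | exists2 j, dV a + dW j = n & WJ j w].
  split=> [|b y z hy hz] /=; first by rewrite (lin0 (tcontr_l_linear ul)).
  by rewrite (tcontr_l_linear ul); exact: h.
apply: (lspan_min s) => _ [i [j [v [w [ij Vv Ww ->]]]]] /=.
rewrite tcontr_l_tens //.
have [ia|ia] := pselect (i = a).
  apply: subspaceZ; first exact: lspan_subspace.
  by apply: lspan_in; exists j => //; rewrite -ia.
by rewrite (u0 i) // scale0r; exact: lspan0.
Qed.

End TensorGrade.

Section Dual.
Variable R : realType.
Local Notation C := R[i].
Variables (V : lmodType C) (S : voc V).

Local Notation D := (gdual S).
Local Notation ev := (@gdual_fun R V S).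
Local Notation W := (dual_voa S).

Lemma gdual_is_dual : is_graded_dual (vgrade S) ev.
Proof.
split=> //.
- by move=> d; split; [exact: gdual_linear|have /gdual_predP[] := gdual_funP d].
- move=> f fP; have fP' : f \in gdual_pred S by apply/gdual_predP.
  by exists (GDual fP').
- by move=> d e /funext de; apply: val_inj.
Qed.

Lemma gdual_ext (f h : D) : (forall x, f x = h x) -> f = h.
Proof. by move=> fh; case: gdual_is_dual => _ _ _; apply. Qed.

Lemma series_of_modesE (X : Type) (U : lmodType C) (Dl : int -> X ->
  U) v (k : int) :
  series_of_modes Dl v (- k%:~R - 1) = Dl k v.
Proof.
rewrite /series_of_modes; have -> : - (- k%:~R - 1) - 1 = k%:~R :> rat by ring.
by rewrite intrKfloor rpredB // rpredN intr_int.
Qed.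

Lemma vUps_linear e : linear (fun v => vUps S v e).
Proof.
move=> a u v; rewrite /vUps /series_of_modes; case: ifP => _;
  first by rewrite linearP.
by rewrite scaler0 addr0.
Qed.

Lemma series_trunc (X : Type) (U : lmodType C) (Dl : int -> X -> U) v :
  (exists k0 : int, forall k, k < k0 -> Dl k v = 0) ->
  forall x : rat, exists k : nat, forall i, (k <= i)%N ->
    series_of_modes Dl v (x + i%:R) = 0.
Proof.
move=> [k0 h] x; have [k kP] := rat_archi (- k0%:~R - x); exists k => i /kP ki.
rewrite /series_of_modes; case: ifP => // xi; apply: h.
rewrite -(ltr_int rat) floorK; first by lra.
have -> : - (x + i%:R) - 1 = - (x + i%:R + 1) by ring.
by rewrite rpredN rpredD ?rpred1.
Qed.

Local Notation tau := (coact (vUps S)).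

Lemma coact_vUps (u : V -> C^o) (k : int) x :
  tau u k%:~R x = tcontr_l u (vDelta S k x).
Proof. by rewrite /coact /vUps series_of_modesE. Qed.

Lemma coact_vUps0 (u : V -> C^o) t x : linear u -> t \isn't a Num.int ->
  tau u t x = 0.
Proof.
move=> ul tI; rewrite /coact /vUps /series_of_modes.
have -> : - t - 1 = - (t + 1) by ring.
by rewrite rpredN rpredDr ?rpred1 // (negPf tI) (lin0 (tcontr_l_linear ul)).
Qed.

Lemma gdual_modeE (u v : D) k x :
  gdual_mode u k v x = v (tcontr_l u (vDelta S k x)).
Proof. by apply: tpairE; exact: gdual_linear. Qed.

Lemma adjoint_modeE (u v : D) t x :
  (adjoint_mode (W := W) u t v : D) x = v (tau u t x).
Proof.
rewrite /adjoint_mode; case: ifPn => [tI|tI]; last first.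
  by rewrite coact_vUps0 ?(lin0 (gdual_linear v)) //; exact: gdual_linear.
by rewrite -[t in RHS](floorK tI) coact_vUps -gdual_modeE.
Qed.

Lemma vLE k x : vL S k x = tcontr_l (vrho S) (vDelta S (1 - k) x).
Proof.
rewrite -coact_vUps /coact /vL /coL /vUps;
  congr (tcontr_l _ (series_of_modes _ _ _)).
by rewrite intrD intrN; ring.
Qed.

Lemma vL_linear k : linear (vL S k).
Proof.
move=> a x y; rewrite !vLE linearP tcontr_l_linear //.
by move=> b z w; rewrite linearP.
Qed.

(** As [Delta_k] is homogeneous, projecting its second factor to a degree
    amounts to projecting its first factor to the complementary one. *)
Lemma delta_component (f : V -> C^o) k s x b : linear f -> vgrade S s x ->
  component (vgrade S) b (tcontr_l f (vDelta S k x)) =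
  tcontr_l (fun v => f (component (vgrade S) (s + k + 1 - b) v)) (vDelta S k x).
Proof.
move=> fl xs; have dV := voc_grade S; have cl i := component_linear dV i.
have fcl := lin_comp fl (cl (s + k + 1 - b)).
have l1 := lin_comp (cl b) (tcontr_l_linear (W := V) fl).
have l2 := tcontr_l_linear (W := V) fcl.
have sE : is_subspace [set y | component (vgrade S) b (tcontr_l f y) =
    tcontr_l (fun v => f (component (vgrade S) (s + k + 1 - b) v)) y].
  split=> [|a y z /= hy hz]; first by rewrite /= (lin0 l1) (lin0 l2).
  by rewrite l1 l2 hy hz.
apply: (lspan_min sE) (voc_Delta_grade k xs) =>
  _ [i [j [v [w [ij vi wj ->]]]]] /=.
rewrite !tcontr_l_tens // (linZ (cl b)).
have {}ij : i + j = s + k + 1 by apply: (@intr_inj rat); rewrite -ij intrD.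
have [jb|jb] := eqVneq j b.
  by rewrite -ij jb addrK (component_in dV vi) -{1}jb (component_in dV wj).
rewrite (component_out dV wj); last by move=> e; rewrite e eqxx in jb.
rewrite (component_out dV vi) ?(lin0 fl) ?scaler0 ?scale0r // => e.
by move: jb; rewrite -(inj_eq (addrI i)) ij e subrK eqxx.
Qed.

(** The right counit recovers [x] from [Delta_(-1) x]. *)
Lemma coact_eq0 (u : V -> C^o) : linear u ->
  (forall x, tcontr_l u (vDelta S (- 1) x) = 0) -> forall x, u x = 0.
Proof.
move=> ul u0 x; have := voc_counit_r S x (lexx 0); rewrite eqxx => {1}<-.
have -> : 0 = - (- 1)%:~R - 1 :> rat by rewrite intrN; ring.
rewrite /vUps series_of_modesE -tpairE_r // ?tpairE ?u0 ?linear0 //.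
  by move=> a y z; rewrite linearP.
by move=> a y z; rewrite linearP.
Qed.

Let cl : linear (vc S : V -> C^o). Proof. by move=> a y z; rewrite linearP. Qed.
Let rl : linear (vrho S : V -> C^o).
Proof.
by move=> a y z; rewrite linearP.
Qed.

Lemma voc_counit_lD k x : tcontr_l (vc S) (vDelta S k x) =
  if k == - 1 then x else 0.
Proof.
have := voc_counit_l S x (- k%:~R - 1); rewrite /vUps series_of_modesE => ->.
congr (if _ then _ else _); rewrite -opprD oppr_eq0 -[1]/(1%:~R) -intrD.
by rewrite intr_eq0 addr_eq0.
Qed.

Lemma functional_concentrated (f : V -> C^o) a : linear f ->
  (forall b x, b <> a -> tcontr_l (fun v => f (component (vgrade S) b v))
    (vDelta S (- 1) x) = 0) ->
  forall x, f x = f (component (vgrade S) a x).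
Proof.
move=> fl f0 x; have dV := voc_grade S.
apply: (graded_ext dV fl (lin_comp fl (component_linear dV a))) => s v vs.
have [<-|/eqP sa] := eqVneq s a; first by rewrite (component_in dV vs).
rewrite (component_out dV vs sa) (lin0 fl) -(component_in dV vs).
have l := lin_comp fl (component_linear dV s).
by apply: (coact_eq0 l) => y; exact: f0.
Qed.

(** The counit being homogeneous of degree zero on [Delta_k], its components in
    other degrees contract the coproduct to zero, hence vanish. *)
Lemma vc_component x : vc S x = vc S (component (vgrade S) 0 x).
Proof.
apply: (functional_concentrated cl) => b y b0; have dV := voc_grade S.
have l := tcontr_l_linear (W := V) (lin_comp cl (component_linear dV b)).
apply: (graded_ext dV (lin_comp l (linearP (vDelta S (- 1)))) (g := fun=> 0)).
  by move=> a z w; rewrite scaler0 addr0.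
move=> s z zs.
have -> : b = s + (- 1) + 1 - (s - b) by rewrite subrK opprB addrCA subrr addr0.
rewrite -(delta_component _ _ cl zs) voc_counit_lD eqxx.
by apply: (component_out dV zs) => e; apply: b0; rewrite -(subKr s b) -e subrr.
Qed.

Lemma vL_grade k s x : vgrade S s x -> vgrade S (s - k) (vL S k x).
Proof.
move=> /voc_L0 xs; apply/voc_L0; have := voc_virasoro S 0 k x.
rewrite xs (linZ (vL_linear k)) sub0r add0r => /eqP; rewrite subr_eq => /eqP ->.
have -> : (if k == 0 then (0 ^+ 3 - 0)%:~R / 12%:R * vd S else 0 : C) = 0.
  by case: eqP => // _; rewrite expr0n subrr mul0r mul0r.
by rewrite scale0r addr0 -scalerDl -intrD addrC.
Qed.

(** Likewise for [rho], where the degree is read off from the commutator of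
    [L(k)] with [L(0)]. *)
Lemma vrho_component x : vrho S x = vrho S (component (vgrade S) 2 x).
Proof.
apply: (functional_concentrated rl) => b y b2; have dV := voc_grade S.
have l := tcontr_l_linear (W := V) (lin_comp rl (component_linear dV b)).
apply: (graded_ext dV (lin_comp l (linearP (vDelta S (- 1)))) (g := fun=> 0)).
  by move=> a z w; rewrite scaler0 addr0.
move=> s z zs.
have -> : b = s + (- 1) + 1 - (s - b) by rewrite subrK opprB addrCA subrr addr0.
rewrite -(delta_component _ _ rl zs).
have -> : tcontr_l (vrho S) (vDelta S (- 1) z) = vL S 2 z by rewrite vLE.
apply: (component_out dV (vL_grade 2 zs)) => e; apply: b2.
by rewrite -(subKr s b) -e subKr.
Qed.

End Dual.

Section LeftAction.
Variable R : realType.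
Local Notation C := R[i].
Variables (W : va_data R) (N : lmodType C) (m : W -> rat -> N -> N).

Lemma jacobiE rho u v : jacobi m rho u v <-> forall n,
  Jac rho (fun x y => m u (- x - 1) (m v (- y - 1) n))
    (fun x y => m v (- y - 1) (m u (- x - 1) n))
    (fun x y => m (series_of_modes (va_mode u) v x) (- y - 1) n).
Proof.
by split=> h n a b c; have := h n a b c;
  rewrite /jacobi delta_012E delta_021E delta_210E.
Qed.

Hypothesis ml : forall t n, linear (fun u => m u t n).
Hypothesis mr : forall u t, linear (m u t).
Hypothesis mtr : forall u n, exists t0 : rat, forall t, t0 < t -> m u t n = 0.
Hypothesis vtr : forall u v : W,
  exists k0 : int, forall k, k0 < k -> va_mode u k v = 0.

Lemma action_trunc u v n :
  trunc (fun x y => m u (- x - 1) (m v (- y - 1) n)).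
Proof.
move=> x y; have [t0 h] := mtr v n; have [k kP] := rat_archi (t0 + y + 1).
exists k => i /kP ki; rewrite [X in m u _ X]h ?(lin0 (mr _ _)) //.
by lra.
Qed.

Lemma iterate_trunc u v n :
  trunc (fun x y => m (series_of_modes (va_mode u) v y) (- x - 1) n).
Proof.
move=> x y; have [k0 h] := vtr u v; have [k kP] := rat_archi (k0%:~R + y + 1).
exists k => i /kP ki; rewrite /series_of_modes; case: ifPn => yI; last first.
  exact: (lin0 (ml _ n)).
rewrite h ?(lin0 (ml _ n)) // -(ltr_int rat) floorK; first by lra.
have -> : - (y - i%:R) - 1 = - (y - i%:R + 1) by ring.
by rewrite rpredN rpredD ?rpred1.
Qed.

End LeftAction.

Section RightJacobi.
Variable R : realType.
Local Notation C := R[i].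
Variables (V M : lmodType C) (Y : M -> rat -> tensor V M).
Hypothesis Yl : forall e, linear (Y^~ e).
Hypothesis Ytr : forall m x, exists k : nat, forall i, (k <= i)%N ->
  Y m (x + i%:R) = 0.

Lemma coact2_trunc m : trunc (fun x y => tmap id (Y^~ y) (Y m x)).
Proof.
move=> x y; have [k h] := Ytr m x; exists k => i /h ->.
exact: (lin0 (tmap_linear (@lin_id _ _) (Yl _))).
Qed.

Lemma coact2_swap_trunc m :
  trunc (fun x y => tswap12 (tmap id (Y^~ y) (Y m x))).
Proof.
move=> x y; have [k h] := coact2_trunc m x y; exists k => i /h ->.
exact: (lin0 (@tswap12_linear _ _ _ _)).
Qed.

Lemma coact_iterate_trunc (G : rat -> V -> tensor V V) m :
  (forall x, linear (G x)) ->
  trunc (fun x y => tassoc (tmap (G y) id (Y m x))).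
Proof.
move=> Gl x y; have [k h] := Ytr m x; exists k => i /h ->.
rewrite (lin0 (tmap_linear (Gl _) (@lin_id _ _))).
exact: (lin0 (@tassoc_linear _ _ _ _)).
Qed.

End RightJacobi.

Section DualVOA.
Variable R : realType.
Local Notation C := R[i].
Variables (V : lmodType C) (S : voc V).

Local Notation D := (gdual S).
Local Notation W := (dual_voa S).
Local Notation tau := (coact (vUps S)).

Let dV := voc_grade S.
Let dD := (graded_dual_direct_sum dV (gdual_is_dual S)).1.
Let gl (u : D) : linear u := gdual_linear u.

Lemma vUps_trunc x e : exists k : nat, forall i, (k <= i)%N ->
  vUps S x (e + i%:R) = 0.
Proof. exact: series_trunc (voc_trunc S x) e. Qed.

(** The coalgebra Jacobi identity contracted with [u (x) v (x) Id]. *)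
Lemma voc_right_jacobi (u v : D) p :
  Jac 0 (fun x y => tau v (- y - 1) (tau u (- x - 1) p))
    (fun x y => tau u (- x - 1) (tau v (- y - 1) p))
    (fun x y => tau (series_of_modes (gdual_mode u) v x : D) (- y - 1) p).
Proof.
have Yl := @vUps_linear R V S; have Ytr := vUps_trunc.
have J : Jac 0 (fun x y => tmap id ((vUps S)^~ y) (vUps S p x))
   (fun x y => tswap12 (tmap id ((vUps S)^~ x) (vUps S p y)))
   (fun x y => tassoc (tmap ((vUps S)^~ x) id (vUps S p y))).
  by move=> a b c; have := voc_jacobi S p a b c;
    rewrite delta_012E delta_021E delta_120E.
have fl := lin_comp (tcontr_l_linear (W := V) (gl v)) (tcontr_l_linear (gl u)).
apply: Jac_eq (Jac_lin fl _ _ _ J).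
- by move=> x y; rewrite coact_coact.
- by move=> x y; rewrite coact_swap.
- move=> x y; rewrite coact_iterate // /coact; congr (tcontr_l _ _).
  apply: funext => z; rewrite /vUps /series_of_modes; case: ifP => // _.
  exact: (lin0 (tpair_linear (gl u) (gl v))).
- exact: coact2_trunc.
- exact: coact2_swap_trunc.
- exact: coact_iterate_trunc.
Qed.

Lemma contr_grade (u : D) a k s x : gdual_grade a u -> vgrade S s x ->
  vgrade S (s + k + 1 - a) (tcontr_l u (vDelta S k x)).
Proof.
move=> ua xs; have sV := grade_subspace dV (s + k + 1 - a).
have := tensor_grade_contr (gl u) ua (voc_Delta_grade k xs).
apply: (lspan_min sV) => w [j + wj]; rewrite -intrD => /intr_inj e.
by rewrite -e addrC addKr.
Qed.

Lemma gdual_mode_linl k (v : D) : linear (fun u : D => gdual_mode u k v).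
Proof.
move=> a u1 u2; apply: gdual_ext => x.
rewrite gdual_modeE (tcontr_l_lincomb a (vDelta S k x) (gl u1) (gl u2)) (gl v).
by rewrite -!gdual_modeE.
Qed.

Lemma gdual_lincombE a (u v : D) x : (a *: u + v : D) x = a *: u x + v x.
Proof. by []. Qed.

Lemma gdual_mode_linr k (u : D) : linear (gdual_mode u k).
Proof.
move=> a v1 v2; apply: gdual_ext => x.
by rewrite gdual_lincombE !gdual_modeE gdual_lincombE.
Qed.

(** On homogeneous arguments the degree of [u_k v] decreases with [k], and the
    degrees of [V] are bounded below. *)
Lemma dual_trunc (u v : D) :
  exists k0 : int, forall k, k0 < k -> gdual_mode u k v = 0.
Proof.
have sP : is_subspace [set u | exists k0 : int, forall k, k0 < k ->
  gdual_mode u k v = 0].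
  split; first by exists 0 => k _; exact: lin0 (gdual_mode_linl k v).
  move=> a u1 u2 [k1 h1] [k2 h2]; exists (Num.max k1 k2) => k.
  by rewrite gt_max gdual_mode_linl => /andP[/h1 -> /h2 ->];
    rewrite scaler0 addr0.
apply: (graded_ind dD sP) u => a u ua /= {sP}.
have sQ : is_subspace [set v | exists k0 : int, forall k, k0 < k ->
  gdual_mode u k v = 0].
  split; first by exists 0 => k _; exact: lin0 (gdual_mode_linr k u).
  move=> b u1 u2 [k1 h1] [k2 h2]; exists (Num.max k1 k2) => k.
  by rewrite gt_max gdual_mode_linr => /andP[/h1 -> /h2 ->];
    rewrite scaler0 addr0.
apply: (graded_ind dD sQ) v => b v vb /=.
have [s0 h0] := voc_bounded S; exists (a + b - 1 - s0) => k kk.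
apply: gdual_ext; apply: (graded_ext dV (gl _) (gl _)) => s x xs.
rewrite gdual_modeE; have h := contr_grade k ua xs.
have [e|/eqP ne] := eqVneq (s + k + 1 - a) b; last by rewrite (vb _ _ ne h).
have s_lt : s < s0.
  have -> : s = a + b - 1 - k by rewrite -e; ring.
  by rewrite ltrBlDr -ltrBlDl.
by rewrite (h0 _ s_lt _ xs) !linear0 (lin0 (tcontr_l_linear (gl u)))
  (lin0 (gl v)).
Qed.

Lemma dual_oneE x : (va_one W : D) x = vc S x.
Proof. by rewrite [RHS]vc_component. Qed.

Lemma dual_omegaE x : (va_omega W : D) x = vrho S x.
Proof. by rewrite [RHS]vrho_component. Qed.

Lemma dual_LE n (f : D) x : (va_L n (f : W) : D) x = f (vL S (- n) x).
Proof.
rewrite /va_L gdual_modeE vLE opprK (addrC 1 n); congr (f (tcontr_l _ _)).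
by apply: funext => y; exact: dual_omegaE.
Qed.

Lemma dual_virasoro : virasoro (@va_L R W) (vd S).
Proof.
move=> k j f; apply: gdual_ext => x.
have D2 (a b : D) : (a + b) x = a x + b x by [].
have DB (a b : D) : (a - b) x = a x - b x by [].
have DZ c (a : D) : (c *: a) x = c *: a x by [].
rewrite DB D2 !DZ !dual_LE.
have := voc_virasoro S (- j) (- k) x; rewrite -(linB (gl f)) => ->.
have -> : - j + - k = - (k + j) by rewrite opprD addrC.
rewrite (linD (gl f)) !(linZ (gl f)) oppr_eq0.
congr (_%:~R *: _ + _ *: _); first by rewrite opprK addrC.
case: eqP => // kj; congr (_%:~R / _ * _).
have -> : j = - k by apply/eqP; rewrite -addr_eq0 addrC kj.
by rewrite opprK.
Qed.

Lemma adjoint_linl t (w : D) : linear (fun u => adjoint_mode (W := W) u t w).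
Proof.
rewrite /adjoint_mode; case: (t \is a Num.int); first exact: gdual_mode_linl.
by move=> a y z; rewrite scaler0 addr0.
Qed.

Lemma adjoint_linr (w : D) t : linear (adjoint_mode (W := W) w t).
Proof.
rewrite /adjoint_mode; case: (t \is a Num.int); first exact: gdual_mode_linr.
by move=> a y z; rewrite scaler0 addr0.
Qed.

Lemma adjoint_trunc (u v : D) : exists t0 : rat, forall t, t0 < t ->
  adjoint_mode (W := W) u t v = 0.
Proof.
have [k0 h] := dual_trunc u v; exists k0%:~R => t tt.
rewrite /adjoint_mode; case: ifPn => // tI; apply: h.
by rewrite -(ltr_int rat) floorK.
Qed.

(** Truncation of a coaction makes the transposed operators vanish towards
    negative modes, uniformly in the functional. *)
Lemma coact_trunc (M : lmodType C) (Y : M -> rat -> tensor V M)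
    (Ytr : forall m x, exists k : nat, forall i, (k <= i)%N ->
      Y m (x + i%:R) = 0)
    m (y : rat) :
  exists k : nat, forall i, (k <= i)%N -> forall u : D,
    coact Y u (- (y + i%:R) - 1) m = 0.
Proof.
have [k h] := Ytr m y; exists k => i /h Y0 u; rewrite /coact.
have -> : - (- (y + i%:R) - 1) - 1 = y + i%:R by ring.
by rewrite Y0 (lin0 (tcontr_l_linear (gl u))).
Qed.

Lemma dual_jacobi (u v n : D) :
  Jac 0 (fun x y => adjoint_mode (W := W) u (- x - 1)
    (adjoint_mode (W := W) v (- y - 1) n))
    (fun x y => adjoint_mode (W := W) v (- y - 1)
      (adjoint_mode (W := W) u (- x - 1) n))
    (fun x y => adjoint_mode (W := W) (series_of_modes (gdual_mode u) v x)
      (- y - 1) n).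
Proof.
apply: (@Jac_sep _ _ C^o V (fun x (d : D) => d x)).
- by move=> x a d e.
- by move=> d e; exact: gdual_ext.
- exact: (action_trunc (W := W) adjoint_linr adjoint_trunc).
- exact: (action_trunc (W := W) adjoint_linr adjoint_trunc).
- exact: (iterate_trunc (W := W) adjoint_linl dual_trunc).
move=> p; have tl w t : linear (tau (w : D) t) :=
  coact_linear (@vUps_linear R V S) t (gl w).
apply: Jac_eq (Jac_lin (gl n) _ _ _ (voc_right_jacobi u v p)).
- by move=> x y; rewrite !adjoint_modeE.
- by move=> x y; rewrite !adjoint_modeE.
- by move=> x y; rewrite adjoint_modeE.
- move=> x y; have [k h] := coact_trunc vUps_trunc p x.
  by exists k => i /h ->; exact: lin0 (tl _ _).
- move=> x y; have [k h] := coact_trunc vUps_trunc p x.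
  by exists k => i /h ->; exact: lin0 (tl _ _).
- move=> x y; have [k h] := coact_trunc vUps_trunc p x.
  by exists k => i /h ->.
Qed.

Lemma dual_is_voa : is_voa W.
Proof.
have DZ c (a : D) x : (c *: a) x = c *: a x by [].
split.
- by move=> k v; exact: gdual_mode_linl.
- by move=> u k; exact: gdual_mode_linr.
- exact: dD.
- by move=> s; exact: (graded_dual_findim dV (gdual_is_dual S)
    (voc_findim S s)).
- have [s0 h] := voc_bounded S; exists s0 => s ss f fs; apply: gdual_ext => x.
  rewrite (dual_grade_eval dV (gdual_is_dual S) x fs).
  by rewrite (h _ ss _ (component_mem dV s x)) (lin0 (gl f)).
- exact: dual_trunc.
- move=> v k; apply: gdual_ext => x.
  rewrite -[LHS]/(gdual_mode (va_one W) k v x) gdual_modeE.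
  have -> : gdual_fun (va_one W) = vc S by apply: funext => y; exact: dual_oneE.
  by rewrite voc_counit_lD; case: eqP => // _; exact: lin0.
- move=> u k k1; apply: gdual_ext => x;
    rewrite -[LHS]/(gdual_mode u k (va_one W) x) gdual_modeE dual_oneE.
  have := voc_counit_r S x (e := - k%:~R - 1); rewrite /vUps series_of_modesE.
  have -> : (- k%:~R - 1 <= 0 :> rat) = (- 1 <= k).
    by rewrite -[1]/(1%:~R) -intrN -intrB lerz0 lerBlDr add0r lerNl.
  move=> /(_ k1) cr; rewrite -tpairE // ?tpairE_r //; last first.
  + by move=> a y z; rewrite linearP.
  + by move=> a y z; rewrite linearP.
  rewrite cr; have -> : (- k%:~R - 1 == 0 :> rat) = (k == - 1).
    by rewrite -opprD oppr_eq0 -[1]/(1%:~R) -intrD intr_eq0 addr_eq0.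
  by case: eqP => // _; exact: lin0.
- by move=> u v; apply/jacobiE; exact: dual_jacobi.
- by exists (vd S); exact: dual_virasoro.
- move=> s f; split=> [fs|fL].
    apply: gdual_ext; apply: (graded_ext dV (gl _) (gl _)) => t x xt.
    rewrite dual_LE oppr0; have /voc_L0 -> := xt.
    rewrite (linZ (gl f)); have [->//|/eqP ts] := eqVneq t s.
    by rewrite (fs _ _ ts xt) (_ : (_ *: f : D) x =
      s%:~R *: f x) // (fs _ _ ts xt) !scaler0.
  move=> t x ts xt; have : (va_L 0 (f : W) : D) x =
    (s%:~R *: f : D) x by rewrite fL.
  rewrite dual_LE oppr0; have /voc_L0 -> := xt.
  rewrite (linZ (gl f)) => /eqP;
    rewrite -subr_eq0 (_ : (_ *: f : D) x = s%:~R *: f x) //.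
  rewrite -scalerBl scaler_eq0 -intrB intr_eq0 subr_eq0.
  by move=> /orP[/eqP //|/eqP].
- move=> u k v; apply: gdual_ext => x.
  rewrite -[LHS]/(gdual_mode (va_L (- 1) (u : W)) k v x) gdual_modeE.
  have -> : (va_L (- 1) (u : W) : V -> C^o) = (fun y => u (vL S 1 y)).
    by apply: funext => y; rewrite [LHS]dual_LE opprK.
  have := voc_L1 S x (- k%:~R - 1); rewrite /fderiv subrK.
  have E1 : vUps S x (- k%:~R - 1) = vDelta S k x by exact: series_of_modesE.
  have E2 : vUps S x (- k%:~R) = vDelta S (k - 1) x.
    have -> : (- k%:~R : rat) = - (k - 1)%:~R - 1 by rewrite intrB; ring.
    exact: series_of_modesE.
  rewrite E1 E2 => /(congr1 (tcontr_l u)).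
  rewrite tcontr_l_map //; last exact: vL_linear.
  move=> ->; rewrite (linZ (tcontr_l_linear (gl u))) (linZ (gl v)) -gdual_modeE.
  by rewrite -intrN ratr_int intrN.
Qed.

End DualVOA.

(** * Automorphisms and eigenspaces *)

Section RootsOfUnity.
Variable R : realType.
Local Notation C := R[i].
Variable T : nat.
Hypothesis T_gt0 : (0 < T)%N.

Let TR_neq0 : (T%:R : R) != 0. Proof. by rewrite pnatr_eq0 -lt0n. Qed.

Lemma expi0 : expi R 0 T = 1.
Proof. by rewrite /expi mulr0 mul0r cos0 sin0. Qed.

Lemma expiS r : expi R r.+1 T = expi R 1 T * expi R r T.
Proof.
rewrite /expi; set a := 2 * pi * 1%:R / T%:R; set b := 2 * pi * r%:R / T%:R.
have -> : 2 * pi * r.+1%:R / T%:R = a + b :> R.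
  by rewrite -addn1 natrD addrC /a /b; field.
by rewrite cosD sinD [RHS]/GRing.mul /= addrC (addrC (sin a * _)).
Qed.

Lemma expiX r : expi R r T = expi R 1 T ^+ r.
Proof. by elim: r => [|r IH]; rewrite ?expi0 ?expr0 // expiS IH exprS. Qed.

Lemma expiT : expi R 1 T ^+ T = 1.
Proof.
rewrite -expiX /expi mulfK //; congr Complex.
  by rewrite mulrC mulr_natr cos2pi.
by rewrite mulrC mulr_natr sin2pi.
Qed.

Lemma expi_neq1 r : (0 < r < T)%N -> expi R r T != 1.
Proof.
move=> /andP[r0 rT]; apply/eqP => -[]; set a := 2 * pi * r%:R / T%:R => ca _.
pose b := pi * r%:R / T%:R : R.
have ab : a = b *+ 2 by rewrite /a /b -mulr_natl; field.
have : 0 < sin b.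
  apply: sin_gt0_pi; rewrite /b divr_gt0 ?mulr_gt0 ?pi_gt0 ?ltr0n //=.
  by rewrite ltr_pdivrMr ?ltr0n // ltr_pM2l ?pi_gt0 // ltr_nat.
move: ca; rewrite ab cos_mulr2n; have := cos2Dsin2 b => h1 h2 h3.
have : sin b ^+ 2 = 0 by lra.
by move/eqP; rewrite sqrf_eq0 => /eqP s0; rewrite s0 ltxx in h3.
Qed.

End RootsOfUnity.

Section Eigenspaces.
Variable R : realType.
Local Notation C := R[i].
Variables (V : lmodType C) (g : V -> V) (T : nat).
Hypothesis gl : linear g.
Hypothesis T_gt0 : (0 < T)%N.
Hypothesis gT : forall v, iter T g v = v.

Local Notation z := (expi R 1 T).
Local Notation E := (fun r : 'I_T => eigensp g T r).

Let zT : z ^+ T = 1. Proof. exact: expiT. Qed.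
Let z_neq0 : z != 0.
Proof.
by apply/eqP => z0; have := zT; rewrite z0 expr0n gtn_eqF // => /eqP;
  rewrite eq_sym oner_eq0.
Qed.
Let zX_neq0 n : z ^+ n != 0. Proof. exact: expf_neq0. Qed.
Let T_neq0 : (T%:R : C) != 0. Proof. by rewrite pnatr_eq0 -lt0n. Qed.

Lemma iter_linear n : linear (iter n g).
Proof. by elim: n => [|n IH] a u v //=; rewrite IH gl. Qed.

Let iter_eig r n v : eigensp g T r v -> iter n g v = (z ^+ r) ^+ n *: v.
Proof.
move=> vr; elim: n => [|n IH]; first by rewrite expr0 scale1r.
by rewrite /= IH (linZ gl) vr scalerA (expiX R T_gt0 r) -exprSr.
Qed.

(** Discrete Fourier projection for the cyclic group generated by [g]. *)
Definition eigenproj (r : nat) (v : V) : V :=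
  T%:R^-1 *: \sum_(k < T) (z ^+ r) ^- k *: iter k g v.

Let geomsum (w : C) : w ^+ T = 1 -> w != 1 -> \sum_(k < T) w ^+ k = 0.
Proof.
move=> wT w1; apply/eqP; have := subrX1 w T.
by rewrite wT subrr => /esym/eqP; rewrite mulf_eq0 subr_eq0 (negPf w1).
Qed.

Let zinj r s : (r < s < T)%N -> z ^+ r != z ^+ s.
Proof.
move=> /andP[rs sT]; apply/eqP => e.
have rs' : (0 < s - r < T)%N by rewrite subn_gt0 rs
  (leq_ltn_trans (leq_subr _ _) sT).
have /negP := expi_neq1 R T_gt0 rs'; apply; rewrite (expiX R T_gt0); apply/eqP.
apply: (mulfI (zX_neq0 r)); rewrite mulr1 -exprD subnKC //; exact: ltnW.
Qed.

Let zinj' (r s : 'I_T) : r != s -> z ^+ r != z ^+ s.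
Proof.
move=> rs; have [h|h|h] := ltngtP r s.
- by apply: zinj; rewrite h ltn_ord.
- by rewrite eq_sym; apply: zinj; rewrite h ltn_ord.
- by case/eqP: rs; apply: val_inj.
Qed.

Let zXT n : (z ^+ n) ^+ T = 1. Proof. by rewrite exprAC zT expr1n. Qed.

Lemma eigen_direct_sum : direct_sum E /\
  forall r v, component E r v = eigenproj r v.
Proof.
have pl n : linear (eigenproj n).
  move=> a u v; rewrite /eigenproj scalerA [a * _]mulrC -scalerA -scalerDr;
    congr (_ *: _).
  rewrite scaler_sumr -big_split; apply: eq_bigr => k _ /=.
  by rewrite iter_linear scalerDr !scalerA [a * _]mulrC.
apply: component_eqP => //.
- move=> r; split=> [|a u v]; rewrite /eigensp /=;
    first by rewrite (lin0 gl) scaler0.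
  by move=> gu gv; rewrite gl gu gv scalerDr !scalerA mulrC.
- move=> r v; rewrite /eigensp /= /eigenproj (linZ gl) scalerA mulrC -scalerA;
    congr (_ *: _).
  rewrite (lin_sum gl) (expiX R T_gt0 r);
    pose F k := (z ^+ r) ^- k *: iter k g v.
  have -> : \sum_(k < T) g ((z ^+ r) ^- k *: iter k g v) =
    z ^+ r *: \sum_(k < T) F k.+1.
    rewrite scaler_sumr; apply: eq_bigr => k _; rewrite (linZ gl) /F /= scalerA.
    by rewrite exprS invfM mulrA divff // mul1r.
  congr (_ *: _); have F0 : F T = F 0%N by rewrite /F zXT gT expr0.
  have : \sum_(k < T.+1) F k = \sum_(k < T) F k + F T by rewrite big_ord_recr.
  by rewrite big_ord_recl /= F0 addrC => /addIr ->.
- move=> r v vr; rewrite /eigenproj;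
    under eq_bigr do rewrite (iter_eig _ vr) scalerA mulVf ?expf_neq0
    // scale1r.
  by rewrite sumr_const card_ord -[X in _ *: X]scaler_nat scalerA mulVf
    // scale1r.
- move=> r s v vr /eqP rs; rewrite /eigenproj.
  under eq_bigr do rewrite (iter_eig _ vr) scalerA -exprVn -exprMn.
  rewrite -scaler_suml geomsum ?scale0r ?scaler0 //.
    by rewrite exprMn exprVn !zXT invr1 mulr1.
  rewrite mulrC; apply/eqP => /(congr1 (fun x => x * z ^+ s)).
  by rewrite mulfVK // mul1r => /eqP; apply/negP/zinj'.
- move=> v; exists (enum 'I_T); split.
  + exact: enum_uniq.
  + by move=> r; rewrite mem_enum.
  rewrite big_enum /= /eigenproj -scaler_sumr exchange_big /=.
  rewrite (bigD1 (Ordinal T_gt0)) //= [X in _ + X]big1 ?addr0.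
    under eq_bigr do rewrite /= ?expr0 invr1 scale1r.
    by rewrite sumr_const card_ord -[X in _ *: X]scaler_nat scalerA mulVf
      // scale1r.
  move=> k k0; rewrite -scaler_suml.
  have -> : \sum_(r < T) (z ^+ r) ^- k = \sum_(r < T) (z ^- k) ^+ r.
    by apply: eq_bigr => r _; rewrite exprVn exprAC.
  rewrite geomsum ?scale0r // ?exprVn ?zXT ?invr1 //.
  rewrite invr_eq1; by have := @zinj' k (Ordinal T_gt0) k0; rewrite expr0.
Qed.

Let dE := eigen_direct_sum.1.

Lemma eigencompE (r : 'I_T) v : eigencomp g r v = eigenproj r v.
Proof. exact: eigen_direct_sum.2. Qed.

Lemma eigencomp_linear (r : 'I_T) : linear (eigencomp g r).
Proof. exact: (component_linear dE). Qed.

Lemma eigencomp_mem (r : 'I_T) v : eigensp g T r (eigencomp g r v).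
Proof. exact: (component_mem dE). Qed.

Lemma eigencomp_in (r : 'I_T) v : eigensp g T r v -> eigencomp g r v = v.
Proof. exact: (component_in dE). Qed.

Lemma eigencomp_out (r s : 'I_T) v : eigensp g T r v -> r <> s ->
  eigencomp g s v = 0.
Proof. exact: (component_out dE). Qed.

Lemma eigencomp_sum v : v = \sum_(r < T) eigencomp g r v.
Proof.
rewrite -big_enum -(fsum_seq (enum_uniq 'I_T)); last by move=> r;
  rewrite mem_enum.
by case: (component_decomposition dE v).
Qed.

Lemma eigencomp_stable (X : set V) (r : 'I_T) v : is_subspace X ->
  (forall v, X v -> X (g v)) -> X v -> X (eigencomp g r v).
Proof.
move=> sX gX Xv; rewrite eigencompE; apply: subspaceZ => //.
apply: subspace_sum => // k _; apply: subspaceZ => //.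
by elim: (k : nat) => //= n; exact: gX.
Qed.

End Eigenspaces.

Section DualAutomorphism.
Variable R : realType.
Local Notation C := R[i].
Variables (V : lmodType C) (S : voc V) (g : {linear V -> V})
  (gaut : voc_aut S g).
Variable T : nat.
Hypothesis gorder : has_order g T.

Local Notation D := (gdual S).
Local Notation W := (dual_voa S).
Local Notation h := (dual_inv_act gaut).
Let dV := voc_grade S.
Let dl (u : D) : linear u := gdual_linear u.
Let gl : linear g. Proof. by move=> a u v; rewrite linearP. Qed.

Lemma dual_inv_actE (f : D) x : h f x = f (g x). Proof. by []. Qed.

Lemma iter_dual n (f : D) x : iter n h f x = f (iter n g x).
Proof. by elim: n x => //= n IH x; rewrite IH -iterSr. Qed.

Lemma dual_act_linear : linear h.
Proof. by move=> a u v; apply: gdual_ext => x. Qed.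

Lemma dual_order : has_order h T.
Proof.
have [T0 gT gm] := gorder; split=> // [f|n nT].
  by apply: gdual_ext => x; rewrite iter_dual gT.
move=> hn; apply: (gm n nT) => v; apply/eqP; rewrite -subr_eq0; apply/eqP.
apply: (graded_dual_sep dV (gdual_is_dual S)) => d.
by rewrite (linB (dl d)) -iter_dual hn subrr.
Qed.

Lemma dual_aut : voa_aut (W := W) h.
Proof.
have [T0 hT _] := dual_order; have [_ gc gr gD] := gaut.
split; first exact: dual_act_linear.
- exists (iter T.-1 h) => f; first by rewrite -iterSr prednK.
  by rewrite -iterS prednK.
- split; apply: gdual_ext => x; rewrite dual_inv_actE.
    by rewrite !(dual_oneE S) gc.
  by rewrite !(dual_omegaE S) gr.
- move=> u k v; apply: gdual_ext => x.
  rewrite -[RHS]/(gdual_mode (h u) k (h v) x) gdual_modeE.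
  rewrite -[LHS]/(gdual_mode u k v (g x)) gdual_modeE gD.
  by rewrite (tcontr_l_map _ (dl u) gl gl).
Qed.

Lemma dual_act_grade a (f : D) : gdual_grade a f -> gdual_grade a (h f).
Proof.
by move=> fa s x sa xs; rewrite dual_inv_actE;
  apply: fa sa (voc_aut_grade gaut xs).
Qed.

(** Both projections are the same polynomial in the automorphism, and the one
    acting on the dual is a transpose. *)
Lemma dual_eigencompE (r : 'I_T) (u : D) x :
  (eigencomp h r u : D) x = u (eigencomp g r x).
Proof.
have [T0 gT _] := gorder; have [_ hT _] := dual_order.
rewrite (eigencompE dual_act_linear T0 hT) (eigencompE gl T0 gT) /eigenproj.
have ev_l : linear (fun d : D => d x : C^o) by [].
rewrite (linZ ev_l) (lin_sum ev_l) (linZ (dl u)) (lin_sum (dl u));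
  congr (_ *: _).
by apply: eq_bigr => k _; rewrite (linZ ev_l) (linZ (dl u)) iter_dual.
Qed.

Lemma dual_eigen_vanish (r s : 'I_T) (u : D) x :
  eigensp h T r u -> eigensp g T s x -> r <> s -> u x = 0.
Proof.
have [T0 gT _] := gorder; have [_ hT _] := dual_order.
move=> ur xs rs; rewrite -(eigencomp_in dual_act_linear T0 hT ur)
  dual_eigencompE.
by rewrite (eigencomp_out gl T0 gT xs) ?(lin0 (dl u)) // => e; apply: rs.
Qed.

Lemma dual_eigencomp_grade a (r : 'I_T) (u : D) :
  gdual_grade a u -> gdual_grade a (eigencomp h r u : D).
Proof.
have [T0 hT _] := dual_order; move=> ua.
apply: (@eigencomp_stable _ _ _ _ dual_act_linear T0 hT (gdual_grade a)) => //.
  exact: (dual_grade_subspace (gdual_is_dual S)).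
by move=> v; exact: dual_act_grade.
Qed.

End DualAutomorphism.

(** * Twisted modules: commutators, derivative property, Virasoro relations *)

Section Gbin.
Variable R : realType.

Lemma gbin_0 q : gbin R q 0 = 1.
Proof. by rewrite /gbin big_ord0 fact0 divr1 rmorph1. Qed.

Lemma gbin_1 q : gbin R q 1 = ratr q.
Proof. by rewrite /gbin big_ord1 subr0 divr1. Qed.

Lemma gbin0S i : gbin R 0 i.+1 = 0.
Proof. by rewrite /gbin big_ord_recl subrr !mul0r rmorph0. Qed.

Lemma gbin_3 q : gbin R q 3 = ratr (q * (q - 1) * (q - 2) / 6).
Proof.
by rewrite /gbin !big_ord_recr big_ord0 /= mul1r subr0.
Qed.

End Gbin.

Section VertexAlgebra.
Variable R : realType.
Local Notation C := R[i].
Variable W : va_data R.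
Hypothesis Wvoa : is_voa W.
Variable d : C.
Hypothesis Wvir : virasoro (@va_L R W) d.
Local Notation one := (va_one W).
Local Notation om := (va_omega W).

Let moder u k := voa_linear_r Wvoa u k.

Lemma va_L_linear n : linear (@va_L R W n).
Proof. exact: moder. Qed.

Lemma va_L_one n : - 1 <= n -> va_L n one = 0.
Proof.
move=> n1; rewrite /va_L (voa_creation Wvoa); last by rewrite -lerBlDr;
  apply: le_trans n1.
by case: eqP => // e; move: n1; rewrite -(lerD2r 1) e.
Qed.

Lemma va_L_omega : va_L (- 2) one = om.
Proof. by rewrite /va_L (voa_creation Wvoa). Qed.

Lemma va_Lm1 u : va_mode u (- 2) one = va_L (- 1) u.
Proof.
have := voa_Lm1 Wvoa u (- 1) one.
by rewrite (voa_creation Wvoa) //= => ->; rewrite opprK scale1r.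
Qed.

(** From [omega = L(-2) 1] and the Virasoro relations; this gives the products
    [omega_i omega] that enter the commutators of the [L(k)] on modules. *)
Lemma va_L_L2 n : - 1 <= n ->
  va_L n om = (n + 2)%:~R *: va_L (n - 2) one +
    (if n == 2 then d / 2 else 0) *: one.
Proof.
move=> n1; have := Wvir n (- 2) one.
rewrite va_L_omega va_L_one // (lin0 (va_L_linear _)) subr0 => ->.
rewrite opprK subr_eq0; congr (_ + _ *: _).
case: eqP => [->|//]; rewrite (_ : (2 ^+ 3 - 2 : int) = 6) //.
have -> : (12%:R : C) = 6%:R * 2 by rewrite -natrM.
rewrite -[(6 : int)%:~R]/(6%:R : C).
have n6 : (6%:R : C) != 0 by rewrite pnatr_eq0.
by rewrite invfM mulrA divff // mul1r mulrC.
Qed.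

Lemma omega_omega0 : va_mode om 0 om = va_L (- 1) om.
Proof. by []. Qed.

Lemma omega_omega1 : va_mode om 1 om = 2%:R *: om.
Proof.
rewrite -[LHS]/(va_L 0 om) va_L_L2 // add0r sub0r va_L_omega.
by rewrite scale0r addr0.
Qed.

Lemma omega_omega2 : va_mode om 2 om = 0.
Proof.
rewrite -[LHS]/(va_L 1 om) va_L_L2 // scale0r addr0.
by rewrite va_L_one // scaler0.
Qed.

Lemma omega_omega3 : va_mode om 3 om = (d / 2) *: one.
Proof.
rewrite -[LHS]/(va_L 2 om) va_L_L2 // va_L_one ?subrr //.
by rewrite scaler0 add0r.
Qed.

Lemma omega_omega4 (i : nat) : va_mode om i.+4 om = 0.
Proof.
have -> : i.+4%:Z = i.+3%:Z + 1 by rewrite -[1]/(1%N%:Z) -PoszD addn1.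
rewrite -[LHS]/(va_L i.+3 om) va_L_L2 //.
by rewrite va_L_one ?scaler0 ?scale0r ?addr0 // lerBrDr.
Qed.

End VertexAlgebra.

Section TwistedModule.
Variable R : realType.
Local Notation C := R[i].
Variable W : va_data R.
Hypothesis Wvoa : is_voa W.
Variable d : C.
Hypothesis Wvir : virasoro (@va_L R W) d.
Variables (h : W -> W) (T : nat).
Hypothesis haut : voa_aut h.
Hypothesis hord : has_order h T.
Local Notation one := (va_one W).
Local Notation om := (va_omega W).
Variables (N : lmodType C) (m : W -> rat -> N -> N).
Hypothesis Nmod : weak_twisted_module h T m.

Let T_gt0 : (0 < T)%N. Proof. by case: hord. Qed.
Let hT v : iter T h v = v. Proof. by case: hord => _ + _; apply. Qed.
Let hl : linear h. Proof. by case: haut. Qed.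

Lemma tm_linl t n : linear (fun u => m u t n).
Proof. by case: Nmod => -[+ _] _ _ _ _; apply. Qed.

Lemma tm_linr u t : linear (m u t).
Proof. by case: Nmod => -[_ +] _ _ _ _; apply. Qed.

Lemma tm_trunc u n : exists t0 : rat, forall t, t0 < t -> m u t n = 0.
Proof. by case: Nmod => _ _ + _ _; apply. Qed.

Lemma tm_vac t n : m one t n = if t == - 1 then n else 0.
Proof. by case: Nmod => _ _ _ + _; apply. Qed.

Lemma tm_nonint (r : 'I_T) u t n : eigensp h T r u ->
  t - r%:R / T%:R \isn't a Num.int -> m u t n = 0.
Proof. by case: Nmod => _ + _ _ _; move=> H ur tI; apply: (H r) => //. Qed.

Lemma tm_Jac (r : 'I_T) u v n : eigensp h T r u ->
  Jac (- (r%:R / T%:R)) (fun x y => m u (- x - 1) (m v (- y - 1) n))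
    (fun x y => m v (- y - 1) (m u (- x - 1) n))
    (fun x y => m (series_of_modes (va_mode u) v x) (- y - 1) n).
Proof.
case: Nmod => _ _ _ _ H ur.
by have /jacobiE := H r u v (ltn_ord r) ur; apply.
Qed.

(** The coefficient of [z0^-1] in the Jacobi identity. *)
Lemma tm_commutator (r : 'I_T) u v s t n : eigensp h T r u ->
  s - r%:R / T%:R \is a Num.int ->
  m u s (m v t n) - m v t (m u s n) =
  \sum_(i \in [set: nat]) gbin R s i *: m (va_mode u i v) (s + t - i%:R) n.
Proof.
move=> ur sI; have := tm_Jac v n ur (- 1) (- s - 1) (- t - 1).
rewrite /jac1 /jac2 /jac3; have -> : - (- 1) - 1 = 0 :> rat by ring.
rewrite rpred0 (fsum_nat (k := 1)); last first.
  by case=> // i _; rewrite gbin0S mul0r scale0r.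
rewrite (fsum_nat (k := 1)); last first.
  by case=> // i _; rewrite gbin0S mul0r mulr0 scale0r.
rewrite !big_ord1 gbin_0 floor0 expr0z expr0 !mulr1 !scale1r.
have -> : - s - 1 - - (r%:R / T%:R) = - (s - r%:R / T%:R + 1) by ring.
rewrite rpredN rpredD ?rpred1 //.
have -> : - (- s - 1 + -1 + 1 + 0) - 1 = s by ring.
have -> : - (- t - 1 - 0) - 1 = t by ring.
have -> : - (- s - 1 - 0) - 1 = s by ring.
have -> : - (- t - 1 + -1 + 1 + 0) - 1 = t by ring.
move=> ->; apply: eq_fsbigr => i _.
have -> : - (- s - 1) - 1 = s by ring.
congr (_ *: m _ _ _); last by ring.
have -> : - 1 - i%:R = - i%:~R - 1 :> rat by rewrite addrC.
exact: series_of_modesE.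
Qed.

Let Lm1_stable (r : 'I_T) u : eigensp h T r u -> eigensp h T r (va_L (- 1) u).
Proof.
have [_ _ [_ hom] hm] := haut; rewrite /eigensp /va_L /= => ur.
by rewrite hm hom ur (linZ (voa_linear_r Wvoa _ _)).
Qed.

(** In the Jacobi identity with [v] the vacuum, at exponents [1] of [z0] and
    [-1] of [z2], both products vanish. The iterates [u_(-2) 1 = L(-1) u] and
    [u_(-1) 1 = u] remain on the other side. *)
Lemma tm_Lm1 u t n : m (va_L (- 1) u) t n = - ratr t *: m u (t - 1) n.
Proof.
have l1 := lin_comp (tm_linl t n) (va_L_linear Wvoa (- 1)).
have l2 : linear (fun u => - ratr t *: m u (t - 1) n).
  by move=> a u1 u2; rewrite tm_linl scalerDr !scalerA mulrC.
rewrite (eigencomp_sum hl T_gt0 hT u) (lin_sum l1) (lin_sum l2).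
apply: eq_bigr => r _; have ur := eigencomp_mem hl T_gt0 hT r u.
move: (eigencomp h r u) ur => {}u ur.
case: (boolP (t - r%:R / T%:R \is a Num.int)) => tI; last first.
  rewrite (tm_nonint n (Lm1_stable ur) tI) (tm_nonint n ur) ?scaler0 //.
  have -> : t - 1 - r%:R / T%:R = (t - r%:R / T%:R) - 1 by ring.
  by rewrite rpredBr ?rpred1.
have := tm_Jac one n ur 1 (- t - 1) (- 1).
rewrite /jac1 /jac2 /jac3; have -> : - 1 - 1 = (- 2)%:~R :> rat by [].
rewrite intr_int.
have tI' : - t - 1 - - (r%:R / T%:R) \is a Num.int.
  have -> : - t - 1 - - (r%:R / T%:R) = - (t - r%:R / T%:R + 1) by ring.
  by rewrite rpredN rpredD ?rpred1.
rewrite tI' [X in X - _]fsbig1; last first.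
  move=> i _; rewrite tm_vac.
  have -> : - (- 1 - i%:R) - 1 = i%:R :> rat by ring.
  have -> : (i%:R == - 1 :> rat) = false.
    by apply/negbTE/eqP => e; have := ler0n rat i; rewrite e; lra.
  by rewrite (lin0 (tm_linr _ _)) scaler0.
rewrite [X in _ - X]fsbig1; last first.
  move=> i _; rewrite tm_vac.
  have -> : (- (- 1 + 1 + 1 + i%:R) - 1 == - 1 :> rat) = false.
    by apply/negbTE/eqP => e; have := ler0n rat i; lra.
  by rewrite scaler0.
rewrite subrr => /esym; rewrite (fsum_nat (k := 2)); last first.
  case=> [|[|i]] // _.
  have -> : 1 - i.+2%:R = - (i%:Z)%:~R - 1 :> rat.
    by rewrite -addn2 natrD; ring.
  rewrite series_of_modesE (voa_creation Wvoa) ?(lin0 (tm_linl _ _))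
    ?scaler0 //.
have E1 : series_of_modes (va_mode u) one 1 = va_L (- 1) u.
  by rewrite -(va_Lm1 Wvoa) -series_of_modesE.
have E2 : series_of_modes (va_mode u) one 0 = u.
  have := series_of_modesE (va_mode u) one (- 1).
  by rewrite (voa_creation Wvoa).
rewrite big_ord_recl big_ord1 gbin_0 gbin_1 scale1r subr0 E1.
rewrite (_ : 1 - _ = 0 :> rat) // E2.
have -> : - (- 1 + (- t - 1) + 1 + (ord0 : 'I_2)%:R) - 1 = t by rewrite /=;
  ring.
have -> : - (- t - 1) - 1 = t by ring.
have -> : - (- 1 + (- t - 1) + 1 + (lift ord0 (ord0 : 'I_1))%:R) - 1 = t - 1.
  by rewrite lift0 /=; ring.
by move=> /eqP; rewrite addr_eq0 => /eqP ->; rewrite scaleNr.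
Qed.

Let om0 : eigensp h T (Ordinal T_gt0) om.
Proof.
by have [_ _ [_ hom] _] := haut; rewrite /eigensp /= hom expi0 scale1r.
Qed.

Lemma tm_omega_commutator (k : int) v t n :
  m om k%:~R (m v t n) - m v t (m om k%:~R n) =
  \sum_(i \in [set: nat])
    gbin R k%:~R i *: m (va_mode om i v) (k%:~R + t - i%:R) n.
Proof. by apply: (tm_commutator _ _ _ om0); rewrite mul0r subr0 intr_int. Qed.

Lemma tm_L_commutator u t n :
  m om 0 (m u t n) - m u t (m om 0 n) = - ratr t *: m u (t - 1) n.
Proof.
rewrite (tm_omega_commutator 0) (fsum_nat (k := 1)); last first.
  by case=> // i _; rewrite gbin0S scale0r.
by rewrite big_ord1 gbin_0 scale1r subr0 add0r -tm_Lm1.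
Qed.

(** The commutator formula for [omega] with itself. *)
Lemma tm_virasoro : virasoro (fun k => m om (k + 1)%:~R) d.
Proof.
move=> k j n; rewrite tm_omega_commutator (fsum_nat (k := 4)); last first.
  case=> [|[|[|[|i]]]] // _.
  by rewrite (omega_omega4 Wvoa Wvir) (lin0 (tm_linl _ _)) scaler0.
rewrite !big_ord_recr big_ord0 /= add0r gbin_0 scale1r gbin_1 gbin_3.
rewrite omega_omega0 (omega_omega1 Wvoa Wvir) (omega_omega2 Wvoa Wvir).
rewrite (omega_omega3 Wvoa Wvir) tm_Lm1 (lin0 (tm_linl _ _)) scaler0 addr0.
rewrite !(linZ (tm_linl _ _)) tm_vac.
set L := m om (k + j + 1)%:~R n.
have -> : (k + 1)%:~R + (j + 1)%:~R - 0 - 1 = (k + j + 1)%:~R :> rat.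
  by rewrite !intrD; ring.
have -> : (k + 1)%:~R + (j + 1)%:~R - 1 = (k + j + 1)%:~R :> rat.
  by rewrite !intrD; ring.
have -> : ((k + 1)%:~R + (j + 1)%:~R - 3%:R == - 1 :> rat) = (k + j == 0).
  have -> : (k + 1)%:~R + (j + 1)%:~R - 3%:R = (k + j)%:~R - 1 :> rat.
    by rewrite !intrD; ring.
  by rewrite subr_eq addNr intr_eq0.
rewrite -/L scalerA -scalerDl; congr (_ *: _ + _).
  rewrite subr0 -intrD !ratr_int !intrD intrN; ring.
case: eqP => [_|_]; last by rewrite !scaler0 scale0r.
rewrite scalerA; congr (_ *: _).
have -> : (k + 1)%:~R * ((k + 1)%:~R - 1) * ((k + 1)%:~R - 2) / 6 =
   (k ^+ 3 - k)%:~R / 6 :> rat.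
  by congr (_ / _); rewrite intrB rmorphXn /= !intrD; ring.
rewrite fmorph_div /= ratr_int ratr_nat.
by field.
Qed.

End TwistedModule.

(** * From twisted comodules of [V] to twisted modules of [V'] *)

Section ComoduleSeries.
Variable R : realType.
Local Notation C := R[i].
Variables (V : lmodType C) (S : voc V) (g : {linear V -> V})
  (gaut : voc_aut S g).
Variable T : nat.
Hypothesis gorder : has_order g T.
Variables (M : lmodType C) (D : int -> {linear M -> tensor V M}).

Local Notation V' := (gdual S).
Local Notation W := (dual_voa S).
Local Notation h := (dual_inv_act gaut).
Local Notation Y := (comod_series g T D).
Local Notation tau := (coact Y).

Let dV := voc_grade S.
Let dl (u : V') : linear u := gdual_linear u.
Let gl : linear g. Proof. by move=> a u v; rewrite linearP. Qed.
Let T0 : (0 < T)%N. Proof. by case: gorder. Qed.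
Let gT v : iter T g v = v. Proof. by case: gorder => _ + _; apply. Qed.
Let hl := dual_act_linear gaut.
Let hT : forall f, iter T h f = f.
Proof.
by have [_ ? _] := dual_order gaut gorder.
Qed.
Let El r := eigencomp_linear gl T0 gT r.
Let idl : linear (@id M). Proof. by []. Qed.

Lemma comod_series_linear e : linear (Y^~ e).
Proof.
move=> a x y; rewrite /comod_series scaler_sumr -big_split;
  apply: eq_bigr => r _ /=.
case: ifP => _; last by rewrite scaler0 addr0.
by rewrite linearP (tmap_linear (El r) idl).
Qed.

(** Only the part of [u] in the [r]-th eigenspace meets [t - r / T] integral. *)
Lemma tau_sum (u : V') t m :
  tau u t m = \sum_(r < T) if t - r%:R / T%:R \is a Num.int
    then tcontr_l (eigencomp h r u : V')
      (D (Num.floor (t - r%:R / T%:R)) m) else 0.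
Proof.
rewrite /coact /comod_series (lin_sum (tcontr_l_linear (dl u))).
apply: eq_bigr => r _; have ->
  : - (- t - 1) - 1 - r%:R / T%:R = t - r%:R / T%:R by ring.
case: ifP => _; last exact: (lin0 (tcontr_l_linear (dl u))).
rewrite (tcontr_l_map _ (dl u) (El r) idl); congr (tcontr_l _ _).
by apply: funext => x; rewrite -(dual_eigencompE gaut gorder).
Qed.

Lemma eigencomp_dual_other (r s : 'I_T) (u : V') : eigensp h T r u -> s != r ->
  eigencomp h s u = 0.
Proof.
by move=> ur /eqP sr; apply: (eigencomp_out hl T0 hT ur) => e; apply: sr.
Qed.

Lemma tcontr_l0f (U : lmodType C) (x : tensor V U) : tcontr_l (0 : V') x = 0.
Proof.
apply: (@tensor_ext _ V U U _ (fun=> 0)) x => [|a x y|v w].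
- exact: (tcontr_l_linear (dl 0)).
- by rewrite scaler0 addr0.
- by rewrite (tcontr_l_tens (dl 0)) scale0r.
Qed.

Lemma tau_eigen (r : 'I_T) (u : V') t m : eigensp h T r u ->
  tau u t m = if t - r%:R / T%:R \is a Num.int
    then tcontr_l u (D (Num.floor (t - r%:R / T%:R)) m) else 0.
Proof.
move=> ur; rewrite tau_sum (bigD1 r) //= (eigencomp_in hl T0 hT ur) big1
  ?addr0 //.
move=> s sr; case: ifP => // _; rewrite (eigencomp_dual_other ur sr).
exact: tcontr_l0f.
Qed.

Lemma tau_mode (r : 'I_T) (u : V') (k : int) m : eigensp h T r u ->
  tau u (k%:~R + r%:R / T%:R) m = tcontr_l u (D k m).
Proof. by move=> ur; rewrite (tau_eigen _ _ ur) addrK intr_int intrKfloor. Qed.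

Lemma tau_linear (u : V') t : linear (tau u t).
Proof. exact: (coact_linear comod_series_linear t (dl u)). Qed.

Lemma tau_linearl t m : linear (fun u : V' => tau u t m).
Proof.
by move=> a u v; exact: (@coact_lincomb _ _ _ Y a u v t m (dl u) (dl v)).
Qed.

Hypothesis Dtr : forall m, exists k0 : int, forall k, k < k0 -> D k m = 0.

Lemma comod_series_trunc m x : exists k : nat, forall i, (k <= i)%N ->
  Y m (x + i%:R) = 0.
Proof.
have [k0 k0P] := Dtr m; have [k kP] := rat_archi (- x - k0%:~R);
  exists k => i /kP ki.
rewrite /comod_series big1 // => r _ /=; case: ifP => // rI.
rewrite k0P ?(lin0 (tmap_linear (El r) idl)) // -(ltr_int rat) floorK //.
have : 0 <= r%:R / T%:R :> rat by rewrite divr_ge0 // ler0n.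
lra.
Qed.

(** The Jacobi identity of the coaction, tested by [u (x) v (x) Id] for [u]
    homogeneous under the automorphism. *)
Definition tau_Jac := forall (r : 'I_T) (u v : V') m, eigensp h T r u ->
  Jac (- (r%:R / T%:R)) (fun x y => tau v (- y - 1) (tau u (- x - 1) m))
    (fun x y => tau u (- x - 1) (tau v (- y - 1) m))
    (fun x y => tau (series_of_modes (gdual_mode u) v x : V') (- y - 1) m).

Let P1 m x y := tmap id (Y^~ y) (Y m x).
Let P2 m x y := tswap12 (tmap id (Y^~ x) (Y m y)).
Let P3 m x y := tassoc (tmap ((vUps S)^~ x) id (Y m y)).
Let P3r (r : 'I_T) m x y := tmap (eigencomp g r) id (P3 m x y).

Let comod_jacobiE : comod_jacobi S g T D <-> forall m a b c,
  jac1 (P1 m) a b c - jac2 (P2 m) a b c =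
  \sum_(r < T) jac3 (- (r%:R / T%:R)) (P3r r m) a b c.
Proof.
have E m a b c : \sum_(r < T) fmul3 (delta_210 R (- (r%:R / T%:R)))
    (fun a b c => if b == 0 then P3r r m a c else 0) a b c =
    \sum_(r < T) jac3 (- (r%:R / T%:R)) (P3r r m) a b c.
  by apply: eq_bigr => r _; exact: delta_210E.
split=> J m a b c; have := J m a b c.
  by rewrite delta_012E delta_021E => ->; exact: E.
by rewrite -E => <-; rewrite delta_012E delta_021E.
Qed.

Let t1 m : trunc (P1 m).
Proof. exact: coact2_trunc comod_series_linear comod_series_trunc m. Qed.
Let t2 m : trunc (fun x y => P2 m y x).
Proof. exact: coact2_swap_trunc comod_series_linear comod_series_trunc m. Qed.
Let t3 m : trunc (fun x y => P3 m y x).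
Proof.
by apply: coact_iterate_trunc; [exact: comod_series_trunc|exact: vUps_linear].
Qed.
Let t3r r m : trunc (fun x y => P3r r m y x).
Proof.
move=> x y; have [k kP] := t3 m x y; exists k => i /kP; rewrite /P3r => ->.
exact: (lin0 (tmap_linear (El r) (@lin_id _ _))).
Qed.

Let c1 u v m x y : tcontr_l (v : V') (tcontr_l (u : V') (P1 m x y)) =
  tau v (- y - 1) (tau u (- x - 1) m).
Proof. exact: (coact_coact comod_series_linear _ _ _ (dl u) (dl v)). Qed.

Let c2 u v m x y : tcontr_l (v : V') (tcontr_l (u : V') (P2 m x y)) =
  tau u (- x - 1) (tau v (- y - 1) m).
Proof. exact: (coact_swap comod_series_linear _ _ _ (dl u) (dl v)). Qed.

Let c3 u v m x y : tcontr_l (v : V') (tcontr_l (u : V') (P3 m x y)) =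
  tau (series_of_modes (gdual_mode u) v x : V') (- y - 1) m.
Proof.
have := @coact_iterate _ _ _ Y _ _ _ y m (dl u) (dl v) (vUps_linear S x).
rewrite /P3 => ->; congr (coact _ _ _ _); apply: funext => w.
rewrite /vUps /series_of_modes; case: ifP => // _.
exact: (lin0 (tpair_linear (dl u) (dl v))).
Qed.

Let c3r u v r m x y : tcontr_l (v : V') (tcontr_l (u : V') (P3r r m x y)) =
  tcontr_l v (tcontr_l (eigencomp h r u : V') (P3 m x y)).
Proof.
rewrite /P3r (tcontr_l_map _ (dl u) (El r) (@lin_id _ _)).
congr (tcontr_l _ (tcontr_l _ _)).
by apply: funext => z; rewrite (dual_eigencompE gaut gorder).
Qed.

Let c0 v m x y : tcontr_l (v : V') (tcontr_l (0 : V') (P3 m x y)) = 0.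
Proof.
by rewrite tcontr_l0f (lin0 (tcontr_l_linear (dl v))).
Qed.

Let jac30 rho a b c : jac3 rho (fun _ _ => 0 : M) a b c = 0.
Proof.
by rewrite /jac3; case: ifP => // _; rewrite fsbig1 // => i _; rewrite scaler0.
Qed.

(* The contraction kills all eigenspace summands but the one of u. *)
Let rhs (r : 'I_T) (u v : V') m a b c : eigensp h T r u ->
  tcontr_l v (tcontr_l u
    (\sum_(r < T) jac3 (- (r%:R / T%:R)) (P3r r m) a b c)) =
  jac3 (- (r%:R / T%:R))
    (fun x y => tau (series_of_modes (gdual_mode u) v x : V') (- y - 1)
      m) a b c.
Proof.
move=> ur; have l := lin_comp (tcontr_l_linear (W := M) (dl v))
  (tcontr_l_linear (dl u)).
rewrite (lin_sum l) (bigD1 r) //= (jac3_lin l) // big1 ?addr0.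
  by apply: jac3_ext => x y; rewrite c3r (eigencomp_in hl T0 hT ur) c3.
move=> s sr; rewrite (jac3_lin l) //.
rewrite -[RHS](jac30 (- (s%:R / T%:R)) a b c); apply: jac3_ext => x y.
by rewrite c3r (eigencomp_dual_other ur sr) c0.
Qed.

(** Contraction with a homogeneous [u] keeps the summand of the right-hand side
    whose exponent is the one of [u]; such [u] separate tensors. *)
Lemma comod_jacobi_tau : comod_jacobi S g T D <-> tau_Jac.
Proof.
rewrite comod_jacobiE; split=> [J r u v m ur a b c|J m a b c].
  have l := lin_comp (tcontr_l_linear (W := M) (dl v)) (tcontr_l_linear (dl u)).
  rewrite -(rhs _ _ _ _ _ ur) -J (linB l) (jac1_lin l) // (jac2_lin l) //.
  by rewrite (jac1_ext _ _ _ (c1 u v m)) (jac2_ext _ _ _ (c2 u v m)).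
apply: (tensor_eq2 dV (gdual_is_dual S)) => u v.
have l (x : tensor V (tensor V M)) : linear (fun u : V' =>
  tcontr_l v (tcontr_l u x)).
  move=> e u1 u2; rewrite -(tcontr_l_linear (dl v)).
  by rewrite -(tcontr_l_lincomb e x (dl u1) (dl u2)).
rewrite (eigencomp_sum hl T0 hT u) (lin_sum (l _)) [RHS](lin_sum (l _)).
apply: eq_bigr => r _; have ur := eigencomp_mem hl T0 hT r u.
move: (eigencomp h r u : V') ur => {}u ur; rewrite (rhs _ _ _ _ _ ur) -J //.
have l' := lin_comp (tcontr_l_linear (W := M) (dl v)) (tcontr_l_linear (dl u)).
rewrite (linB l') (jac1_lin l') // (jac2_lin l') //.
by rewrite (jac1_ext _ _ _ (c1 u v m)) (jac2_ext _ _ _ (c2 u v m)).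
Qed.

End ComoduleSeries.

Section Shift.
Variables (K : fieldType) (N : lmodType K) (A : nat -> set N) (T : nat).
Hypothesis T_gt0 : (0 < T)%N.
Hypothesis dA : direct_sum A.

(** [phi] is homogeneous of degree [c], for the grading in which [A n] has
    degree [n / T]; there is no component of negative degree. *)
Definition hom_deg (c : rat) (phi : N -> N) := forall n x, A n x ->
  phi x = 0 \/
  exists2 j : nat, j%:R / T%:R = n%:R / T%:R + c :> rat & A j (phi x).

Let TQ : (T%:R : rat) != 0. Proof. by rewrite pnatr_eq0 -lt0n. Qed.

Lemma divT_inj (i j : nat) : i%:R / T%:R = j%:R / T%:R :> rat -> i = j.
Proof. by move/(divIf TQ)/natrI_rat. Qed.

Lemma fin_functional_shift c phi (f : N -> K^o) : linear phi -> hom_deg c phi ->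
  fin_functional A f -> fin_functional A (fun x => f (phi x)).
Proof.
move=> pl pc [fl ff]; split; first exact: lin_comp fl pl.
have [s us sf] := finite_set_seq ff.
pose b (j : nat) := Num.truncn (j%:R - c * T%:R : rat).
apply: (@seq_finite_set _ (map b s)) => n /= [x An nz].
have [e|[j jn Aj]] := pc _ _ An; first by case: nz; rewrite e (lin0 fl).
apply/mapP; exists j; first by apply: sf; exists (phi x).
rewrite /b; have -> : j%:R - c * T%:R = n%:R :> rat; last by rewrite natrK.
by rewrite -[j%:R](divfK TQ) jn mulrDl (divfK TQ) addrK.
Qed.

Lemma degree_lspan (c : rat) v :
  lspan [set w | exists2 j : nat, j%:R / T%:R = c :> rat & A j w] v ->
  v = 0 \/ exists2 j : nat, j%:R / T%:R = c :> rat & A j v.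
Proof.
have [[j jc]|nj] := pselect (exists j : nat, j%:R / T%:R = c :> rat).
  move=> h; right; exists j => //; apply: (lspan_min (grade_subspace dA j)) h.
  by move=> w [i ic Aw]; rewrite (divT_inj (etrans jc (esym ic))).
by move=> [[|n] [a [x [xS ->]]]]; [left; rewrite big_ord0|
  case: (xS ord0) => j jc _; case: nj; exists j].
Qed.

Section DualShift.
Variables (D : lmodType K) (ev : D -> N -> K^o).
Hypothesis evP : is_graded_dual A ev.
Local Notation B := (dual_grade A ev).

Lemma dual_shift c phi (d d' : D) n : hom_deg c phi ->
  (forall x, ev d' x = ev d (phi x)) -> B n d ->
  d' = 0 \/ exists2 j : nat, j%:R / T%:R = n%:R / T%:R - c :> rat & B j d'.
Proof.
move=> pc d'E dn; have evl d0 := graded_dual_linear evP d0.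
have zero i x : A i x -> i%:R / T%:R <> n%:R / T%:R - c :> rat -> ev d' x = 0.
  move=> Ai ne; rewrite d'E; have [->|[j jE Aj]] := pc _ _ Ai;
    first exact: lin0.
  by apply: (dn j) => // jn; apply: ne; rewrite -jn jE addrK.
have [[j jc]|nj] := pselect (exists j : nat,
  j%:R / T%:R = n%:R / T%:R - c :> rat).
  right; exists j => // i x ij Ai; apply: (zero i) => // e; apply: ij.
  by apply: divT_inj; rewrite e jc.
left; have [_ _ _ inj] := evP; apply: inj => x.
rewrite (lin0 (graded_dual_eval_linear evP x)).
apply: (graded_ext dA (evl d') (g := fun=> 0)) => [a y z|i y Ai].
  by rewrite scaler0 addr0.
by apply: (zero i) => // e; apply: nj; exists i.
Qed.

End DualShift.

End Shift.

Section ComoduleToModule.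
Variable R : realType.
Local Notation C := R[i].
Variables (V : lmodType C) (S : voc V) (g : {linear V -> V})
  (gaut : voc_aut S g).
Variable T : nat.
Hypothesis gorder : has_order g T.
Variables (M : lmodType C) (D : int -> {linear M -> tensor V M}) (Mt : nat ->
  set M).
Hypothesis Madm : admissible_comodule S g T D Mt.

Local Notation V' := (gdual S).
Local Notation W := (dual_voa S).
Local Notation h := (dual_inv_act gaut).
Local Notation Y := (comod_series g T D).
Local Notation tau := (coact Y).
Local Notation M' := (gd Mt).

Let dV := voc_grade S.
Let dD := (graded_dual_direct_sum dV (gdual_is_dual S)).1.
Let dl (u : V') : linear u := gdual_linear u.
Let T0 : (0 < T)%N. Proof. by case: gorder. Qed.
Let hl := dual_act_linear gaut.
Let hT : forall f, iter T h f = f.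
Proof.
by have [_ ? _] := dual_order gaut gorder.
Qed.

Lemma comodule_direct_sum : direct_sum Mt. Proof. by case: Madm. Qed.
Let dM := comodule_direct_sum.

Lemma comodule_trunc m : exists k0 : int, forall k, k < k0 -> D k m = 0.
Proof. by case: Madm => -[[tr _] _ _ _] _ _; exact: tr. Qed.

Lemma comodule_tau_Jac : tau_Jac gaut T D.
Proof.
by case: Madm => -[_ J _ _] _ _;
  apply/(comod_jacobi_tau gaut gorder comodule_trunc).
Qed.

Lemma comodule_tau_one t m : tau (va_one W : V') t m =
  if t == - 1 then m else 0.
Proof.
have [[[_ cu] _ _ _] _ _] := Madm.
have -> : gdual_fun (va_one W) = vc S by apply: funext => y; exact: dual_oneE.
rewrite /coact cu; congr (if _ then _ else _).
by rewrite -opprD oppr_eq0 addr_eq0.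
Qed.

(** Contraction with [u] in degree [a] and in one eigenspace leaves a single
    degree of the second factor. *)
Lemma comodule_tau_degree a (u : V') t : gdual_grade a u ->
  hom_deg Mt T (t + 1 - a%:~R) (tau u t).
Proof.
move=> ua n x xn; apply: (degree_lspan T0 dM).
rewrite (tau_sum gaut gorder); apply: subspace_sum => [|r _];
  first exact: lspan_subspace.
case: ifP => rI; last exact: lspan0.
set k := Num.floor _; have kE : k%:~R =
  t - r%:R / T%:R :> rat by rewrite floorK.
have ur : eigensp h T r (eigencomp h r u) by exact: eigencomp_mem hl T0 hT r u.
have ura : gdual_grade a (eigencomp h r u : V') by exact: dual_eigencomp_grade.
move: (eigencomp h r u : V') ur ura => {ua}u ur ua.
set G := lspan _; have [_ _ /(_ k n x xn) Dx] := Madm.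
have sG : is_subspace [set y : tensor V M | G (tcontr_l u y)].
  have [h0 h1] : is_subspace G by exact: lspan_subspace.
  split=> [|b y z hy hz] /=; first by rewrite (lin0 (tcontr_l_linear (dl u))).
  by rewrite (tcontr_l_linear (dl u)); exact: h1.
apply: (lspan_min sG) Dx => y [s ys] /=.
have [rs|/eqP rs] := eqVneq r s; last first.
  have [n' [b [z [zS ->]]]] := ys; rewrite (lin_sum (tcontr_l_linear (dl u))).
  rewrite big1; first exact: lspan0.
  move=> p _; rewrite (linZ (tcontr_l_linear (dl u))).
  have [i [j [v [w [_ [_ vs] _ ->]]]]] := zS p.
  by rewrite (tcontr_l_tens (dl u)) (dual_eigen_vanish gorder ur vs rs)
    scale0r scaler0.
have u0 i v : i <> a -> (vgrade S i `&` eigensp g T s) v -> u v = 0.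
  by move=> ia [vi _]; exact: (ua i).
apply: lspan_mono (tensor_grade_contr (dl u) u0 ys) => w [j jE wj];
  exists j => //.
rewrite -rs kE in jE.
apply: (addrI (a%:~R)); rewrite jE; ring.
Qed.

Lemma tau_fin (f : M') (u : V') t : fin_functional Mt (fun x => f (tau u t x)).
Proof.
have fl := (gd_fin f).1.
have sP : is_subspace [set u : V' | fin_functional Mt (fun x => f (tau u t x))].
  split=> [|a u1 u2 h1 h2] /=.
    rewrite (_ : (fun x => _) = 0); first exact: fin_functional0.
    apply: funext => x; have e : tau (0 : V') t x =
      0 by exact: lin0 (tau_linearl g T D t x).
    by rewrite e; exact: lin0 fl.
  rewrite (_ : (fun x => _) =
    a *: (fun x => f (tau u1 t x) : C^o) + (fun x => f (tau u2 t x))).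
    exact: fin_functionalD.
  by apply: funext => x; rewrite
    [LHS](congr1 f (tau_linearl g T D t x a u1 u2)) fl.
apply: (graded_ind dD sP) u => a u ua.
apply: (fin_functional_shift T0 (tau_linear gorder D u t)
  (comodule_tau_degree t ua)).
exact: gd_fin.
Qed.

Definition comodule_dual_act (u : W) (t : rat) (f : M') : M' :=
  mkgd (tau_fin f u t).
Local Notation act := comodule_dual_act.
Local Notation evM := (@gd_fun C M nat Mt).

Lemma comodule_dual_actE u t f x : act u t f x = f (tau u t x).
Proof. by []. Qed.

Let fl (f : M') : linear f := (gd_fin f).1.

Lemma gd_ext (f f' : M') : (forall x, f x = f' x) -> f = f'.
Proof. by have [_ _ _ inj] := gd_graded_dual Mt; exact: inj. Qed.

Lemma comodule_act_linl t f : linear (fun u => act u t f).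
Proof.
move=> a u v; apply: gd_ext => x.
by rewrite comodule_dual_actE tau_linearl // fl.
Qed.

Lemma comodule_act_linr u t : linear (act u t).
Proof. by move=> a f f'; apply: gd_ext. Qed.

(** On homogeneous arguments a large mode would land in negative degree. *)
Lemma comodule_act_trunc u f : exists t0 : rat, forall t, t0 < t ->
  act u t f = 0.
Proof.
have sP : is_subspace [set u : W | exists t0 : rat, forall t, t0 < t ->
  act u t f = 0].
  split; first by exists 0 => t _; exact: (lin0 (comodule_act_linl t f)).
  move=> a u1 u2 [k1 h1] [k2 h2]; exists (Num.max k1 k2) => k.
  by rewrite gt_max comodule_act_linl => /andP[/h1 -> /h2 ->];
    rewrite scaler0 addr0.
apply: (graded_ind dD sP) u => a u ua /= {sP}.
have sQ : is_subspace [set f | exists t0 : rat, forall t, t0 < t ->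
  act u t f = 0].
  split; first by exists 0 => t _; exact: (lin0 (comodule_act_linr u t)).
  move=> b u1 u2 [k1 h1] [k2 h2]; exists (Num.max k1 k2) => k.
  by rewrite gt_max comodule_act_linr => /andP[/h1 -> /h2 ->];
    rewrite scaler0 addr0.
apply: (graded_ind (graded_dual_direct_sum dM (gd_graded_dual Mt)).1 sQ) f =>
  j f fj /=.
exists (j%:R / T%:R + a%:~R - 1) => t tt.
have [//|[i iE _]] := dual_shift T0 dM (gd_graded_dual Mt) (d' := act u t f)
  (comodule_tau_degree t ua) (comodule_dual_actE u t f) fj.
exfalso; have : 0 <= i%:R / T%:R :> rat by rewrite divr_ge0 // ler0n.
by rewrite iE; move: tt; lra.
Qed.

(** The graded dual of a comodule is a module: every axiom is the transpose of
    one for the operators [tau u t]. *)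
Lemma comodule_dual_admissible :
  admissible_module (W := W) h T act (dual_grade Mt evM).
Proof.
split; last 2 first.
- exact: (graded_dual_direct_sum dM (gd_graded_dual Mt)).1.
- move=> w a t n f aw fn.
  have [|[j jE fj]] := dual_shift T0 dM (gd_graded_dual Mt) (d' := act a t f)
    (comodule_tau_degree t aw) (comodule_dual_actE a t f) fn; first by left.
  by right; exists j => //; rewrite jE; ring.
split; first split.
- exact: comodule_act_linl.
- exact: comodule_act_linr.
- move=> r u t rT ur tI f; apply: gd_ext => x; rewrite comodule_dual_actE.
  have := tau_eigen gorder D t x (r := Ordinal rT) ur;
    rewrite /= (negPf tI) => ->.
  exact: (lin0 (fl f)).
- exact: comodule_act_trunc.
- move=> t f; apply: gd_ext => x; rewrite comodule_dual_actE comodule_tau_one.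
  by case: eqP => // _; exact: lin0.
move=> r u v rT ur; apply/jacobiE => f.
apply: (@Jac_sep _ _ C^o M (fun x (d : M') => d x)).
- by move=> x a d e.
- exact: gd_ext.
- exact: (action_trunc comodule_act_linr comodule_act_trunc).
- exact: (action_trunc comodule_act_linr comodule_act_trunc).
- exact: (iterate_trunc (W := W) comodule_act_linl (@dual_trunc _ _ S)).
move=> x; have tr := comod_series_trunc gorder comodule_trunc.
have tl (w : V') t : linear (tau w t) by exact: tau_linear.
apply: Jac_eq (Jac_lin (fl f) _ _ _
  (comodule_tau_Jac v x (r := Ordinal rT) ur)) => //.
- move=> y z; have [k kP] := coact_trunc S tr x y.
  by exists k => i /kP ->; exact: lin0 (tl _ _).
- move=> y z; have [k kP] := coact_trunc S tr x y.
  by exists k => i /kP ->; exact: lin0 (tl _ _).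
- move=> y z; have [k kP] := coact_trunc S tr x y.
  by exists k => i /kP ->.
Qed.

End ComoduleToModule.

(** * From twisted modules of [V'] to twisted comodules of [V] *)

Section ModuleToComodule.
Variable R : realType.
Local Notation C := R[i].
Variables (V : lmodType C) (S : voc V) (g : {linear V -> V})
  (gaut : voc_aut S g).
Variable T : nat.
Hypothesis gorder : has_order g T.
Local Notation V' := (gdual S).
Local Notation W := (dual_voa S).
Local Notation h := (dual_inv_act gaut).
Variables (N : lmodType C) (m : W -> rat -> N -> N) (Nt : nat -> set N).
Hypothesis Nadm : admissible_module (W := W) h T m Nt.
Local Notation N' := (gd Nt).

Let dV := voc_grade S.
Let dD := (graded_dual_direct_sum dV (gdual_is_dual S)).1.
Let dl (u : V') : linear u := gdual_linear u.
Let gl : linear g. Proof. by move=> a u v; rewrite linearP. Qed.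
Let T0 : (0 < T)%N. Proof. by case: gorder. Qed.
Let gT v : iter T g v = v. Proof. by case: gorder => _ + _; apply. Qed.
Let hl := dual_act_linear gaut.
Let hT : forall f, iter T h f = f.
Proof.
by have [_ ? _] := dual_order gaut gorder.
Qed.
Let El r := eigencomp_linear gl T0 gT r.

Lemma module_direct_sum : direct_sum Nt. Proof. by case: Nadm. Qed.
Let dN := module_direct_sum.
Let dN' := (graded_dual_direct_sum dN (gd_graded_dual Nt)).1.
Lemma module_weak : weak_twisted_module (W := W) h T m.
Proof.
by case: Nadm.
Qed.
Let Nw := module_weak.
Let ml t n := tm_linl Nw t n.
Let mr u t := tm_linr Nw u t.
Let fl (f : N') : linear f := (gd_fin f).1.

Lemma module_degree w (a : V') t : gdual_grade w a ->
  hom_deg Nt T (w%:~R - t - 1) (m a t).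
Proof.
move=> aw n x xn; have [_ _ H] := Nadm; have [|[j jE Nj]] := H w a t n x aw xn;
  first by left.
by right; exists j => //; rewrite jE; ring.
Qed.

Lemma transpose_fin (f : N') (u : W) t : fin_functional Nt (fun x =>
  f (m u t x)).
Proof.
have sP : is_subspace [set u : V' | fin_functional Nt (fun x => f (m u t x))].
  split=> [|a u1 u2 h1 h2] /=.
    rewrite (_ : (fun x => _) = 0); first exact: fin_functional0.
    apply: funext => x; have e : m (0 : V') t x = 0 by exact: lin0 (ml t x).
    by rewrite e; exact: lin0 (fl f).
  rewrite (_ : (fun x => _) =
    a *: (fun x => f (m u1 t x) : C^o) + (fun x => f (m u2 t x))).
    exact: fin_functionalD.
  by apply: funext => x; rewrite [LHS](congr1 f (ml t x a u1 u2)) (fl f).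
apply: (graded_ind dD sP) u => a u ua.
exact: (fin_functional_shift T0 (mr u t) (module_degree t ua) (gd_fin f)).
Qed.

Definition module_transpose (u : W) (t : rat) (f : N') : N' :=
  mkgd (transpose_fin f u t).
Local Notation tr := module_transpose.

Lemma module_transposeE u t f x : tr u t f x = f (m u t x). Proof. by []. Qed.

Lemma transpose_linl t f : linear (fun u => tr u t f).
Proof.
by move=> a u v; apply: gd_ext => x; rewrite module_transposeE ml fl.
Qed.

Lemma transpose_linr u t : linear (tr u t).
Proof. by move=> a f f'; apply: gd_ext. Qed.

Lemma transpose_degree w (u : V') t n f : gdual_grade w u ->
  dual_grade Nt (@gd_fun _ _ _ Nt) n f ->
  tr u t f = 0 \/ exists2 j : nat,
    j%:R / T%:R = n%:R / T%:R + t + 1 - w%:~R :> rat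
    & dual_grade Nt (@gd_fun _ _ _ Nt) j (tr u t f).
Proof.
move=> uw fn; have [|[j jE fj]] := dual_shift T0 dN (gd_graded_dual Nt) (d' :=
  tr u t f)
  (module_degree t uw) (module_transposeE u t f) fn; first by left.
by right; exists j => //; rewrite jE; ring.
Qed.

Lemma transpose_nonint (r : 'I_T) (u : V') t f : eigensp h T r u ->
  t - r%:R / T%:R \isn't a Num.int -> tr u t f = 0.
Proof.
move=> ur tI; apply: gd_ext => x; rewrite module_transposeE.
by rewrite (tm_nonint Nw x ur tI); exact: lin0 (fl f).
Qed.

(** What contraction with [u] of the [V^(r)]-part of the coproduct [Delta_k f]
    has to be; the mode is shifted by [r / T] as in the coaction series. *)
Definition comode (r : 'I_T) (k : int) (f : N') (u : V') : N' :=
  tr (eigencomp h r u : V') (k%:~R + r%:R / T%:R) f.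

Lemma comode_linear r k f : linear (comode r k f).
Proof. exact: lin_comp (transpose_linl _ f) (eigencomp_linear hl T0 hT r). Qed.

Lemma comode_linearr r k u : linear (fun f => comode r k f u).
Proof. exact: transpose_linr. Qed.

Lemma eigencomp_eigencomp (r s : 'I_T) (u : V') :
  eigencomp h r (eigencomp h s u) = if r == s then eigencomp h r u else 0.
Proof.
have us := eigencomp_mem hl T0 hT s u; case: eqVneq => [->|/eqP rs].
  exact: eigencomp_in.
by apply: (eigencomp_out hl T0 hT us) => e; apply: rs.
Qed.

Lemma gdual_bounded : exists s0 : int, forall s (u : V'), s < s0 ->
  gdual_grade s u -> u = 0.
Proof.
by have [s0 h0] := voa_bounded (dual_is_voa S); exists s0 => s u ss us;
  exact: (h0 s ss).
Qed.

(** For [f] in degree [n / T] the value has degree [n / T + t + 1 - i], with [t]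
    the mode, and this must be nonnegative; the degrees of [V] are bounded
    below. *)
Lemma comode_bound r k f : exists s : seq int, uniq s /\
  forall i u, i \notin s -> gdual_grade i u -> comode r k f u = 0.
Proof.
suff [s sP] : exists s : seq int,
    forall i u, i \notin s -> gdual_grade i u -> comode r k f u = 0.
  exists (undup s); split; first exact: undup_uniq.
  by move=> i u; rewrite mem_undup; exact: sP.
have sQ : is_subspace [set f | exists s : seq int,
    forall i u, i \notin s -> gdual_grade i u -> comode r k f u = 0].
  split; first by exists [::] => i u _ _; exact: lin0 (comode_linearr r k u).
  move=> a f1 f2 [s1 h1] [s2 h2]; exists (s1 ++ s2) => i u.
  rewrite mem_cat negb_or => /andP[/h1 e1 /h2 e2] ui.
  by rewrite comode_linearr e1 // e2 // scaler0 addr0.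
apply: (graded_ind dN' sQ) f => n f fn /=.
have [s0 h0] := gdual_bounded.
have [L LP] := rat_archi (n%:R / T%:R + (k%:~R + r%:R / T%:R) + 1 - s0%:~R).
exists [seq s0 + (i%:Z) | i <- iota 0 L] => i u is_ ui.
have [is0|s0i] := ltP i s0.
  by rewrite (h0 _ _ is0 ui); exact: lin0 (comode_linear r k f).
have ura := dual_eigencomp_grade gaut gorder r ui.
have [//|[j jE _]] := transpose_degree (k%:~R + r%:R / T%:R) ura fn.
exfalso; move/negP: is_; apply; apply/mapP; exists `|i - s0|%N; last first.
  by rewrite gez0_abs ?subr_ge0 // [RHS]addrC subrK.
rewrite mem_iota /= add0n ltnNge; apply/negP => Li.
have j0 : 0 <= j%:R / T%:R :> rat by rewrite divr_ge0 // ler0n.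
have := LP _ Li; have -> : (`|i - s0|%N)%:R = i%:~R - s0%:~R :> rat.
  by rewrite -intrB -[in RHS](gez0_abs (_ : 0 <= i - s0)) ?subr_ge0.
by rewrite jE in j0; lra.
Qed.

(** The tensor is assembled from its parts over the eigenspaces [V^(r)], each
    given by canonical elements, so that its degrees are visible. *)
Lemma comode_tensor_homogeneous k n f : dual_grade Nt (@gd_fun _ _ _ Nt) n f ->
  exists2 x : tensor V N', forall u : V',
    tcontr_l u x = \sum_(r < T) comode r k f u
  & lspan [set x | exists r : 'I_T,
      tensor_grade (R := R) intr (fun j : nat => j%:R / T%:R)
        (fun s => vgrade S s `&` eigensp g T r)
          (dual_grade Nt (@gd_fun _ _ _ Nt))
        (n%:R / T%:R + k%:~R + 1 + r%:R / T%:R) x] x.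
Proof.
move=> fn; have one (r : 'I_T) : exists2 x : tensor V N',
    forall u : V', tcontr_l u x = comode r k f u
    & tensor_grade (R := R) intr (fun j : nat => j%:R / T%:R)
        (fun s => vgrade S s `&` eigensp g T r)
          (dual_grade Nt (@gd_fun _ _ _ Nt))
        (n%:R / T%:R + k%:~R + 1 + r%:R / T%:R) x.
  have [s [us sP]] := comode_bound r k f.
  have [x xS xE] := tensor_of_map dV (gdual_is_dual S) (voc_findim S)
    (comode_linear r k f) us sP.
  have tl := tmap_linear (El r) (@lin_id _ N').
  exists (tmap (eigencomp g r) id x) => [u|].
    rewrite (tcontr_l_map _ (dl u) (El r) (@lin_id _ _)).
    rewrite (_ : (fun v => u (eigencomp g r v)) = (eigencomp h r u : V'));
      last first.
      by apply: funext => v; rewrite (dual_eigencompE gaut gorder).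
    by rewrite xE /comode eigencomp_eigencomp eqxx.
  rewrite /tensor_grade; set G := [set y | _].
  have sG : is_subspace [set y : tensor V N' | lspan G
    (tmap (eigencomp g r) id y)].
    have [h0 h1] : is_subspace (lspan G) by exact: lspan_subspace.
    by split=> [|a y z hy hz] /=; rewrite ?(lin0 tl) // tl; exact: h1.
  apply: (lspan_min sG) xS => _ [i [v [d [vi di ->]]]] /=.
  rewrite (tmap_tens (El r) (@lin_id _ _)).
  have ura := dual_eigencomp_grade gaut gorder r di.
  have [e|[j jE cj]] := transpose_degree (k%:~R + r%:R / T%:R) ura fn.
    by rewrite /comode e (lin0 (tens_linr _)); exact: lspan0.
  apply: lspan_in; exists i, j, (eigencomp g r v), (comode r k f d); split=> //.
    by rewrite jE; ring.
  split; last exact: eigencomp_mem.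
  apply: (eigencomp_stable gl T0 gT r (grade_subspace dV i)) => // z.
  exact: voc_aut_grade.
pose x r := s2val (cid2 (one r)).
have xE r (u : V') : tcontr_l u (x r) =
  comode r k f u by exact: (s2valP (cid2 (one r))).
exists (\sum_(r < T) x r) => [u|].
  by rewrite (lin_sum (tcontr_l_linear (dl u))); apply: eq_bigr => r _.
apply: subspace_sum => [|r _]; first exact: lspan_subspace.
by apply: lspan_in; exists r; exact: (s2valP' (cid2 (one r))).
Qed.

Lemma comode_tensor k f : exists x : tensor V N',
  forall u : V', tcontr_l u x = \sum_(r < T) comode r k f u.
Proof.
have sP : is_subspace [set f | exists x : tensor V N',
    forall u : V', tcontr_l u x = \sum_(r < T) comode r k f u].
  split.
    exists 0 => u; rewrite (lin0 (tcontr_l_linear (dl u))) big1 // => r _.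
    exact: lin0 (comode_linearr r k u).
  move=> a f1 f2 [x1 h1] [x2 h2]; exists (a *: x1 + x2) => u.
  rewrite (tcontr_l_linear (dl u)) h1 h2 scaler_sumr -big_split.
  by apply: eq_bigr => r _; rewrite comode_linearr.
apply: (graded_ind dN' sP) f => n f fn.
by have [x xE _] := comode_tensor_homogeneous k fn; exists x.
Qed.

Definition comod_Delta_fun (k : int) (f : N') : tensor V N' :=
  projT1 (cid (comode_tensor k f)).

Lemma comod_Delta_contr k f (u : V') :
  tcontr_l u (comod_Delta_fun k f) = \sum_(r < T) comode r k f u.
Proof. by rewrite /comod_Delta_fun; case: cid. Qed.

Let Teq := @tensor_eq _ _ _ _ dV _ _ (gdual_is_dual S) N'.

Lemma comod_Delta_linear k : linear (comod_Delta_fun k).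
Proof.
move=> a f1 f2; apply: Teq => u.
rewrite (tcontr_l_linear (dl u)) !comod_Delta_contr scaler_sumr -big_split.
by apply: eq_bigr => r _; rewrite comode_linearr.
Qed.

Definition comod_Delta (k : int) : {linear N' -> tensor V N'} :=
  HB.pack (comod_Delta_fun k)
    (GRing.isLinear.Build C N' (tensor V N') _ (comod_Delta_fun k)
      (comod_Delta_linear k)).

Local Notation D := comod_Delta.
Local Notation Y := (comod_series g T D).
Local Notation tau := (coact Y).

(** The coaction is built so that its operators are the transposes of the
    module operators. *)
Lemma comod_Delta_tau (u : V') t f : tau u t f = tr u t f.
Proof.
rewrite (tau_sum gaut gorder) [in RHS](eigencomp_sum hl T0 hT u).
rewrite (lin_sum (transpose_linl t f)); apply: eq_bigr => r _.
have ur := eigencomp_mem hl T0 hT r u.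
case: ifPn => tI; last by rewrite (transpose_nonint f ur tI).
rewrite -[D _ f]/(comod_Delta_fun _ f) comod_Delta_contr (bigD1 r) //=
  big1 ?addr0.
  rewrite /comode eigencomp_eigencomp eqxx floorK //; congr (tr _ _ f); ring.
move=> s sr; rewrite /comode eigencomp_eigencomp (negPf sr).
exact: lin0 (transpose_linl _ f).
Qed.

Lemma comod_Delta_trunc f : exists k0 : int, forall k, k < k0 -> D k f = 0.
Proof.
have sQ : is_subspace [set f | exists k0 : int, forall k, k < k0 -> D k f = 0].
  split; first by exists 0 => k _; exact: linear0.
  move=> b u1 u2 [k1 h1] [k2 h2]; exists (Num.min k1 k2) => k.
  by rewrite lt_min linearP => /andP[/h1 -> /h2 ->]; rewrite scaler0 addr0.
apply: (graded_ind dN' sQ) f => n f fn /=; have [s0 h0] := gdual_bounded.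
exists (s0 - n%:Z - 2) => k kk; apply: Teq => u.
rewrite comod_Delta_contr (lin0 (tcontr_l_linear (dl u))) big1 // => r _.
apply: (graded_ext dD (comode_linear r k f) (g := fun=> 0)) u => [a y z|i u ui].
  by rewrite scaler0 addr0.
have [is0|s0i] := ltP i s0.
  by rewrite (h0 _ _ is0 ui); exact: lin0 (comode_linear r k f).
have ura := dual_eigencomp_grade gaut gorder r ui.
have [//|[j jE _]] := transpose_degree (k%:~R + r%:R / T%:R) ura fn.
exfalso; have j0 : 0 <= j%:R / T%:R :> rat by rewrite divr_ge0 // ler0n.
have T1 : 0 < T%:R :> rat by rewrite ltr0n.
have r1 : r%:R / T%:R < 1 :> rat by rewrite ltr_pdivrMr // mul1r ltr_nat.
have n1 : n%:R / T%:R <= n%:R :> rat.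
  by rewrite ler_pdivrMr // ler_peMr ?ler0n // ler1n.
have : k%:~R < s0%:~R - n%:R - 2 :> rat.
  by move: kk; rewrite -(ltr_int rat) !intrB.
have : s0%:~R <= i%:~R :> rat by rewrite ler_int.
rewrite jE in j0; lra.
Qed.

Lemma comod_Delta_tau_Jac : tau_Jac gaut T D.
Proof.
move=> r u v f ur.
have ctr := comod_series_trunc gorder comod_Delta_trunc.
have tl (w : V') t : linear (tau w t) by exact: tau_linear.
apply: (@Jac_sep _ _ C^o N (fun x (d : N') => d x)).
- by move=> x a d e.
- exact: gd_ext.
- move=> x y; have [k kP] := coact_trunc S ctr f x.
  by exists k => i /kP ->; exact: lin0 (tl _ _).
- move=> x y; have [k kP] := coact_trunc S ctr f x.
  by exists k => i /kP ->; exact: lin0 (tl _ _).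
- move=> x y; have [k kP] := coact_trunc S ctr f x.
  by exists k => i /kP ->.
move=> n; apply: Jac_eq (Jac_lin (fl f) _ _ _ (tm_Jac Nw v n ur)).
- by move=> x y; rewrite !comod_Delta_tau.
- by move=> x y; rewrite !comod_Delta_tau.
- by move=> x y; rewrite !comod_Delta_tau.
- exact: (action_trunc mr (tm_trunc Nw)).
- exact: (action_trunc mr (tm_trunc Nw)).
- exact: (iterate_trunc (W := W) ml (@dual_trunc _ _ S)).
Qed.

Lemma comod_Delta_L k f n : comod_L S g T D k f n =
  f (m (va_omega W) (- k + 1)%:~R n).
Proof.
rewrite /comod_L -module_transposeE -comod_Delta_tau /coact.
have -> : gdual_fun (va_omega W) = vrho S by apply: funext => y;
  exact: dual_omegaE.
congr (gd_fun (tcontr_l _ (comod_series _ _ _ _ _)) n).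
by rewrite intrD intrN; ring.
Qed.

Lemma gd_lincombE a (f f' : N') x : (a *: f + f' : N') x = a *: f x + f' x.
Proof. by []. Qed.

Lemma comod_Delta_L_linear k : linear (comod_L S g T D k).
Proof.
by move=> a f1 f2; apply: gd_ext => n; rewrite gd_lincombE !comod_Delta_L.
Qed.

Let tau_tr u e f : tcontr_l (u : V') (Y f e) = tr u (- e - 1) f.
Proof.
by rewrite -comod_Delta_tau /coact; congr (tcontr_l _ (Y _ _)); ring.
Qed.

Lemma comod_Delta_virasoro : virasoro (comod_L S g T D) (vd S).
Proof.
move=> k j f; apply: gd_ext => n.
have D2 (a b : N') : (a + b) n = a n + b n by [].
have DB (a b : N') : (a - b) n = a n - b n by [].
have DZ c (a : N') : (c *: a) n = c *: a n by [].
rewrite DB D2 !DZ !comod_Delta_L.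
have := tm_virasoro (dual_is_voa S) (dual_virasoro (S := S))
  (dual_aut gaut gorder)
  (dual_order gaut gorder) Nw (- j) (- k) n.
rewrite -(linB (fl f)) => ->.
have -> : - j + - k = - (k + j) by rewrite opprD addrC.
rewrite (linD (fl f)) !(linZ (fl f)) oppr_eq0.
congr (_%:~R *: _ + _ *: _); first by rewrite opprK addrC.
case: eqP => // kj; congr (_%:~R / _ * _).
have -> : j = - k by apply/eqP; rewrite -addr_eq0 addrC kj.
by rewrite opprK.
Qed.

Lemma comod_Delta_weak : weak_twisted_comodule S g T D.
Proof.
have cs k := comod_Delta_L_linear k.
split.
- split; first exact: comod_Delta_trunc.
  move=> f e; have -> : vc S = gdual_fun (va_one W) :> (V -> C^o).
    by apply: funext => y; rewrite dual_oneE.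
  rewrite tau_tr; apply: gd_ext => n; rewrite module_transposeE (tm_vac Nw).
  rewrite -subr_eq0 opprK subrK oppr_eq0.
  by case: eqP => // _; exact: lin0 (fl f).
- exact/(comod_jacobi_tau gaut gorder comod_Delta_trunc)/comod_Delta_tau_Jac.
- exact: comod_Delta_virasoro.
move=> f e; have ratr_e : ratr (e + 1) = - ratr (- e - 1) :> C.
  by rewrite -rmorphN /= opprB addrC opprK.
have e1 : - (e + 1) - 1 = (- e - 1) - 1 :> rat by ring.
split; apply: Teq => u; rewrite /fderiv (linZ (tcontr_l_linear (dl u))) tau_tr
  ratr_e e1.
  rewrite (tcontr_l_map _ (dl u) (vL_linear S 1) (@lin_id _ _)).
  have -> : (fun v => u (vL S 1 v)) = gdual_fun (va_L (- 1) (u : W)).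
    by apply: funext => y; rewrite [RHS]dual_LE opprK.
  rewrite tau_tr; apply: gd_ext => n; rewrite module_transposeE.
  rewrite (tm_Lm1 (dual_is_voa S) (dual_aut gaut gorder)
    (dual_order gaut gorder) Nw).
  exact: linZ (fl f) _ _.
rewrite (linB (tcontr_l_linear (dl u))) tau_tr.
rewrite (tcontr_l_map _ (dl u) (@lin_id _ _) (cs 1)) tau_tr.
apply: gd_ext => n.
have -> : (- ratr (- e - 1) *: tr u (- e - 1 - 1) f : N') n =
    f (- ratr (- e - 1) *: m u (- e - 1 - 1) n) by rewrite (linZ (fl f)).
rewrite -(tm_L_commutator (dual_is_voa S) (dual_aut gaut gorder)
  (dual_order gaut gorder) Nw).
rewrite (linB (fl f)); have DB (a b : N') : (a - b) n = a n - b n by [].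
by rewrite DB module_transposeE !comod_Delta_L module_transposeE addNr.
Qed.

(** The graded dual of a module is a comodule. The Virasoro and derivative
    axioms, which are not part of the definition of a module, transpose the
    consequences of its Jacobi identity. *)
Lemma comod_Delta_admissible :
  admissible_comodule S g T D (dual_grade Nt (@gd_fun _ _ _ Nt)).
Proof.
split; [exact: comod_Delta_weak|exact: dN'|move=> k n f fn].
have [x xE xS] := comode_tensor_homogeneous k fn.
rewrite -[D k f]/(comod_Delta_fun k f) (_ : comod_Delta_fun k f = x) //.
by apply: Teq => u; rewrite comod_Delta_contr xE.
Qed.

End ModuleToComodule.

(** * Finiteness of cyclic submodules in the degree of the generator *)

Section JacobiLeading.
Variable R : realType.
Local Notation C := R[i].

Lemma fsum_subspace (U : lmodType C) (X : set U) (F : nat -> U) :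
  is_subspace X -> (forall i, X (F i)) -> X (\sum_(i \in [set: nat]) F i).
Proof. by move=> sX FX; apply: subspace_sum. Qed.

(** Associativity: the leading term of the first sum of the Jacobi identity is
    expressed by the iterates [Q] once the second sum vanishes. *)
Lemma Jac_leading (U : lmodType C) (X : set U) rho (P1 P2 Q : rat -> rat -> U)
    (s t : rat) (K k : nat) :
  is_subspace X -> Jac rho P1 P2 Q -> (forall x y, X (Q x y)) ->
  - s - 1 - K%:R - rho \is a Num.int ->
  (forall i : nat, P2 (- s - 1 - K%:R - i%:R) (- t - 1 + K%:R + i%:R) = 0) ->
  (forall i : nat, (k < i)%N -> P1 (- s - 1 + i%:R) (- t - 1 - i%:R) = 0) ->
  (forall i : nat, (0 < i <= k)%N ->
    X (P1 (- s - 1 + i%:R) (- t - 1 - i%:R))) ->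
  X (P1 (- s - 1) (- t - 1)).
Proof.
move=> sX J XQ sI P20 P10 XP1.
have := J (K%:R - 1) (- s - 1 - K%:R) (- t - 1).
rewrite /jac1 /jac2 /jac3 sI.
have -> : - (K%:R - 1) - 1 = - K%:R :> rat by ring.
rewrite rpredN natr_int; set q := - K%:R.
have E1 i : - s - 1 - K%:R + (K%:R - 1) + 1 + i = - s - 1 + i :> rat by ring.
have E2 i : - t - 1 + (K%:R - 1) + 1 + i = - t - 1 + K%:R + i :> rat by ring.
rewrite [X in _ - X]fsbig1 => [|i _]; last by rewrite E2 P20 scaler0.
rewrite subr0 (fsum_nat (k := k.+1)) => [|i ki];
  last by rewrite E1 P10 ?scaler0.
rewrite big_ord_recl gbin_0 expr0 mulr1 scale1r E1 addr0 subr0 => /eqP.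
rewrite eq_sym -subr_eq => /eqP <-; apply: subspaceB => //.
  by apply: fsum_subspace => // i; apply: subspaceZ.
apply: subspace_sum => // i _; apply: subspaceZ => //; rewrite E1 lift0.
by apply: XP1; rewrite /= ltn_ord.
Qed.

Lemma graded_linear_family (V U : lmodType C) (I : choiceType) (A : I -> set V)
    (F : I -> V -> U) : direct_sum A -> (forall i, linear (F i)) ->
  exists2 o : V -> U, linear o & forall i v, A i v -> o v = F i v.
Proof.
move=> dA Fl; exists (fun v => \sum_(i \in [set: I]) F i (component A i v)).
  move=> a u v; have [su [us u0 _]] := component_seq dA u.
  have [sv [vs v0 _]] := component_seq dA v.
  pose s := undup (su ++ sv); have ss : uniq s := undup_uniq _.
  have F0 w : (forall i, i \notin s -> component A i w = 0) ->
      \sum_(i \in [set: I]) F i (component A i w) =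
        \sum_(i <- s) F i (component A i w).
    by move=> w0; apply: fsum_seq => // i /w0 ->; exact: lin0.
  have zu i : i \notin s -> component A i u = 0.
    by rewrite mem_undup mem_cat negb_or => /andP[/u0].
  have zv i : i \notin s -> component A i v = 0.
    by rewrite mem_undup mem_cat negb_or => /andP[_ /v0].
  rewrite !F0 //; last first.
    by move=> i is_; rewrite (component_linear dA) zu // zv // scaler0 addr0.
  rewrite scaler_sumr -big_split; apply: eq_bigr => i _ /=.
  by rewrite (component_linear dA) Fl.
move=> i v vi; rewrite (fsum_seq (s := [:: i])) ?big_seq1
  ?(component_in dA vi) //.
move=> j; rewrite inE => ji;
  rewrite (component_out dA vi) ?(lin0 (Fl j)) // => ij.
by rewrite ij eqxx in ji.
Qed.

Lemma fsum_nat_linear (V U : lmodType C) (F : V -> nat -> U) :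
  (forall i, linear (F^~ i)) ->
  (forall v, exists k, forall i, (k <= i)%N -> F v i = 0) ->
  linear (fun v => \sum_(i \in [set: nat]) F v i).
Proof.
move=> Fl Ft a u v; have [ku uP] := Ft u; have [kv vP] := Ft v.
pose k := maxn ku kv.
have uP' i : (k <= i)%N -> F u i = 0 by rewrite geq_max => /andP[/uP].
have vP' i : (k <= i)%N -> F v i = 0 by rewrite geq_max => /andP[_ /vP].
rewrite (fsum_nat uP') (fsum_nat vP') (fsum_nat (k := k)).
  by rewrite scaler_sumr -big_split; apply: eq_bigr => i _ /=; rewrite Fl.
by move=> i ki; rewrite Fl uP' // vP' // scaler0 addr0.
Qed.

End JacobiLeading.

Section Finiteness.
Variable R : realType.
Local Notation C := R[i].
Variables (V : lmodType C) (S : voc V) (g : {linear V -> V})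
  (gaut : voc_aut S g).
Variable T : nat.
Hypothesis gorder : has_order g T.
Local Notation V' := (gdual S).
Local Notation W := (dual_voa S).
Local Notation h := (dual_inv_act gaut).

Let dV := voc_grade S.
Let dD := (graded_dual_direct_sum dV (gdual_is_dual S)).1.
Let dl (u : V') : linear u := gdual_linear u.
Let T0 : (0 < T)%N. Proof. by case: gorder. Qed.
Let TQ : (0 : rat) < T%:R. Proof. by rewrite ltr0n. Qed.
Let hl := dual_act_linear gaut.
Let hT : forall f, iter T h f = f.
Proof.
by have [_ ? _] := dual_order gaut gorder.
Qed.

Lemma gdual_mode_grade a b k (u v : V') : gdual_grade a u -> gdual_grade b v ->
  gdual_grade (a + b - k - 1) (gdual_mode u k v).
Proof.
move=> ua vb s x sE xs; rewrite gdual_modeE.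
apply: (vb _ _ _ (contr_grade k ua xs)) => e; apply: sE.
by rewrite -e; ring.
Qed.

Lemma dual_omega_grade : gdual_grade 2 (va_omega W : V').
Proof.
move=> s x s2 xs; rewrite dual_omegaE vrho_component.
by rewrite (component_out dV xs s2) linear0.
Qed.

(** Modules and comodules are treated together: [c a t] is the degree of [m u t]
    for [u] in degree [a], and [z a] is the mode at which it is zero. *)
Section Cyclic.
Variables (N : lmodType C) (Nt : nat -> set N) (m : V' -> rat -> N -> N).
Hypothesis dN : direct_sum Nt.
Hypothesis ml : forall t n, linear (fun u => m u t n).
Hypothesis mr : forall u t, linear (m u t).
Variable c : int -> rat -> rat.
Hypothesis mdeg : forall a u t, gdual_grade a u -> hom_deg Nt T (c a t) (m u t).
Variable z : int -> rat.
Hypothesis cz : forall a t, c a t = 0 -> t = z a.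
Variables (n : nat) (w : N).
Hypothesis wn : Nt n w.

Definition orbit : set N := lspan [set y | exists u t, y = m u t w].

Hypothesis mw : exists u t, w = m u t w.
Hypothesis massoc : forall u t v s, orbit (m u t (m v s w)).

Lemma stable_orbit : stable (gops Nt (fun p : V' * rat => m p.1 p.2)) orbit.
Proof.
have sO : is_subspace orbit := lspan_subspace _.
apply/stable_gops; split; last first.
  move=> [u t] x Ox /=.
  have sX : is_subspace [set x | orbit (m u t x)].
    have [h0 h1] := sO; split=> [|a y y' hy hy'] /=;
      first by rewrite (lin0 (mr u t)).
    by rewrite mr; exact: h1.
  by apply: (lspan_min sX) Ox => _ [v [s ->]]; exact: massoc.
split=> // x Ox j; have cl := component_linear dN j.
have sX : is_subspace [set x | orbit (component Nt j x)].
  have [h0 h1] := sO; split=> [|a y y' hy hy'] /=; first by rewrite (lin0 cl).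
  by rewrite cl; exact: h1.
apply: (lspan_min sX) Ox => _ [u [t ->]] /=.
have sU : is_subspace [set u | orbit (component Nt j (m u t w))].
  have l := lin_comp cl (ml t w).
  have [h0 h1] := sO; split=> [|a y y' hy hy'] /=; first by rewrite (lin0 l).
  by rewrite l; exact: h1.
apply: (graded_ind dD sU) u => a u ua /=.
have [->|[i _ ui]] := mdeg t ua wn; first by rewrite (lin0 cl); case: sO.
have [<-|/eqP ij] := eqVneq i j.
  by rewrite (component_in dN ui); apply: lspan_in; exists u, t.
by rewrite (component_out dN ui ij); case: sO.
Qed.

Lemma orbit_gen : orbit w.
Proof. by have [u [t e]] := mw; apply: lspan_in; exists u, t. Qed.

(** Degree-preserving operators [m u (z a)] span the degree of [w] in its
    orbit, so a finite-codimensional space of [u] acting by zero suffices. *)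
Lemma orbit_findim (o : V' -> N) (O : set V') : linear o ->
  (forall a u, gdual_grade a u -> o u = m u (z a) w) ->
  (forall u, O u -> o u = 0) -> finite_codim O ->
  exists k (x : 'I_k -> N), orbit `&` Nt n `<=` lspan (range x).
Proof.
move=> ol oE oO [k [x xP]]; exists k, (fun i => o (x i)) => y [Oy yn].
have sx : is_subspace (lspan (range (fun i => o (x i)))) := lspan_subspace _.
have ox u : lspan (range (fun i => o (x i))) (o u).
  have [v vx Ouv] := xP u; have -> : o u = o v.
    by apply/eqP; rewrite -subr_eq0 -(linB ol) oO.
  have [a ->] := (lspan_rangeP x v).1 vx; apply/lspan_rangeP; exists a.
  by rewrite (lin_sum ol); apply: eq_bigr => i _; rewrite (linZ ol).
have cl := component_linear dN n.
have sX : is_subspace [set y | lspan (range (fun i => o (x i)))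
  (component Nt n y)].
  have [h0 h1] := sx; split=> [|a u u' hu hu'] /=; first by rewrite (lin0 cl).
  by rewrite cl; exact: h1.
rewrite -(component_in dN yn); apply: (lspan_min sX) Oy => _ [u [t ->]] /=.
have sU : is_subspace [set u | lspan (range (fun i => o (x i)))
  (component Nt n (m u t w))].
  have l := lin_comp cl (ml t w).
  have [h0 h1] := sx; split=> [|a v v' hv hv'] /=; first by rewrite (lin0 l).
  by rewrite l; exact: h1.
apply: (graded_ind dD sU) u => a u ua /=.
have [->|[i iE ui]] := mdeg t ua wn; first by rewrite (lin0 cl); case: sx.
have [ein|/eqP ij] := eqVneq i n; last first.
  by rewrite (component_out dN ui ij); case: sx.
have c0 : c a t = 0.
  by apply: (addrI (n%:R / T%:R)); rewrite -iE ein addr0.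
rewrite {1}ein in ui; rewrite (component_in dN ui) (cz c0) -(oE _ _ ua).
exact: ox.
Qed.

End Cyclic.

Section LeftModule.
Variables (N : lmodType C) (m : W -> rat -> N -> N) (Nt : nat -> set N).
Hypothesis Nadm : admissible_module (W := W) h T m Nt.

Let dN := module_direct_sum Nadm.
Let Nw := module_weak Nadm.
Let ml t n := tm_linl Nw t n.
Let mr u t := tm_linr Nw u t.
Let Dvoa := dual_is_voa S.
Let haut := dual_aut gaut gorder.
Let hord := dual_order gaut gorder.

(** Downward induction on the mode [t] of [v], the operator applied first: for
    large [t] it kills [w], and otherwise associativity reduces to larger
    modes. *)
Lemma module_orbit_assoc (u v : W) s t (w : N) :
  orbit m w (m u s (m v t w)).
Proof.
have sO : is_subspace (orbit m w) := lspan_subspace _.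
rewrite [u](eigencomp_sum hl T0 hT) (lin_sum (ml _ _)).
apply: subspace_sum => // r _; have ur := eigencomp_mem hl T0 hT r u.
move: (eigencomp h r u : V') ur => {}u ur.
case: (boolP (s - r%:R / T%:R \is a Num.int)) => sI; last first.
  by rewrite (tm_nonint Nw _ ur sI); case: sO.
suff Q k : forall t s, s - r%:R / T%:R \is a Num.int ->
    (forall i, (k <= i)%N -> m v (t + i%:R) w = 0) ->
      orbit m w (m u s (m v t w)).
  have [t0 h0] := tm_trunc Nw v w; have [k kP] := rat_archi (t0 - t).
  by apply: (Q k) => // i /kP ki; apply: h0; lra.
elim: k => {s t sI} [|k IH] t s sI vt.
  by have := vt 0%N isT; rewrite addr0 => ->; rewrite (lin0 (mr u s)); case: sO.
have [t0 h0] := tm_trunc Nw u w; have [K KP] := rat_archi (t0 - s).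
have sE : - (- s - 1) - 1 = s by ring.
have tE : - (- t - 1) - 1 = t by ring.
have := Jac_leading (X := orbit m w) (s := s) (t := t) (K := K) (k := k) sO
  (tm_Jac Nw v w ur); rewrite sE tE; apply.
- by move=> x y; apply: lspan_in; eexists; eexists.
- have -> : - s - 1 - K%:R - - (r%:R / T%:R) =
    - (s - r%:R / T%:R + 1 + K%:R) by ring.
  by rewrite rpredN rpredD ?natr_int // rpredD ?rpred1.
- move=> i; rewrite [X in m v _ X]h0 ?(lin0 (mr _ _)) //.
  have := KP K (leqnn _); have : 0 <= i%:R :> rat by rewrite ler0n.
  lra.
- move=> i ki; have -> : - (- t - 1 - i%:R) - 1 = t + i%:R by ring.
  by rewrite vt // (lin0 (mr _ _)).
- move=> i /andP[i0 ik]; have -> : - (- t - 1 - i%:R) - 1 = t + i%:R by ring.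
  have -> : - (- s - 1 + i%:R) - 1 = s - i%:R by ring.
  apply: IH; first by rewrite addrAC rpredB ?natr_int.
  move=> j kj; rewrite -addrA -natrD; apply: vt.
  by rewrite addnC -[k.+1]addn1 leq_add.
Qed.

(** The zero modes of [O_(l,i)] act by zero in degree [l + i / T]: in the
    Jacobi identity whose iterate side is the residue defining the generator,
    every operator applied first lands in negative degree. *)
Lemma zhu_O_zero l i (w : N) (o : V' -> N) : (i < T)%N ->
  Nt (l * T + i)%N w -> linear o ->
  (forall a u, gdual_grade a u -> o u = m u (a%:~R - 1) w) ->
  forall u, zhu_O (W := W) h T l i u -> o u = 0.
Proof.
move=> iT wn ol oE.
have wdeg : (l * T + i)%:R / T%:R = l%:R + i%:R / T%:R :> rat.
  by rewrite natrD natrM mulrDl mulfK // lt0r_neq0.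
have neg a (u : V') t : gdual_grade a u ->
    l%:R + i%:R / T%:R + (a%:~R - t - 1) < 0 -> m u t w = 0.
  move=> ua lt0; have [//|[j jE _]] := module_degree Nadm t ua wn; exfalso.
  have : 0 <= j%:R / T%:R :> rat by rewrite divr_ge0 // ler0n.
  by rewrite jE wdeg; move: lt0; lra.
have sK : is_subspace [set u : V' | o u = 0].
  by split=> [|a u v /= hu hv]; rewrite /= ?(lin0 ol) // ol hu hv scaler0 addr0.
apply: (lspan_min sK) => x [[u ->]|[r [a [u [v [ua ur ->]]]]]] /=.
  have l1 := lin_comp ol (va_L_linear Dvoa (- 1)).
  have l2 := lin_comp ol (va_L_linear Dvoa 0).
  rewrite (linD ol); have sU : is_subspace
    [set u : W | o (va_L (- 1) u) + o (va_L 0 u) = 0].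
    split=> [|b u1 u2 /= h1 h2]; first by rewrite /= (lin0 l1) (lin0 l2) addr0.
    by rewrite l1 l2 addrACA -scalerDr h1 h2 scaler0 addr0.
  apply: (graded_ind dD sU) u => a u ua /=.
  have Lu : gdual_grade (a + 1) (va_L (- 1) (u : W) : V').
    have := gdual_mode_grade (k := 0) dual_omega_grade ua.
    by rewrite subr0 (_ : 2 + a - 1 = a + 1) //; ring.
  rewrite (oE _ _ Lu) (tm_Lm1 Dvoa haut hord Nw).
  have e : o (va_L 0 (u : W)) = (a%:~R : C) *: o u.
    by rewrite -(linZ ol); congr o; apply/(voa_L0 Dvoa).
  rewrite [X in _ + X]e (oE _ _ ua).
  rewrite intrD addrK ratr_int; by rewrite -scalerDl addNr scale0r.
set q := a%:~R - 1 + (zhu_delta i r)%:R + l%:R + r%:R / T%:R : rat.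
set p := (2 * l + zhu_delta i r + zhu_delta i (T - r) + 1)%N.
have ztr (v' : V') : exists k, forall j, (k <= j)%N ->
  gbin R q j *: gdual_mode u (j%:Z - p%:Z) v' = 0.
  have [k0 h0] := dual_trunc u v'; have [k kP] := rat_archi (k0%:~R + p%:R).
  exists k => j /kP kj; rewrite h0 ?scaler0 // -(ltr_int rat) intrB.
  by rewrite ltrBrDr.
have zl : linear (fun v => zhu_circ (W := W) T l i r a u v).
  rewrite /zhu_circ; apply:
    (@fsum_nat_linear _ _ _
    (fun v j => gbin R q j *: gdual_mode u (j%:Z - p%:Z) v)) => //.
  by move=> j b v1 v2; rewrite (gdual_mode_linr (S := S)) scalerDr
    !scalerA mulrC.
have sV : is_subspace [set v : V' | o (zhu_circ (W := W) T l i r a u v) = 0].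
  have lz := lin_comp ol zl.
  by split=> [|b v1 v2 /= h1 h2];
    rewrite /= ?(lin0 lz) // lz h1 h2 scaler0 addr0.
apply: (graded_ind dD sV) v => b v vb /=.
rewrite /zhu_circ (lin_fsum ol); last exact: ztr.
have J := tm_Jac Nw v w ur (p%:R - 1) (- q - 1) (q + 1 - a%:~R - b%:~R - p%:R).
move: J; rewrite /jac1 /jac2 /jac3.
have -> : - (p%:R - 1) - 1 = - p%:R :> rat by ring.
rewrite rpredN natr_int.
have -> : - q - 1 - - (r%:R / T%:R) = - (a%:~R + (zhu_delta i r)%:R + l%:R).
  by rewrite /q; ring.
rewrite rpredN !rpredD ?natr_int ?intr_int //.
have r1 : r%:R / T%:R < 1 :> rat by rewrite ltr_pdivrMr // mul1r ltr_nat.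
have i1 : i%:R / T%:R < 1 :> rat by rewrite ltr_pdivrMr // mul1r ltr_nat.
have r0 : 0 <= r%:R / T%:R :> rat by rewrite divr_ge0 // ler0n.
have i0 : 0 <= i%:R / T%:R :> rat by rewrite divr_ge0 // ler0n.
have dr : i%:R / T%:R < r%:R / T%:R + (zhu_delta i r)%:R :> rat.
  rewrite /zhu_delta; case: (leqP r i) => ri; first by rewrite mulr1n; lra.
  by rewrite addr0 ltr_pM2r ?invr_gt0 // ltr_nat.
have dTr : i%:R / T%:R + r%:R / T%:R < 1 + (zhu_delta i (T - r))%:R :> rat.
  rewrite /zhu_delta; case: (leqP (T - r) i) => ri; first by rewrite mulr1n;
    lra.
  rewrite addr0 -mulrDl -natrD ltr_pdivrMr // mul1r ltr_nat.
  by rewrite addnC -ltn_subRL.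
have pE : p%:R = 2 * l%:R + (zhu_delta i r)%:R + (zhu_delta i (T - r))%:R +
  1 :> rat.
  by rewrite /p natrD natrD natrD natrM.
rewrite fsbig1 => [|k _]; last first.
  rewrite [X in m u _ X](neg b v _ vb) ?(lin0 (mr _ _)) ?scaler0 //.
  have k0 : 0 <= k%:R :> rat by rewrite ler0n.
  by rewrite pE /q; lra.
rewrite fsbig1 => [|k _]; last first.
  rewrite [X in m v _ X](neg a u _ ua) ?(lin0 (mr _ _)) ?scaler0 //.
  have k0 : 0 <= k%:R :> rat by rewrite ler0n.
  by rewrite /q; lra.
rewrite subrr => e; rewrite [RHS]e; apply: eq_fsbigr => k _.
have uv := gdual_mode_grade (k := k%:Z - p%:Z) ua vb.
rewrite (linZ ol) (oE _ _ uv).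
have -> : - (- q - 1) - 1 = q by ring.
congr (_ *: m _ _ _).
  have -> : p%:R - 1 - k%:R = - (k%:Z - p%:Z)%:~R - 1 :> rat by rewrite intrB;
    ring.
  by rewrite series_of_modesE.
by rewrite !intrB !intrD; ring.
Qed.

Lemma module_zhu_findim l i : (i < T)%N ->
  zhu_finite_dim (W := W) h T l i -> forall w, Nt (l * T + i)%N w ->
  exists X, [/\ stable (gops Nt (fun p : V' * rat => m p.1 p.2)) X, X w
    & exists k (x : 'I_k -> N), X `&` Nt (l * T + i)%N `<=` lspan (range x)].
Proof.
move=> iT fin w wn; exists (orbit m w).
have mdeg a (u : V') t : gdual_grade a u ->
  hom_deg Nt T (a%:~R - t - 1) (m u t).
  by move=> ua; exact: (module_degree Nadm t ua).
have gen : exists u t, w = m u t w.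
  by exists (va_one W), (- 1); rewrite (tm_vac Nw) eqxx.
split.
- apply: (stable_orbit dN ml mr mdeg wn) => u t v s; exact: module_orbit_assoc.
- exact: orbit_gen.
- have [o ol oE] := graded_linear_family dD (fun a : int => ml (a%:~R - 1) w).
  apply: (orbit_findim dN ml mdeg (z := fun a => a%:~R - 1) _ wn ol oE _ fin).
    by move=> a t e; apply/eqP; rewrite -subr_eq0 -oppr_eq0 -e; apply/eqP; ring.
  by move=> u; exact: (zhu_O_zero iT wn ol oE).
Qed.

End LeftModule.

Section Comodule.
Variables (M : lmodType C) (D : int -> {linear M -> tensor V M}) (Mt : nat ->
  set M).
Hypothesis Madm : admissible_comodule S g T D Mt.
Local Notation tau := (coact (comod_series g T D)).

Let dM := comodule_direct_sum Madm.
Let Mtr := comodule_trunc Madm.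
Let ml t x := tau_linearl (S := S) g T D t x.
Let mr (u : V') t : linear (tau u t). Proof. exact: tau_linear. Qed.

(** The same induction with the roles exchanged: contractions vanish for very
    negative modes, and the operator applied first is the one of [u]. *)
Lemma comodule_orbit_assoc (v u : V') t s (x : M) :
  orbit tau x (tau v t (tau u s x)).
Proof.
have sO : is_subspace (orbit (fun u : V' => tau u) x) := lspan_subspace _.
have ctr := comod_series_trunc gorder Mtr.
have l := lin_comp (mr v t) (ml s x).
rewrite [u](eigencomp_sum hl T0 hT) (lin_sum l).
apply: subspace_sum => // r _; have ur := eigencomp_mem hl T0 hT r u.
move: (eigencomp h r u : V') ur => {}u ur.
case: (boolP (s - r%:R / T%:R \is a Num.int)) => sI; last first.
  by rewrite (tau_eigen gorder D s x ur) (negPf sI) (lin0 (mr v t)); case: sO.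
suff Q k : forall t s, s - r%:R / T%:R \is a Num.int ->
    (forall i, (k <= i)%N -> tau u (s - i%:R) x = 0) ->
    orbit (fun u : V' => tau u) x (tau v t (tau u s x)).
  have [k kP] := coact_trunc S ctr x (- s - 1).
  apply: (Q k) => // i /kP /(_ u).
  by have -> : - (- s - 1 + i%:R) - 1 = s - i%:R by ring.
elim: k => {s t sI l} [|k IH] t s sI us.
  by have := us 0%N isT; rewrite subr0 => ->; rewrite (lin0 (mr v t)); case: sO.
have [K KP] := coact_trunc S ctr x (- t - 1).
have sE : - (- s - 1) - 1 = s by ring.
have tE : - (- t - 1) - 1 = t by ring.
have := Jac_leading (X := orbit (fun u : V' => tau u) x) (s := s) (t :=
  t) (K := K) (k := k) sO
  (comodule_tau_Jac gorder Madm v x ur); rewrite sE tE; apply.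
- by move=> y z; apply: lspan_in; eexists; eexists.
- have -> : - s - 1 - K%:R - - (r%:R / T%:R) =
    - (s - r%:R / T%:R + 1 + K%:R) by ring.
  by rewrite rpredN rpredD ?natr_int // rpredD ?rpred1.
- move=> i; have -> : - t - 1 + K%:R + i%:R =
    - t - 1 + (K + i)%N%:R by rewrite natrD addrA.
  rewrite KP ?leq_addr //.
  exact: lin0 (mr _ _).
- move=> i ki; have -> : - (- s - 1 + i%:R) - 1 = s - i%:R by ring.
  by rewrite us // (lin0 (mr _ _)).
- move=> i /andP[i0 ik]; have -> : - (- t - 1 - i%:R) - 1 = t + i%:R by ring.
  have -> : - (- s - 1 + i%:R) - 1 = s - i%:R by ring.
  apply: IH; first by rewrite addrAC rpredB ?natr_int.
  move=> j kj; rewrite -[s - _ - _]addrA -opprD -natrD; apply: us.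
  by rewrite addnC -[k.+1]addn1 leq_add.
Qed.

(** Zero modes on [M] are transposes of those on the dual module, where
    [O_(l,i)] acts by zero. *)
Lemma comodule_zhu_findim l i : (i < T)%N ->
  zhu_finite_dim (W := W) h T l i -> forall w, Mt (l * T + i)%N w ->
  exists X, [/\ stable (gops Mt (fun p : V' * rat => tau p.1 p.2)) X, X w
    & exists k (x : 'I_k -> M), X `&` Mt (l * T + i)%N `<=` lspan (range x)].
Proof.
move=> iT fin w wn; exists (orbit (fun u : V' => tau u) w).
have mdeg a (u : V') t : gdual_grade a u ->
  hom_deg Mt T (t + 1 - a%:~R) (tau u t).
  by move=> ua; exact: (comodule_tau_degree gaut gorder Madm t ua).
have gen : exists (u : V') t, w = tau u t w.
  by exists (va_one W), (- 1); rewrite (comodule_tau_one Madm) eqxx.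
split.
- apply: (stable_orbit dM ml mr mdeg wn) => u t v s;
    exact: comodule_orbit_assoc.
- exact: orbit_gen.
have [o ol oE] := graded_linear_family dD (fun a : int => ml (a%:~R - 1) w).
apply: (orbit_findim dM ml mdeg (z := fun a => a%:~R - 1) _ wn ol oE _ fin).
  by move=> a t e; apply/eqP; rewrite -subr_eq0 -e; apply/eqP; ring.
have [dM' _] := graded_dual_direct_sum dM (gd_graded_dual Mt).
have on u : Mt (l * T + i)%N (o u).
  have sP : is_subspace [set u | Mt (l * T + i)%N (o u)].
    have [h0 h1] := grade_subspace dM (l * T + i)%N.
    by split=> [|a u1 u2 hu1 hu2] /=; rewrite ?(lin0 ol) // ol; exact: h1.
  apply: (graded_ind dD sP) u => a u ua /=; rewrite (oE _ _ ua).
  have [->|[j jE uj]] := mdeg _ _ (a%:~R - 1) ua _ _ wn.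
    by case: (grade_subspace dM (l * T + i)%N).
  have jn : j%:R / T%:R = (l * T + i)%N%:R / T%:R :> rat by rewrite jE; ring.
  by rewrite -(divT_inj T0 jn).
move=> u Ou; rewrite -(component_in dM (on u)).
apply: (graded_dual_separates dM (gd_graded_dual Mt)) => f fn.
have fl : linear f := (gd_fin f).1.
have Madm' := comodule_dual_admissible gaut gorder Madm.
have [of_ ofl ofE] := graded_linear_family dD
  (fun a : int => tm_linl (module_weak Madm') (a%:~R - 1) f).
have <- : of_ u w = f (o u).
  have l1 : linear (fun u => of_ u w : C^o) by move=> a u1 u2; rewrite ofl.
  apply: (graded_ext dD l1 (lin_comp fl ol) _ u) => a v va.
  by rewrite (ofE _ _ va) (oE _ _ va).
by rewrite (zhu_O_zero Madm' iT fn ofl ofE Ou).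
Qed.

End Comodule.

End Finiteness.

(** * The equivalence *)

Section Comparison.
Variable R : realType.
Local Notation C := R[i].
Variables (V : lmodType C) (S : voc V) (g : {linear V -> V})
  (gaut : voc_aut S g).
Variable T : nat.
Hypothesis gorder : has_order g T.
Local Notation V' := (gdual S).
Local Notation W := (dual_voa S).
Local Notation h := (dual_inv_act gaut).

Let T0 : (0 < T)%N. Proof. by case: gorder. Qed.
Let hl := dual_act_linear gaut.
Let hT : forall f, iter T h f = f.
Proof.
by have [_ ? _] := dual_order gaut gorder.
Qed.
Let dl (u : V') : linear u := gdual_linear u.

(** A contraction of [Delta_k] with any functional is a sum of modes, one for
    each eigenspace. *)
Lemma subcomodule_stable (M : lmodType C) (D : int -> {linear M -> tensor V M})
    (Mt : nat -> set M) X :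
  admissible_subcomodule D Mt X <->
  stable (gops Mt (fun p : V' * rat => coact (comod_series g T D) p.1 p.2)) X.
Proof.
rewrite stable_gops; split=> -[[sX gX] hX]; split=> //.
  move=> [u t] x Xx /=; rewrite (tau_sum gaut gorder).
  apply: subspace_sum => // r _; case: ifP => _; last by case: sX.
  exact: ((tensor_in_sub (voc_grade S) (gdual_is_dual S) _ sX).1 (hX _ _ Xx)).
move=> k x Xx; apply/(tensor_in_sub (voc_grade S) (gdual_is_dual S) _ sX) => u.
have l : linear (fun u : V' => tcontr_l u (D k x)).
  by move=> a u1 u2; exact: (tcontr_l_lincomb a (D k x) (dl u1) (dl u2)).
rewrite (eigencomp_sum hl T0 hT u) (lin_sum l); apply: subspace_sum => // r _.
have ur := eigencomp_mem hl T0 hT r u.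
by rewrite -(tau_mode gorder D k x ur); exact: (hX (_, _)).
Qed.

Lemma submodule_stable (N : lmodType C) (m : W -> rat -> N -> N) (Nt : nat ->
  set N) X :
  admissible_submodule m Nt X <->
  stable (gops Nt (fun p : V' * rat => m p.1 p.2)) X.
Proof.
rewrite stable_gops; split=> -[gX hX]; split=> //; first by move=> [u t] x;
  exact: hX.
by move=> u t x; exact: (hX (u, t)).
Qed.

Lemma irreducible_subcomoduleE (M : lmodType C) (D : int ->
  {linear M -> tensor V M})
    (Mt : nat -> set M) X :
  irreducible_subcomodule D Mt X <->
  irr (gops Mt (fun p : V' * rat => coact (comod_series g T D) p.1 p.2)) X.
Proof.
by split=> -[/subcomodule_stable sX X0 Xm]; split=> // Y /subcomodule_stable;
  exact: Xm.
Qed.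

Lemma irreducible_submoduleE (N : lmodType C) (m : W -> rat -> N -> N)
    (Nt : nat -> set N) X :
  irreducible_submodule m Nt X <->
  irr (gops Nt (fun p : V' * rat => m p.1 p.2)) X.
Proof.
by split=> -[/submodule_stable sX X0 Xm]; split=> // Y /submodule_stable;
  exact: Xm.
Qed.

Lemma gops_linear (K : fieldType) (U : lmodType K) (A : nat -> set U) (J : Type)
    (phi : J -> U -> U) : direct_sum A -> (forall j, linear (phi j)) ->
  forall j, linear (gops A phi j).
Proof. by move=> dA pl [i|j]; [exact: component_linear|exact: pl]. Qed.

Hypothesis hZhu : forall l i : nat, (i < T)%N ->
  zhu_finite_dim (W := W) h T l i.

Lemma corational_rational : corational S g T ->
  forall (N : lmodType C) (m : W -> rat -> N -> N) (Nt : nat -> set N),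
  admissible_module (W := W) h T m Nt -> completely_reducible_module m Nt.
Proof.
move=> cor N m Nt Nadm; have dN := module_direct_sum Nadm.
have dN' := (graded_dual_direct_sum dN (gd_graded_dual Nt)).1.
have [I [P [dP iP]]] := cor _ _ _ (comod_Delta_admissible gorder Nadm).
pose psi (p : V' * rat) := module_transpose gorder Nadm p.1 p.2.
have psil j : linear (psi j) by exact: transpose_linr.
have psiE : (fun p : V' * rat =>
  coact (comod_series g T (comod_Delta gorder Nadm)) p.1 p.2) = psi.
  by apply: funext => p; apply: funext => f; exact: comod_Delta_tau.
have [||||I' [Q [dQ iQ]]] := @semisimple_transfer _ _ _ _ dN (V' * rat)%type
    (fun p => m p.1 p.2) _ _ _ (gd_graded_dual Nt) psi.
- by move=> p; exact: tm_linr (module_weak Nadm) _ _.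
- by [].
- move=> X sX; apply: (soc_complement (gops_linear dN' psil)) => //.
  by apply: (direct_sum_soc dP) => i; rewrite -psiE;
    exact/irreducible_subcomoduleE.
- move=> n w wn; rewrite (divn_eq n T) in wn *.
  have nT : (n %% T < T)%N by rewrite ltn_mod.
  exact: (module_zhu_findim gorder Nadm nT (hZhu _ nT) wn).
by exists I', Q; split=> // i; apply/irreducible_submoduleE.
Qed.

Lemma rational_corational :
  (forall (N : lmodType C) (m : W -> rat -> N -> N) (Nt : nat -> set N),
    admissible_module (W := W) h T m Nt -> completely_reducible_module m Nt) ->
  corational S g T.
Proof.
move=> rat_ M D Mt Madm; have dM := comodule_direct_sum Madm.
have dM' := (graded_dual_direct_sum dM (gd_graded_dual Mt)).1.
have [I [P [dP iP]]] := rat_ _ _ _ (comodule_dual_admissible gaut gorder Madm).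
pose psi (p : V' * rat) := comodule_dual_act gaut gorder Madm p.1 p.2.
have psil j : linear (psi j) by exact: comodule_act_linr.
have [||||I' [Q [dQ iQ]]] := @semisimple_transfer _ _ _ _ dM (V' * rat)%type
    (fun p => coact (comod_series g T D) p.1 p.2) _ _ _ (gd_graded_dual Mt) psi.
- by move=> p; exact: tau_linear.
- by [].
- move=> X sX; apply: (soc_complement (gops_linear dM' psil)) => //.
  by apply: (direct_sum_soc dP) => i; exact/irreducible_submoduleE.
- move=> n w wn; rewrite (divn_eq n T) in wn *.
  have nT : (n %% T < T)%N by rewrite ltn_mod.
  exact: (comodule_zhu_findim gorder Madm nT (hZhu _ nT) wn).
by exists I', Q; split=> // i; apply/irreducible_subcomoduleE.
Qed.

End Comparison.

Theorem theorem7p12 (R : realType) (V : lmodType R[i]) (S : voc V)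
  (hc : ~ (vgrade S 0 `<=` [set v | vc S v = 0]))
  (hrho : ~ (vgrade S 2 `<=` [set v | vrho S v = 0]))
  (g : {linear V -> V}) (gaut : voc_aut S g)
  (T : nat) (gorder : has_order g T)
  (hZhu : forall l i : nat, (i < T)%N ->
     zhu_finite_dim (W := dual_voa S) (dual_inv_act gaut) T l i) :
  corational S g T <-> rational_voa (W := dual_voa S) (dual_inv_act gaut) T.
Proof.
split=> [cor|[_ _ _ rational]];
  last exact: (rational_corational gorder hZhu rational).
split; [exact: dual_is_voa|exact: dual_aut gorder|exact: dual_order|].
exact: (corational_rational gorder hZhu cor).
Qed.
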